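(* Let $d\ge 2$, $\kappa\ge -1$, let $0<\delta_0\ll 1$, and let $1\le p,q,r\le\infty$ satisfy $\frac1p+\frac1q\ge\frac1r$. Suppose that for some $N$ there is a constant $A>0$ such that $$\|\mathcal B^{\phi_1,\phi_2}_{\delta,\varrho}\|_{L^p\times L^q\to L^r}\le A\,\delta^{-\kappa}$$ for all $0<\delta\le\delta_0$, all $\varrho\in[1/2,2]$ and all $\phi_1,\phi_2\in\mathcal C_N([-1,1])$ (so $A$ is independent of $\delta,\varrho,\phi_1,\phi_2$). Then for every $\epsilon>0$ there is a constant $A_\epsilon$, independent of $\delta$, such that $$\|\widetilde{\mathcal B}_\delta\|_{L^p\times L^q\to L^r}\le A_\epsilon\,\delta^{-\kappa-\epsilon(1+\kappa)}\qquad\text{for all }0<\delta\le\delta_0 .$$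
   Context: $\widehat f(\xi)=\int_{\mathbb R^d} e^{-2\pi i x\cdot\xi}f(x)\,dx$; operators act on Schwartz functions $f,g\in\mathcal S(\mathbb R^d)$. For a bilinear operator $T$, $\|T\|_{L^p\times L^q\to L^r}$ is the best constant $B$ with $\|T(f,g)\|_{L^r(\mathbb R^d)}\le B\|f\|_{L^p(\mathbb R^d)}\|g\|_{L^q(\mathbb R^d)}$ for all $f,g\in\mathcal S(\mathbb R^d)$. The notation $0<\delta_0\ll1$ means that $\delta_0\in(0,1)$ is a fixed, sufficiently small constant. For an interval $I\subset\mathbb R$ and an integer $N\ge 0$, $\mathcal C_N(I)$ is the class of smooth functions $\phi$ on $\mathbb R$ with $\operatorname{supp}\phi\subset I$ and $\sup_{t\in I}|\phi^{(k)}(t)|\le 1$ for $k=0,\dots,N$. For smooth compactly supported $\phi$, $\rho\in\mathbb R$ and $\delta>0$, the operator $S^\phi_{\rho,\delta}$ is defined by $\widehat{S^\phi_{\rho,\delta}f}(\xi)=\phi\big(\frac{|\xi|^2-\rho}{\delta}\big)\widehat f(\xi)$. For $\phi_1,\phi_2$ smooth and supported in $[-1,1]$ and $\varrho\in[1/2,2]$, $$\mathcal B^{\phi_1,\phi_2}_{\delta,\varrho}(f,g)(x)=\sum_{\rho\in\delta\mathbb Z\cap[0,1]}S^{\phi_1}_{\rho,\delta}f(x)\,S^{\phi_2}_{\varrho-\rho,\delta}g(x).$$ Fix $\alpha>0$ and a function $\psi\in C_c^\infty((1/2,2))$ satisfying $\sum_{\delta\in\{2^k:\,k\in\mathbb Z\}}\delta^\alpha\psi(t/\delta)=t^\alpha$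 for all $t>0$. Then $$\widetilde{\mathcal B}_\delta(f,g)(x)=\int_{\mathbb R^d}\int_{\mathbb R^d}e^{2\pi i x\cdot(\xi+\eta)}\,\psi\Big(\frac{1-|\xi|^2-|\eta|^2}{\delta}\Big)\widehat f(\xi)\widehat g(\eta)\,d\xi d\eta .$$ *)

(* Defs.v *)
From HB Require Import structures.
From mathcomp Require Import all_boot all_order all_algebra.
From mathcomp Require Import complex.
From mathcomp Require Import all_classical all_reals all_analysis.

Set Implicit Arguments.
Unset Strict Implicit.
Unset Printing Implicit Defensive.
Import Order.TTheory GRing.Theory Num.Theory.
Import numFieldNormedType.Exports.

Local Open Scope classical_set_scope.
Local Open Scope ring_scope.

Section RowVectorMeasurable.
Variables (R : realType) (n : nat).

Let coord (i : 'I_n) (v : 'rV[R]_n) : R := v ord0 i.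

Let rV_set0 : g_sigma_preimage coord set0.
Proof. exact: sigma_algebra0. Qed.

Let rV_setC A : g_sigma_preimage coord A -> g_sigma_preimage coord (~` A).
Proof. exact: sigma_algebraC. Qed.

Let rV_bigcup (F : (set 'rV[R]_n)^nat) :
  (forall i, g_sigma_preimage coord (F i)) ->
  g_sigma_preimage coord (\bigcup_i (F i)).
Proof. exact: sigma_algebra_bigcup. Qed.

(* The product sigma-algebra; it coincides with the Borel sets of 'rV[R]_n. *)
HB.instance Definition _ := @isMeasurable.Build default_measure_display
  'rV[R]_n (g_sigma_preimage coord) rV_set0 rV_setC rV_bigcup.

Lemma measurable_coord (i : 'I_n) :
  measurable_fun [set: 'rV[R]_n] (fun v : 'rV[R]_n => v ord0 i).
Proof.
move=> _ Y mY; rewrite setTI; apply: sub_sigma_algebra => /=.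
rewrite -bigcup_seq/=; exists i => /=; first by rewrite mem_index_enum.
by exists Y => //; rewrite setTI.
Qed.

Lemma measurable_fun_rV d (T : measurableType d) (f : T -> 'rV[R]_n) :
  (forall i, measurable_fun [set: T] (fun t => f t ord0 i)) ->
  measurable_fun [set: T] f.
Proof.
move=> mf; apply: (@measurability _ _ _ _ _ _
  (\big[setU/set0]_(i < n) preimage_set_system setT (coord i) measurable)) => //.
move=> _ [C + <-]; rewrite -bigcup_seq/= => -[i /= _ [A mA <-]].
by rewrite setTI; have := mf i measurableT A mA; rewrite !setTI.
Qed.

End RowVectorMeasurable.

Section LebesgueMeasure.
Variable R : realType.

Definition consrV n (p : R * 'rV[R]_n) : 'rV[R]_n.+1 :=
  \row_i oapp (p.2 ord0) p.1 (unlift ord0 i).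

Definition unconsrV n (v : 'rV[R]_n.+1) : R * 'rV[R]_n :=
  (v ord0 ord0, \row_j v ord0 (lift ord0 j)).

Lemma consrVK n : cancel (@consrV n) (@unconsrV n).
Proof.
case=> x v; congr pair; first by rewrite mxE unlift_none.
by apply/rowP => j; rewrite !mxE liftK.
Qed.

Lemma measurable_consrV n : measurable_fun setT (@consrV n).
Proof.
apply: measurable_fun_rV => i; rewrite /consrV.
under eq_fun do rewrite mxE.
case: unliftP => [j _|_] /=; last exact: measurable_fst.
exact: measurableT_comp (measurable_coord j) measurable_snd.
Qed.

Lemma measurable_unconsrV n : measurable_fun setT (@unconsrV n).
Proof.
apply/measurable_fun_pairP; split; first exact: measurable_coord.
apply: measurable_fun_rV => j; rewrite /comp/=.
under eq_fun do rewrite mxE.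
exact: measurable_coord.
Qed.

Local Open Scope ereal_scope.

Section step.
Variables (n : nat) (mu : {sigma_finite_measure set 'rV[R]_n -> \bar R}).

Let m : {measure set (measurableTypeR R * 'rV[R]_n)%type -> \bar R} :=
  (@lebesgue_measure R \x mu)%E.

Definition leb_step : set 'rV[R]_n.+1 -> \bar R :=
  pushforward m (@consrV n).

HB.instance Definition _ := Measure.copy leb_step
  (measure_function_pushforward__canonical__measure_function_Measure
     (@lebesgue_measure R \x mu) (@measurable_consrV n)).

Let leb_step_sigma_finite : sigma_finite setT leb_step.
Proof.
have /sigma_finiteP[F [FT ndF mF]] := sigma_finiteT (@lebesgue_measure R).
have /sigma_finiteP[G [GT ndG mG]] := sigma_finiteT mu.
exists (fun i => @unconsrV n @^-1` (F i `*` G i)) => [|i].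
  rewrite -preimage_bigcup -(preimage_setT (@unconsrV n)) -setXTT FT GT.
  congr (_ @^-1` _); apply/seteqP; split=> -[x v]/=.
    move=> [[i _ Fx] [j _ Gv]]; exists (maxn i j) => //; split.
      by move: x Fx; exact/subsetPset/ndF/leq_maxl.
    by move: v Gv; exact/subsetPset/ndG/leq_maxr.
  by move=> [i _ [Fx Gv]]; split; exists i.
have [mFi Fioo] := mF i; have [mGi Gioo] := mG i; split.
  rewrite -[X in measurable X]setTI; apply: measurable_unconsrV => //.
  exact: measurableX.
rewrite /leb_step /pushforward -comp_preimage.
rewrite (_ : _ \o _ = id); last by apply/funext => p; exact: consrVK.
by rewrite /= product_measure1E// lte_mul_pinfty// ge0_fin_numE.
Qed.

HB.instance Definition _ :=
  Measure_isSigmaFinite.Build _ _ _ leb_step leb_step_sigma_finite.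

End step.

Fixpoint leb n : {sigma_finite_measure set 'rV[R]_n -> \bar R} :=
  if n is n'.+1 then leb_step (leb n') else \d_(0%R : 'rV[R]_0).

Lemma leb_box n (a b : 'rV[R]_n) : (forall i, a ord0 i <= b ord0 i)%R ->
  leb n [set v | forall i, a ord0 i <= v ord0 i <= b ord0 i]%R =
  (\prod_(i < n) (b ord0 i - a ord0 i))%:E.
Proof.
elim: n a b => [|n IH] a b ab /=.
  by rewrite big_ord0 diracE mem_set// => -[].
pose a' : 'rV[R]_n := \row_j a ord0 (lift ord0 j).
pose b' : 'rV[R]_n := \row_j b ord0 (lift ord0 j).
rewrite /leb_step /pushforward/=.
set P := preimage _ _.
have -> : P = `[a ord0 ord0, b ord0 ord0]%classic `*`
    [set v : 'rV[R]_n | forall i, a' ord0 i <= v ord0 i <= b' ord0 i]%R.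
  apply/seteqP; split=> [[x v]/= H|[x v]/= [H1 H2] i]; first split.
  - by have := H ord0; rewrite mxE unlift_none/= in_itv.
  - by move=> i; have := H (lift ord0 i); rewrite !mxE liftK.
  - rewrite mxE; case: unliftP => [j ->|->] /=; last by move: H1; rewrite in_itv.
    by have := H2 j; rewrite !mxE.
rewrite product_measure1E//; last first.
  rewrite (_ : [set _ | _] = \bigcap_(i in [set: 'I_n])
    ((fun v : 'rV[R]_n => v ord0 i) @^-1` `[a' ord0 i, b' ord0 i])); last first.
    apply/seteqP; split=> v/= H i; first by move=> _; rewrite /= in_itv/= H.
    by have := H i I; rewrite /= in_itv.
  apply: fin_bigcap_measurable => // i _.
  rewrite -[X in measurable X]setTI.
  exact: measurable_coord.
rewrite (IH a' b'); last by move=> i; rewrite !mxE.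
rewrite big_ord_recl EFinM; congr (_ * _); last first.
  by congr EFin; apply: eq_bigr => i _; rewrite !mxE.
apply: etrans (lebesgue_measure_itv _) _; rewrite /= lte_fin -EFinB.
case: ltP => // ba; rewrite (_ : b ord0 ord0 = a ord0 ord0) ?subrr//.
by apply/eqP; rewrite eq_le ba ab.
Qed.

End LebesgueMeasure.

Local Notation Re := (@complex.Re _).
Local Notation Im := (@complex.Im _).
Local Notation normc := ComplexField.Normc.normc.

Section Smoothness.
Variable R : realType.

Definition smoothR (h : R -> R) : Prop := forall k t, derivable h^`(k)%classic t 1.

Definition smoothC (phi : R -> R[i]) : Prop :=
  smoothR (Re \o phi) /\ smoothR (Im \o phi).

Definition derivenC (k : nat) (phi : R -> R[i]) (t : R) : R[i] :=
  Complex ((Re \o phi)^`(k)%classic t) ((Im \o phi)^`(k)%classic t).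

Definition csupport (phi : R -> R[i]) : set R :=
  closure [set t | phi t != 0].

Definition classC (N : nat) (I : set R) (phi : R -> R[i]) : Prop :=
  [/\ smoothC phi, csupport phi `<=` I &
      forall k t, (k <= N)%N -> I t -> normc (derivenC k phi t) <= 1].

Definition test_function (I : set R) (phi : R -> R[i]) : Prop :=
  [/\ smoothC phi, compact (csupport phi) & csupport phi `<=` I].

End Smoothness.

Section Operators.
Variables (R : realType) (d : nat).
Implicit Types (f g : 'rV[R]_d -> R[i]) (x y xi eta : 'rV[R]_d).

(* The Euclidean structure is explicit since `|x| on 'rV[R]_d is the sup norm. *)
Definition dot x y : R := \sum_(i < d) x ord0 i * y ord0 i.

Definition sqnorm x : R := dot x x.

(* Iterated partial derivatives; differentiability (hence continuity) of all of
   them is smoothness. *)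
Definition pderivs (s : seq 'I_d) (h : 'rV[R]_d -> R) : 'rV[R]_d -> R :=
  foldr (fun i u => 'D_(delta_mx ord0 i) u) h s.

Definition schwartzR (h : 'rV[R]_d -> R) : Prop :=
  (forall s x, differentiable (pderivs s h) x) /\
  (forall (a : 'I_d -> nat) s, exists M : R, forall x,
     `|(\prod_(i < d) x ord0 i ^+ a i) * pderivs s h x| <= M).

Definition schwartz f : Prop := schwartzR (Re \o f) /\ schwartzR (Im \o f).

Definition integralC f : R[i] :=
  Complex (\int[leb R d]_x Re (f x)) (\int[leb R d]_x Im (f x)).

Definition normLp (p : \bar R) f : \bar R :=
  Lnorm (leb R d) p (fun x => (normc (f x))%:E).

(* expi t is the complex number e^(it). *)
Definition expi (t : R) : R[i] := Complex (cos t) (sin t).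

Definition fourier f xi : R[i] :=
  integralC (fun x => expi (- (2 * pi * dot x xi)) * f x).

(* The Schwartz function whose Fourier transform is m * fourier f. It is unique
   by Fourier inversion, and it exists for Schwartz f as soon as m is smooth and
   compactly supported; the default value 0 is irrelevant in that case. *)
Definition multiplier (m : 'rV[R]_d -> R[i]) f : 'rV[R]_d -> R[i] :=
  xget (fun=> 0) [set h | schwartz h /\
                          forall xi, fourier h xi = m xi * fourier f xi].

Definition Sop (phi : R -> R[i]) (rho delta : R) :=
  multiplier (fun xi => phi ((sqnorm xi - rho) / delta)).

Definition Bop (phi1 phi2 : R -> R[i]) (delta varrho : R) f g x : R[i] :=
  \sum_(rho \in [set rho : R | (exists k : int, rho = delta * k%:~R) /\
                               0 <= rho <= 1])
    Sop phi1 rho delta f x * Sop phi2 (varrho - rho) delta g x.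

Definition Btilde (psi : R -> R[i]) (delta : R) f g x : R[i] :=
  integralC (fun eta => integralC (fun xi =>
    expi (2 * pi * dot x (xi + eta)) *
    psi ((1 - sqnorm xi - sqnorm eta) / delta) * fourier f xi * fourier g eta)).

(* The best constant in the bound; +oo when T satisfies no such bound. *)
Definition opnorm
    (T : ('rV[R]_d -> R[i]) -> ('rV[R]_d -> R[i]) -> 'rV[R]_d -> R[i])
    (p q r : \bar R) : \bar R :=
  ereal_inf [set B%:E | B in [set B : R | 0 <= B /\
    forall f g, schwartz f -> schwartz g ->
      (normLp r (T f g) <= B%:E * normLp p f * normLp q g)%E]].

End Operators.

Definition dyadic_resolution (R : realType) (alpha : R) (psi : R -> R[i]) :=
  forall t : R, 0 < t ->
    \sum_(delta \in range (fun k : int => (2 : R) ^ k))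
      ((delta `^ alpha)%:C)%C * psi (t / delta) = ((t `^ alpha)%:C)%C.

(* Main.v *)
Require Import Defs.
From mathcomp Require Import all_boot all_order all_algebra.
From mathcomp Require Import complex.
From mathcomp Require Import all_classical all_reals all_analysis.
From mathcomp Require Import measurable_realfun ess_sup_inf ring lra zify.
Set Implicit Arguments.
Unset Strict Implicit.
Unset Printing Implicit Defensive.
Import Order.TTheory GRing.Theory Num.Theory.
Import numFieldNormedType.Exports.
Local Open Scope classical_set_scope.
Local Open Scope ring_scope.

(* Put [delta' = delta / 4]. The dyadic resolution yields a smooth bump [part]
   on ]-1, 1[ whose integer translates sum to 1; with it the unit square of
   frequencies is cut, at scale [delta'], into cells indexed by
   [rho = delta' j] and [varrho - rho], and the support of [psi] leaves only ten
   values of [varrho]. Writing [S = |xi|^2 / delta'], [T = |eta|^2 / delta'] and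
   [X = 1 / delta'], the argument of [psi] is [(X - S - T) / 4], which on the
   relevant cells stays in a bounded interval, so that [psi] can be replaced there
   by its Fourier series of period 8. A character of [S + T] is a product of a
   character of [S] and one of [T]; hence each Fourier mode contributes ten
   operators [Bop], whose cut-offs are [part] times a character. These cut-offs
   lie in the class [classC N] up to a factor polynomial in the frequency, which
   the rapid decay of the Fourier coefficients absorbs. The resulting partial sums
   converge pointwise to [Btilde], and Fatou's lemma in L^r concludes. No loss in
   [delta] occurs beyond a constant. *)

(** The scale [delta / 4] leaves room at the boundary of the square. [Bop] only offers cells with
    [rho] in [0, 1], while each bump spreads over a full cell on either side. Where [psi] is
    nonzero, [2 < X - S - T < 8], so [S] and [T] stay below [X - 2] and the cells with [rho <= 1]
    suffice; at scale [delta] itself the last one could be missing.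

    The period 8 prevents aliasing: [psi] lives in ]1/2, 2[ and its argument on the chosen cells
    lies in [-1/2, 3], so two such points differ by less than the half-period 4.

    [Sop] is a choice among Schwartz functions with a prescribed transform. Nothing is known about
    its values before existence and uniqueness, that is, before Fourier inversion in dimension [d];
    this accounts for the long analytic first half. Inversion is done on real cosine transforms with
    a free phase, so that sines, derivatives and coordinate factors all stay in one family.

    Errors of order [1 / delta] are allowed in the pointwise convergence of the partial sums, since
    [delta] is fixed there; only the L^r bound of the partial sums has to be uniform in [delta]. *)

Local Notation Re := (@complex.Re _).
Local Notation Im := (@complex.Im _).
Local Notation normc := ComplexField.Normc.normc.

(** * Lebesgue measure on row vectors *)

Section LebTools.
Variable R : realType.
Local Notation mu1 := (@lebesgue_measure R).

Let m n : {measure set (measurableTypeR R * 'rV[R]_n)%type -> \bar R} :=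
  (mu1 \x leb R n)%E.

Let mc n : @measurable_fun _ _ (measurableTypeR R * 'rV[R]_n)%type 'rV[R]_n.+1
  setT (@consrV R n).
Proof. exact: measurable_consrV. Qed.

(** [leb R n.+1] is by construction the image of a product measure under [consrV], so this is
    Tonelli after transport. It carries the inductions on the dimension below. *)
Lemma ge0_integral_lebS n (f : 'rV[R]_n.+1 -> \bar R) :
  measurable_fun setT f -> (forall x, 0 <= f x)%E ->
  (\int[leb R n.+1]_x f x = \int[mu1]_t \int[leb R n]_v f (consrV (t, v)))%E.
Proof.
move=> mf f0.
have H := @ge0_integral_pushforward _ _ (measurableTypeR R * 'rV[R]_n)%type 'rV[R]_n.+1
  R (@consrV R n) (@mc n) (m n)
  setT f measurableT mf (fun y _ => f0 y).
have mfc : @measurable_fun _ _ (measurableTypeR R * 'rV[R]_n)%type _ setT (f \o @consrV R n).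
  by apply: measurableT_comp => //; exact: mc.
have H2 := @fubini_tonelli1 _ _ _ _ _ mu1 (leb R n) (f \o @consrV R n) mfc (fun x => f0 _).
rewrite preimage_setT in H.
exact: etrans H H2.
Qed.

Lemma integral_lebS n (f : 'rV[R]_n.+1 -> \bar R) :
  (leb R n.+1).-integrable setT f ->
  (\int[leb R n.+1]_x f x = \int[mu1]_t \int[leb R n]_v f (consrV (t, v)))%E.
Proof.
move=> intf; have mf := measurable_int _ intf.
have intfc : (m n).-integrable (@consrV R n @^-1` setT) (f \o @consrV R n).
  rewrite preimage_setT; apply/integrableP; split.
    by apply: measurableT_comp => //; exact: mc.
  move/integrableP : intf => [_].
  have mf' : measurable_fun setT (abse \o f) by exact: measurableT_comp.
  have H := @ge0_integral_pushforward _ _ (measurableTypeR R * 'rV[R]_n)%type 'rV[R]_n.+1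
  R (@consrV R n) (@mc n) (m n)
    setT (abse \o f) measurableT mf' (fun y _ => abse_ge0 _).
  rewrite preimage_setT in H.
  by move=> H'; apply: le_lt_trans H'; rewrite -H.
have H := @integral_pushforward _ _ (measurableTypeR R * 'rV[R]_n)%type 'rV[R]_n.+1
  R (@consrV R n) (@mc n) (m n)
  setT f mf intfc measurableT.
rewrite preimage_setT in H intfc.
have H2 := integral12_prod_meas1 intfc.
exact: etrans H (esym H2).
Qed.

(** Lebesgue measure is determined by its values on half-open intervals, and [a] times its image
    under [t -> a t + b] has the same ones. *)
Lemma ge0_integral_affine1 (a b : R) (f : R -> \bar R) : 0 < a ->
  measurable_fun (setT : set (measurableTypeR R)) f -> (forall x, 0 <= f x)%E ->
  (a%:E * (\int[mu1]_t f (a * t + b)%R) = \int[mu1]_t f t)%E.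
Proof.
move=> a0 mf f0.
pose phi (t : R) : measurableTypeR R := a * t + b.
have mphi : measurable_fun (setT : set (measurableTypeR R)) phi.
  apply: measurable_funD => //; exact: measurable_funM.
pose A : {nonneg R} := NngNum (ltW a0).
pose pf : {measure set (measurableTypeR R) -> \bar R} :=
  measure_function_pushforward__canonical__measure_function_Measure mu1 mphi.
pose nu : {measure set (measurableTypeR R) -> \bar R} := mscale A pf.
have E X : measurable X -> mu1 X = nu X.
  move=> mX; apply: (lebesgue_measure_unique (mu := nu)) => // _ [[x y] _ <-].
  rewrite /nu /= /mscale/= /pushforward.
  have -> : phi @^-1` `]x, y]%classic = `](x - b) / a, (y - b) / a]%classic.
    apply/seteqP; split => t /=; rewrite /phi !in_itv/= ltr_pdivrMr// ler_pdivlMr// mulrC ltrBlDr lerBrDr => //.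
  rewrite !lebesgue_measure_itv/= !lte_fin ltr_pM2r ?invr_gt0// ltrD2r.
  case: ifPn => _; last by rewrite mule0.
  by rewrite -!EFinB -EFinM; congr EFin; field; rewrite gt_eqF.
transitivity (\int[nu]_t f t)%E; last first.
  by apply: eq_measure_integral => B mB _; first [exact: E|exact/esym/E].
rewrite ge0_integral_mscale//; congr (_ * _)%E.
have := @ge0_integral_pushforward _ _ (measurableTypeR R) (measurableTypeR R) R
  phi (@mphi) mu1 setT f measurableT mf (fun y _ => f0 y).
by rewrite preimage_setT => ->.
Qed.

Lemma consrV_affine n (a : R) (b : 'rV[R]_n.+1) t v :
  a *: consrV (t, v) + b =
  consrV (a * t + (unconsrV b).1, a *: v + (unconsrV b).2).
Proof.
by apply/rowP => i; rewrite !mxE; case: unliftP => [j ->|->]/=; rewrite ?mxE.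
Qed.

Lemma measurable_affine n (a : R) (b : 'rV[R]_n) :
  measurable_fun setT (fun v : 'rV[R]_n => a *: v + b).
Proof.
apply: measurable_fun_rV => i.
under eq_fun do rewrite !mxE.
by apply: measurable_funD => //; apply: measurable_funM => //; exact: measurable_coord.
Qed.

Lemma ge0_integral_affine n (a : R) (b : 'rV[R]_n) (f : 'rV[R]_n -> \bar R) :
  0 < a -> measurable_fun setT f -> (forall x, 0 <= f x)%E ->
  ((a ^+ n)%:E * (\int[leb R n]_x f (a *: x + b)%R) = \int[leb R n]_x f x)%E.
Proof.
move=> a0; elim: n b f => [|n IH] b f mf f0.
  rewrite expr0 mul1e; apply: eq_integral => x _; congr f.
  by apply/rowP => -[].
have mfc : @measurable_fun _ _ (measurableTypeR R * 'rV[R]_n)%type _ setT (f \o @consrV R n).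
  by apply: measurableT_comp => //; exact: mc.
rewrite !ge0_integral_lebS//; last first.
  by apply: measurableT_comp => //; exact: measurable_affine.
under eq_integral => t _ do under eq_integral => v _ do rewrite consrV_affine.
pose G s := (\int[leb R n]_v f (consrV (s, v)))%E.
have mG : measurable_fun (setT : set (measurableTypeR R)) G.
  apply: (@measurable_fun_fubini_tonelli_F _ _ (measurableTypeR R) _ _ (leb R n) (f \o @consrV R n)) => //.
  by move=> ?; exact: f0.
have G0 s : (0 <= G s)%E by apply: integral_ge0.
apply: etrans (ge0_integral_affine1 (unconsrV b).1 a0 mG G0).
rewrite exprS EFinM -muleA; congr (_ * _)%E.
rewrite -ge0_integralZl//; first last.
- by rewrite lee_fin exprn_ge0// ltW.
- by move=> t _; apply: integral_ge0.
- apply: (@measurable_fun_fubini_tonelli_F _ _ (measurableTypeR R) _ _ (leb R n)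
   (fun p => f (consrV (a * p.1 + (unconsrV b).1, a *: p.2 + (unconsrV b).2)))) => //.
  have : measurable_fun setT ((f \o (fun v => a *: v + b)) \o @consrV R n).
    apply: measurableT_comp; last exact: measurable_consrV.
    by apply: measurableT_comp => //; exact: measurable_affine.
  by apply: eq_measurable_fun => -[t v] _ /=; rewrite consrV_affine.
apply: eq_integral => t _; rewrite /G -[RHS](IH (unconsrV b).2)//.
apply: measurableT_comp => //; apply: measurableT_comp; first exact: measurable_consrV.
exact: measurable_fun_pair.
Qed.

End LebTools.

(** * Real-valued integrals: domination, limits and Fubini *)

Section RealIntegral.
Context d (T : measurableType d) (R : realType).
Variable mu : {measure set T -> \bar R}.
Implicit Types f g : T -> R.

Lemma integrable_le f g : measurable_fun setT f -> (forall x, `|f x| <= g x) ->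
  mu.-integrable setT (EFin \o g) -> mu.-integrable setT (EFin \o f).
Proof.
move=> mf fg; apply: le_integrable => //; first exact/measurable_EFinP.
by move=> x _ /=; rewrite lee_fin (le_trans (fg x))// ler_norm.
Qed.

Lemma integrable_mul_bounded f g (C : R) : measurable_fun setT f ->
  (forall x, `|f x| <= C) -> mu.-integrable setT (EFin \o g) ->
  mu.-integrable setT (EFin \o (fun x => f x * g x)).
Proof.
move=> mf fC ig; apply: (@integrable_le _ (fun x => C * `|g x|)).
- apply: measurable_funM => //; apply/measurable_EFinP.
  exact: (measurable_int _ ig).
- by move=> x; rewrite normrM ler_wpM2r.
- exact: (integrableZl measurableT C (integrable_norm ig)).
Qed.

Lemma ler_norm_Rintegral f g : measurable_fun setT f ->
  (forall x, `|f x| <= g x) -> mu.-integrable setT (EFin \o g) ->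
  `|\int[mu]_x f x| <= \int[mu]_x g x.
Proof.
move=> mf fg ig; have if_ := integrable_le mf fg ig.
rewrite (le_trans (le_normr_Rintegral measurableT if_))//.
by apply: le_Rintegral => //; exact: (integrable_norm if_).
Qed.

Lemma Rintegral_cvg (f_ : nat -> T -> R) f g :
  (forall n, measurable_fun setT (f_ n)) ->
  (forall x, f_ ^~ x @ \oo --> f x) ->
  (forall n x, `|f_ n x| <= g x) -> mu.-integrable setT (EFin \o g) ->
  (fun n => \int[mu]_x f_ n x) @ \oo --> \int[mu]_x f x.
Proof.
move=> mf_ cf fg ig.
have mf : measurable_fun setT f by apply: measurable_fun_cvg mf_ _ => x _; exact: cf.
have fg' x : `|f x| <= g x.
  by apply: (cvgr_to_le (cvg_norm (cf x))); apply: nearW => n.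
have cE x : (fun n => (f_ n x)%:E) @ \oo --> (f x)%:E.
  by apply/fine_cvgP; split; [exact: nearW|exact: cf].
have [i1 _ c] := @dominated_convergence _ _ _ mu setT measurableT
  (fun n => EFin \o f_ n) (EFin \o f) (EFin \o g)
  (fun n => (measurable_EFinP _ _).2 (mf_ n)) ((measurable_EFinP _ _).2 mf)
  (nearW _ (fun x _ => cE x)) ig
  (nearW _ (fun x n _ => fg n x)).
have : (fun n => \int[mu]_x (f_ n x)%:E)%E @ \oo --> (\int[mu]_x f x)%:E.
  by rewrite /Rintegral fineK; [exact: c|exact: integrable_fin_num].
by move=> /fine_cvgP[_].
Qed.

End RealIntegral.

Section FubiniReal.
Context d1 d2 (T1 : measurableType d1) (T2 : measurableType d2) (R : realType).
Variables (m1 : {sigma_finite_measure set T1 -> \bar R})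
  (m2 : {sigma_finite_measure set T2 -> \bar R}).

Lemma integrable_prod (f : T1 * T2 -> R) (g : T1 -> R) (h : T2 -> R) :
  measurable_fun setT f ->
  (forall x y, `|f (x, y)| <= g x * h y) ->
  (forall x, 0 <= g x) -> (forall y, 0 <= h y) ->
  m1.-integrable setT (EFin \o g) -> m2.-integrable setT (EFin \o h) ->
  (m1 \x m2)%E.-integrable setT (EFin \o f).
Proof.
move=> mf fgh g0 h0 ig ih; apply/integrable12ltyP; first exact/measurable_EFinP.
have mg : measurable_fun setT g by apply/measurable_EFinP; exact: measurable_int ig.
have mh : measurable_fun setT h by apply/measurable_EFinP; exact: measurable_int ih.
have mfn : measurable_fun setT (fun p => `|f p|%:E) by apply/measurable_EFinP; exact: measurableT_comp.
(* Case analysis on the reflection: the positive case carries the finite integral that is compared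
   with the goal, the negative one contradicts the integrability of [g]. *)
have [|H] := @integrableP _ _ _ m1 setT (EFin \o (fun x => g x * \int[m2]_y h y)).
  move=> [_ H]; apply: le_lt_trans H; apply: ge0_le_integral => //.
  - by move=> x _; apply: integral_ge0.
  - exact: (measurable_fun_fubini_tonelli_F (fun p => `|f p|%:E)).
  - apply/measurable_EFinP; apply: measurableT_comp => //; exact: measurable_funM.
  move=> x _ /=.
  rewrite ger0_norm ?mulr_ge0 ?Rintegral_ge0// EFinM fineK ?integrable_fin_num//.
  rewrite -ge0_integralZl//; first last.
  - by rewrite lee_fin.
  - by move=> y _; rewrite lee_fin.
  - exact/measurable_EFinP.
  apply: ge0_le_integral => //.
  - apply: (measurableT_comp mfn); exact: measurable_fun_pair.
  - by apply/measurable_EFinP; exact: measurable_funM.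
  - by move=> y _ /=; rewrite -EFinM lee_fin.
exfalso; apply: H.
apply/integrableP.
exact: (integrableZr measurableT (\int[m2]_y h y) ig).
Qed.

(** Every slice is assumed integrable, not only almost every one: the real inner integral is [fine]
    of an extended one and must be finite at each point for the two to agree. *)
Lemma Rintegral_fubini (f : T1 * T2 -> R) :
  (m1 \x m2)%E.-integrable setT (EFin \o f) ->
  (forall x, m2.-integrable setT (fun y => (f (x, y))%:E)) ->
  (forall y, m1.-integrable setT (fun x => (f (x, y))%:E)) ->
  \int[m1]_x \int[m2]_y f (x, y) = \int[m2]_y \int[m1]_x f (x, y).
Proof.
move=> iF i1 i2; rewrite /Rintegral; congr fine.
under eq_integral do rewrite fineK ?integrable_fin_num//.
under [RHS]eq_integral do rewrite fineK ?integrable_fin_num//.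
exact: (Fubini iF).
Qed.
End FubiniReal.

Section LebReal.
Variable R : realType.
Local Notation mu1 := (@lebesgue_measure R).

Lemma Rintegral_lebS n (f : 'rV[R]_n.+1 -> R) :
  (leb R n.+1).-integrable setT (EFin \o f) ->
  (forall t, (leb R n).-integrable setT (fun v => (f (consrV (t, v)))%:E)) ->
  \int[leb R n.+1]_x f x = \int[mu1]_t \int[leb R n]_v f (consrV (t, v)).
Proof.
move=> iF i1; rewrite /Rintegral integral_lebS//.
by congr fine; apply: eq_integral => t _; rewrite fineK ?integrable_fin_num.
Qed.

Lemma integrable_affine n (a : R) (b : 'rV[R]_n) (f : 'rV[R]_n -> R) : 0 < a ->
  (leb R n).-integrable setT (EFin \o f) ->
  (leb R n).-integrable setT (EFin \o (fun x => f (a *: x + b))).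
Proof.
move=> a0 ig; have mf := measurable_int _ ig.
have /integrableP[_ fo] := ig.
apply/integrableP; split.
  by apply: measurableT_comp mf _; exact: measurable_affine.
move: fo; rewrite -(ge0_integral_affine b a0)//; last exact: measurableT_comp.
have an : 0 < a ^+ n by rewrite exprn_gt0.
move=> H; rewrite ltNge; apply/negP; rewrite leye_eq => /eqP E.
by move: H; rewrite E gt0_muley ?lte_fin.
Qed.

Lemma Rintegral_affine n (a : R) (b : 'rV[R]_n) (f : 'rV[R]_n -> R) : 0 < a ->
  (leb R n).-integrable setT (EFin \o f) ->
  a ^+ n * \int[leb R n]_x f (a *: x + b) = \int[leb R n]_x f x.
Proof.
move=> a0 ig; have mf := measurable_int _ ig.
have igc := integrable_affine b a0 ig.
apply: EFin_inj; rewrite EFinM /Rintegral !fineK; last 2 first.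
- exact: integrable_fin_num ig.
- exact: integrable_fin_num igc.
have E1 := integralE (leb R n) setT (EFin \o f).
have E2 := integralE (leb R n) setT (EFin \o (fun x => f (a *: x + b))).
rewrite /= in E1 E2; rewrite E1 E2.
rewrite muleBr//; last first.
  exact: (integrable_add_def measurableT igc).
congr (_ - _)%E.
- rewrite -[RHS](ge0_integral_affine b a0 (measurable_funepos mf) (fun x => funepos_ge0 _ x)).
  by congr (_ * _)%E; apply: eq_integral => x _; rewrite !funeposE.
- rewrite -[RHS](ge0_integral_affine b a0 (measurable_funeneg mf) (fun x => funeneg_ge0 _ x)).
  by congr (_ * _)%E; apply: eq_integral => x _; rewrite !funenegE.
Qed.

Lemma Rintegral_translate n (b : 'rV[R]_n) (f : 'rV[R]_n -> R) :
  (leb R n).-integrable setT (EFin \o f) ->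
  \int[leb R n]_x f (x + b) = \int[leb R n]_x f x.
Proof.
move=> ig; rewrite -(Rintegral_affine b (@ltr01 R) ig) expr1n mul1r.
by under [in RHS]eq_Rintegral do rewrite scale1r.
Qed.

Lemma rV_norm_le n (x : 'rV[R]_n) (e : R) : 0 <= e ->
  (forall j, `|x ord0 j| <= e) -> `|x| <= e.
Proof.
move=> e0 xe; rewrite [`|x|](_ : _ = mx_norm x)// mx_normrE; apply/bigmax_leP; split=> // -[i j] _ /=.
by rewrite (ord1 i).
Qed.

Lemma coord_le_norm n (x : 'rV[R]_n) j : `|x ord0 j| <= `|x|.
Proof.
rewrite [`|x|](_ : _ = mx_norm x)// mx_normrE.
exact: (le_bigmax _ (fun ij : 'I_1 * 'I_n => `|x ij.1 ij.2|) (ord0, j)).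
Qed.

(** The sigma-algebra is generated by the coordinates and not by the topology. Rounding each
    coordinate down to a multiple of [1 / m.+1] makes [h \o rnd m] constant on countably many
    measurable cells, and these functions converge to [h] by continuity. *)
Lemma measurable_continuous_rV n (h : 'rV[R]_n -> R) : continuous h ->
  measurable_fun setT h.
Proof.
move=> ch.
pose rnd (m : nat) (x : 'rV[R]_n) : 'rV[R]_n :=
  \row_i ((Num.floor (m.+1%:R * x ord0 i))%:~R / m.+1%:R).
apply: (@measurable_fun_cvg _ _ _ setT (fun m => h \o rnd m)).
  move=> m _ Y mY; rewrite setTI.
  pose cell (k : 'rV[int]_n) : set 'rV[R]_n :=
    [set x | forall i, Num.floor (m.+1%:R * x ord0 i) = k ord0 i].
  pose pt (k : 'rV[int]_n) : 'rV[R]_n := \row_i ((k ord0 i)%:~R / m.+1%:R).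
  have rndE k x : cell k x -> rnd m x = pt k.
    by move=> kx; apply/rowP => i; rewrite !mxE kx.
  have -> : (h \o rnd m) @^-1` Y =
     \bigcup_k (cell k `&` [set _ | Y (h (pt k))]).
    apply/seteqP; split => x /=.
      move=> Yx; exists (\row_i Num.floor (m.+1%:R * x ord0 i)) => //=.
      have cx : cell (\row_i Num.floor (m.+1%:R * x ord0 i)) x by move=> i; rewrite mxE.
      by split => //; rewrite -(rndE _ _ cx).
    by move=> [k _ [kx Yk]]; rewrite /= (rndE _ _ kx).
  apply: countable_bigcupT_measurable; first exact: countableP.
  move=> k; apply: measurableI; last first.
    by case: (pselect (Y (h (pt k)))) => Yk;
      [rewrite (_ : [set _ | _] = setT)|rewrite (_ : [set _ | _] = set0)] => //;
      apply/seteqP; split.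
  have -> : cell k = \bigcap_(i in [set: 'I_n])
      ((fun v : 'rV[R]_n => v ord0 i) @^-1`
       `[(k ord0 i)%:~R / m.+1%:R, (k ord0 i + 1)%:~R / m.+1%:R[).
    apply/seteqP; split => x /=.
      move=> H i _ /=; rewrite in_itv/= -(H i) ler_pdivrMr// ltr_pdivlMr// mulrC.
      exact: floor_itv.
    move=> H i; have := H i I; rewrite /= in_itv/= ler_pdivrMr// ltr_pdivlMr// mulrC.
    by rewrite -floor_eq => /eqP.
  apply: fin_bigcap_measurable => // i _.
  rewrite -[X in measurable X]setTI; exact: measurable_coord.
move=> x _.
apply: (@cvg_comp _ _ _ (fun m => rnd m x) h _ (nbhs x)); last exact: ch.
apply/cvgrPdist_le => e e0; near=> m.
apply: rV_norm_le => [|j]; first exact: ltW.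
rewrite !mxE.
have m0 : (0 : R) < m.+1%:R by rewrite ltr0n.
have /andP[H1 H2] := floor_itv (m.+1%:R * x ord0 j).
have E : x ord0 j = (m.+1%:R * x ord0 j) / m.+1%:R by rewrite mulrC mulrA mulVf ?mul1r ?gt_eqF.
rewrite [X in `|X - _|]E -mulrBl normrM (ger0_norm (_ : 0 <= m.+1%:R^-1)) ?invr_ge0//.
rewrite ler_pdivrMr// ger0_norm ?subr_ge0//.
rewrite intrD in H2.
have : 1 <= e * m.+1%:R.
  rewrite -ler_pdivrMl// mulr1.
  near: m; exists (Num.truncn e^-1) => // m /= H.
  rewrite (le_trans (ltW (truncnS_gt _)))// ler_nat ltnS//.
by move: H2; lra.
Unshelve. all: by end_near. Qed.

(** A product of Cauchy profiles: its integral factors over the coordinates, its powers measure the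
    decay of Schwartz functions, and it is the shape of the Poisson kernel in the inversion
    formula. *)
Definition wt (n : nat) (x : 'rV[R]_n) : R := \prod_(j < n) (1 + x ord0 j ^+ 2)^-1.

Lemma wt_gt0 n (x : 'rV[R]_n) : 0 < wt x.
Proof. by apply: prodr_gt0 => j _; rewrite invr_gt0 ltr_wpDr ?sqr_ge0. Qed.

Lemma measurable_wt n : measurable_fun setT (@wt n).
Proof.
apply: measurable_prod => j _.
apply: (@measurableT_comp _ _ _ _ _ _ (fun t : R => (1 + t ^+ 2)^-1)); last exact: measurable_coord.
apply: continuous_measurable_fun => t.
apply: cvgV; first by rewrite gt_eqF// ltr_wpDr ?sqr_ge0.
by apply: cvgD; [exact: cvg_cst|exact: exprn_continuous].
Qed.

Lemma integral_inv1Dsqr :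
  (\int[mu1]_t ((1 + t ^+ 2)^-1)%:E = (pi : R)%:E)%E.
Proof.
rewrite (@ge0_symfun_integralT _ (fun t : R => (1 + t ^+ 2)^-1)).
- rewrite (_ : [set x | _] = `[0, +oo[%classic); last first.
    by apply/seteqP; split => x/=; rewrite in_itv/= andbT.
  by rewrite integral0y_oneDsqr -EFinM; congr EFin; field.
- by move=> t; rewrite invr_ge0 addr_ge0 ?sqr_ge0.
- exact: continuous_oneDsqrV.
- by move=> t /=; rewrite sqrrN.
Qed.

Lemma consrV0 n t (v : 'rV[R]_n) : consrV (t, v) ord0 ord0 = t.
Proof. by rewrite mxE unlift_none. Qed.

Lemma consrVS n t (v : 'rV[R]_n) j : consrV (t, v) ord0 (lift ord0 j) = v ord0 j.
Proof. by rewrite mxE liftK. Qed.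

Lemma wt_consrV n t (v : 'rV[R]_n) : wt (consrV (t, v)) = (1 + t ^+ 2)^-1 * wt v.
Proof.
rewrite /wt big_ord_recl consrV0; congr (_ * _).
by apply: eq_bigr => j _; rewrite consrVS.
Qed.

Lemma integral_wt n : (\int[leb R n]_x (wt x)%:E = ((pi : R) ^+ n)%:E)%E.
Proof.
elim: n => [|n IH].
  rewrite /= integral_dirac//; last by apply/measurable_EFinP; exact: measurable_wt.
  by rewrite diracT mul1e /wt big_ord0 expr0.
rewrite ge0_integral_lebS; last 2 first.
- by apply/measurable_EFinP; exact: measurable_wt.
- by move=> x; rewrite lee_fin ltW// wt_gt0.
under eq_integral => t _.
  under eq_integral => v _ do rewrite wt_consrV EFinM.
  rewrite ge0_integralZl//; last 3 first.
  - by apply/measurable_EFinP; exact: measurable_wt.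
  - by move=> v _; rewrite lee_fin ltW// wt_gt0.
  - by rewrite lee_fin invr_ge0 addr_ge0 ?sqr_ge0.
  rewrite IH.
  over.
rewrite ge0_integralZr//.
- by rewrite integral_inv1Dsqr -EFinM exprS.
- apply/measurable_EFinP; apply: continuous_measurable_fun; exact: continuous_oneDsqrV.
- by move=> t _; rewrite lee_fin invr_ge0 addr_ge0 ?sqr_ge0.
- by rewrite lee_fin exprn_ge0// pi_ge0.
Qed.

Lemma integrable_wt n : (leb R n).-integrable setT (EFin \o @wt n).
Proof.
apply/integrableP; split; first by apply/measurable_EFinP; exact: measurable_wt.
under eq_integral do rewrite gee0_abs ?lee_fin ?(ltW (wt_gt0 _))//.
by rewrite integral_wt ltry.
Qed.

Lemma integrable_le_wt n (C : R) (f : 'rV[R]_n -> R) : measurable_fun setT f ->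
  (forall x, `|f x| <= C * wt x) -> (leb R n).-integrable setT (EFin \o f).
Proof.
move=> mf fC; apply: (integrable_le mf fC).
exact: (integrableZl measurableT C (integrable_wt n)).
Qed.

(* Peetre's inequality: the weight varies slowly under bounded translations. *)
Lemma wt_shift n (x y : 'rV[R]_n) : (forall j, `|y ord0 j| <= 1) ->
  wt (x + y) <= 3 ^+ n * wt x.
Proof.
move=> y1; have -> : 3 ^+ n = \prod_(j < n) 3 :> R by rewrite prodr_const card_ord.
rewrite /wt -big_split/=.
apply: ler_prod => j _; rewrite invr_ge0 addr_ge0 ?sqr_ge0//=.
have p (t : R) : 0 < 1 + t ^+ 2 by rewrite ltr_wpDr ?sqr_ge0.
rewrite -(ler_pM2r (p (x ord0 j))) mulfVK ?gt_eqF// mulrC ler_pdivrMr// mxE.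
have := y1 j; rewrite ler_norml => /andP[].
move: (x ord0 j) (y ord0 j) => a b b1 b2.
have : b ^+ 2 <= 1 by nra.
(* [3 (1 + (a + b)^2) - (1 + a^2)] is half of this square plus [2 - 3 b^2 / 2], and [b^2 <= 1]. *)
have : 0 <= (2 * a + 3 * b) ^+ 2 by exact: sqr_ge0.
by nra.
Qed.

End LebReal.

(** * Smooth and Schwartz functions *)

Section Smooth.
Variables (R : realType) (n : nat).
Implicit Types (h f g : 'rV[R]_n -> R) (i j : 'I_n).
Local Notation e_ i := (delta_mx ord0 i : 'rV[R]_n).

Definition smoothV h := forall s x, differentiable (pderivs s h) x.

Lemma pderivs_in (P : ('rV[R]_n -> R) -> Prop) :
  (forall h i, P h -> P ('D_(e_ i) h)) -> forall s h, P h -> P (pderivs s h).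
Proof. by move=> PD; elim=> [//|i s IH] h Ph /=; apply: PD; exact: IH. Qed.

Lemma pderivs_D s h i : pderivs s ('D_(e_ i) h) = pderivs (rcons s i) h.
Proof. by rewrite /pderivs foldr_rcons. Qed.

(** Exhibiting a class closed under each partial derivative treats all orders at once; no formula
    for higher derivatives of a product or a composition is required. *)
Lemma smoothV_class (P : ('rV[R]_n -> R) -> Prop) :
  (forall h, P h -> forall x, differentiable h x) ->
  (forall h i, P h -> P ('D_(e_ i) h)) -> forall h, P h -> smoothV h.
Proof. by move=> Pd PD h Ph s x; apply: Pd; exact: pderivs_in. Qed.

Lemma smoothV_D h i : smoothV h -> smoothV ('D_(e_ i) h).
Proof. by move=> sh s x; rewrite pderivs_D. Qed.

Lemma smoothV_differentiable h x : smoothV h -> differentiable h x.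
Proof. by move=> /(_ [::]). Qed.

Lemma smoothV_continuous h : smoothV h -> continuous h.
Proof. by move=> sh x; apply: differentiable_continuous; exact: smoothV_differentiable. Qed.

Lemma smoothV_cst (c : R) : smoothV (cst c).
Proof.
apply: (@smoothV_class (fun h => exists c, h = cst c)); last by exists c.
- by move=> _ [k ->] x; exact: differentiable_cst.
- by move=> _ i [k ->]; exists 0; apply/funext => x; rewrite derive_cst.
Qed.

Lemma derive_coord j (v : 'rV[R]_n) : 'D_v (fun x : 'rV[R]_n => x ord0 j) = cst (v ord0 j).
Proof.
apply/funext => x; rewrite deriveE; last exact: differentiable_coord.
have @f : {linear 'rV[R]_n -> R}.
  by exists (fun N : 'rV[R]_n => N ord0 j); do 2![eexists]; do ?[constructor];
     rewrite ?mxE// => ? *; rewrite ?mxE//; move=> ?; rewrite !mxE.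
rewrite (_ : (fun _ => _) = f) // diff_lin//; exact/coord_continuous.
Qed.

Lemma smoothV_coord j : smoothV (fun x => x ord0 j).
Proof.
move=> s x; case: (lastP s) => [|{}s i]; first exact: differentiable_coord.
by rewrite -pderivs_D derive_coord; exact: smoothV_cst.
Qed.

Lemma derive_comp1 (phi : R -> R) h x v :
  derivable phi (h x) 1 -> differentiable h x ->
  'D_v (phi \o h) x = phi^`()%classic (h x) * 'D_v h x.
Proof.
move=> /derivable1_diffP dphi dh.
rewrite deriveE; last exact: differentiable_comp.
by rewrite diff_comp//= diff1E// deriveE// mulrC.
Qed.

(** The sum, product and chain rules express a derivative by the same operations, so this closure
    meets the conditions of [smoothV_class]. *)
Inductive smooth_gen : ('rV[R]_n -> R) -> Prop :=
| sg_base h of smoothV h : smooth_gen h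
| sg_add f g of smooth_gen f & smooth_gen g : smooth_gen (fun x => f x + g x)
| sg_mul f g of smooth_gen f & smooth_gen g : smooth_gen (fun x => f x * g x)
| sg_comp (phi : R -> R) f of smoothR phi & smooth_gen f :
    smooth_gen (fun x => phi (f x)).

Lemma smooth_gen_differentiable h x : smooth_gen h -> differentiable h x.
Proof.
elim=> {h} [h|f g _ IHf _ IHg|f g _ IHf _ IHg|phi f sphi _ IHf].
- exact: smoothV_differentiable.
- exact: differentiableD.
- exact: differentiableM.
- apply: (@differentiable_comp _ _ _ _ f phi) => //.
  by apply/derivable1_diffP; exact: (sphi 0%N).
Qed.

Lemma smoothR_derive (phi : R -> R) : smoothR phi -> smoothR phi^`()%classic.
Proof. by move=> sphi k t; rewrite -derive1Sn. Qed.

Lemma smooth_gen_D h i : smooth_gen h -> smooth_gen ('D_(e_ i) h).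
Proof.
elim=> {h} [h sh|f g sf IHf sg IHg|f g sf IHf sg IHg|phi f sphi sf IHf].
- by apply: sg_base; exact: smoothV_D.
- rewrite (_ : 'D_(e_ i) _ = fun x => 'D_(e_ i) f x + 'D_(e_ i) g x); first exact: sg_add.
  apply/funext => x; rewrite (_ : (fun x => _) = f + g)// deriveD//;
    apply: diff_derivable; exact: smooth_gen_differentiable.
- rewrite (_ : 'D_(e_ i) _ = fun x => f x * 'D_(e_ i) g x + g x * 'D_(e_ i) f x).
    by apply: sg_add; exact: sg_mul.
  apply/funext => x; rewrite (_ : (fun x => _) = f * g)// deriveM//;
    apply: diff_derivable; exact: smooth_gen_differentiable.
- rewrite (_ : 'D_(e_ i) _ = fun x => phi^`()%classic (f x) * 'D_(e_ i) f x).
    by apply: sg_mul => //; apply: sg_comp => //; exact: smoothR_derive.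
  apply/funext => x; rewrite (_ : (fun x => _) = phi \o f)// derive_comp1//.
    exact: (sphi 0%N).
  exact: smooth_gen_differentiable.
Qed.

Lemma smooth_genP h : smooth_gen h -> smoothV h.
Proof.
apply: smoothV_class; [by move=> *; exact: smooth_gen_differentiable|].
by move=> *; exact: smooth_gen_D.
Qed.

Lemma smoothVD f g : smoothV f -> smoothV g -> smoothV (fun x => f x + g x).
Proof. by move=> sf sg; apply: smooth_genP; apply: sg_add; exact: sg_base. Qed.

Lemma smoothVM f g : smoothV f -> smoothV g -> smoothV (fun x => f x * g x).
Proof. by move=> sf sg; apply: smooth_genP; apply: sg_mul; exact: sg_base. Qed.

Lemma smoothV_comp (phi : R -> R) f : smoothR phi -> smoothV f ->
  smoothV (fun x => phi (f x)).
Proof. by move=> sf sg; apply: smooth_genP; apply: sg_comp => //; exact: sg_base. Qed.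

Lemma smoothV_sum (I : Type) (r : seq I) (F : I -> 'rV[R]_n -> R) :
  (forall k, smoothV (F k)) -> smoothV (fun x => \sum_(k <- r) F k x).
Proof.
move=> sF; elim: r => [|k r IH].
  by under eq_fun do rewrite big_nil; exact: smoothV_cst.
by under eq_fun do rewrite big_cons; exact: smoothVD.
Qed.

Lemma smoothV_sqnorm : smoothV (@sqnorm R n).
Proof.
rewrite /sqnorm /dot; apply: smoothV_sum => i.
by apply: smoothVM; exact: smoothV_coord.
Qed.

Definition poly_bounded h := forall a : 'I_n -> nat, exists M : R, forall x : 'rV[R]_n,
  `|(\prod_(i < n) x ord0 i ^+ a i) * h x| <= M.

Lemma schwartz_class_poly (P : ('rV[R]_n -> R) -> Prop) :
  (forall h, P h -> forall x, differentiable h x) ->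
  (forall h i, P h -> P ('D_(e_ i) h)) ->
  (forall h, P h -> poly_bounded h) -> forall h, P h -> schwartzR h.
Proof.
move=> Pd PD Pb h Ph; split; first exact: (smoothV_class Pd PD).
by move=> a s; apply: Pb; exact: pderivs_in.
Qed.

(** In a class closed under multiplication by coordinates, polynomial decay reduces to mere
    boundedness. *)
Lemma schwartz_class (P : ('rV[R]_n -> R) -> Prop) :
  (forall h, P h -> forall x, differentiable h x) ->
  (forall h i, P h -> P ('D_(e_ i) h)) ->
  (forall h i, P h -> P (fun x => x ord0 i * h x)) ->
  (forall h, P h -> exists M : R, forall x, `|h x| <= M) ->
  forall h, P h -> schwartzR h.
Proof.
move=> Pd PD Px Pb; apply: schwartz_class_poly => // h Ph a; apply: Pb.
elim: (index_enum _) => [|i r IH].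
  by under eq_fun do rewrite big_nil mul1r.
under eq_fun do rewrite big_cons -mulrA.
elim: (a i) => [|k IHk]; first by under eq_fun do rewrite expr0 mul1r.
under eq_fun do rewrite exprS -mulrA.
exact: Px.
Qed.

Lemma schwartzR_smooth h : schwartzR h -> smoothV h.
Proof. by case. Qed.

Lemma schwartzR_D h i : schwartzR h -> schwartzR ('D_(e_ i) h).
Proof. by case=> s b; split => [|a t]; [exact: smoothV_D|rewrite pderivs_D]. Qed.

Lemma schwartzR_bounded h : schwartzR h -> exists M : R, forall x, `|h x| <= M.
Proof.
case=> _ /(_ (fun=> 0%N) [::])[M hM]; exists M => x.
by have := hM x; rewrite big1// mul1r.
Qed.

(** Same device as [smooth_gen]. Scalars are included because differentiating the factor [x ord0 j]
    leaves a constant multiple of [f]. *)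
Inductive schwartz_gen : ('rV[R]_n -> R) -> Prop :=
| scg_base h of schwartzR h : schwartz_gen h
| scg_add f g of schwartz_gen f & schwartz_gen g : schwartz_gen (fun x => f x + g x)
| scg_coord j f of schwartz_gen f : schwartz_gen (fun x => x ord0 j * f x)
| scg_scale (c : R) f of schwartz_gen f : schwartz_gen (fun x => c * f x).

Lemma schwartz_gen_smooth h : schwartz_gen h -> smoothV h.
Proof.
elim=> {h} [h /schwartzR_smooth//|f g _ + _|j f _|c f _].
- exact: smoothVD.
- by apply: smoothVM; exact: smoothV_coord.
- by apply: smoothVM; exact: smoothV_cst.
Qed.

Lemma schwartz_gen_D h i : schwartz_gen h -> schwartz_gen ('D_(e_ i) h).
Proof.
have df f x : schwartz_gen f -> derivable f x (e_ i).
  by move=> /schwartz_gen_smooth sf; apply/diff_derivable/smoothV_differentiable.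
elim=> {h} [h sh|f g sf IHf sg IHg|j f sf IHf|c f sf IHf].
- by apply: scg_base; exact: schwartzR_D.
- rewrite (_ : 'D_(e_ i) _ = fun x => 'D_(e_ i) f x + 'D_(e_ i) g x); first exact: scg_add.
  by apply/funext => x; rewrite (_ : (fun x => _) = f + g)// deriveD//; exact: df.
- rewrite (_ : 'D_(e_ i) _ =
      fun x => x ord0 j * 'D_(e_ i) f x + (e_ i) ord0 j * f x).
    by apply: scg_add; [exact: scg_coord|exact: scg_scale].
  apply/funext => x.
  rewrite (_ : (fun x => _) = (fun x : 'rV[R]_n => x ord0 j) * f)// deriveM//; last exact: df.
    rewrite (congr1 (fun F => F x) (derive_coord j (e_ i))) /GRing.scale/=.
    by rewrite [f x * _]mulrC.
  by apply: diff_derivable; exact: differentiable_coord.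
- rewrite (_ : 'D_(e_ i) _ = fun x => c * 'D_(e_ i) f x); first exact: scg_scale.
  by apply/funext => x; rewrite (_ : (fun x => _) = c *: f)// deriveZ//; exact: df.
Qed.

Lemma schwartz_gen_bounded h : schwartz_gen h -> poly_bounded h.
Proof.
elim=> {h} [h [_ + a]|f g _ IHf _ IHg a|j f _ IHf a|c f _ IHf a].
- by move=> /(_ a [::]).
- have [M1 H1] := IHf a; have [M2 H2] := IHg a; exists (M1 + M2) => x.
  by rewrite mulrDr (le_trans (ler_normD _ _))// lerD.
- have [M HM] := IHf (fun i => (a i + (i == j))%N); exists M => x.
  rewrite mulrA (_ : _ * x ord0 j = \prod_(i < n) x ord0 i ^+ (a i + (i == j))%N)//.
  under [RHS]eq_bigr do rewrite exprD.
  rewrite big_split/=; congr (_ * _).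
  rewrite (bigD1 j)//= eqxx expr1 big1 ?mulr1// => i /negbTE ->.
  by rewrite expr0.
- have [M HM] := IHf a; exists (`|c| * M) => x.
  by rewrite mulrCA normrM ler_wpM2l.
Qed.

Lemma schwartz_genP h : schwartz_gen h -> schwartzR h.
Proof.
apply: schwartz_class_poly.
- by move=> f /schwartz_gen_smooth sf x; exact: smoothV_differentiable.
- by move=> f i; exact: schwartz_gen_D.
- exact: schwartz_gen_bounded.
Qed.

Lemma schwartzRD f g : schwartzR f -> schwartzR g -> schwartzR (fun x => f x + g x).
Proof. by move=> sf sg; apply: schwartz_genP; apply: scg_add; exact: scg_base. Qed.

Lemma schwartzR_coord j f : schwartzR f -> schwartzR (fun x => x ord0 j * f x).
Proof. by move=> sf; apply: schwartz_genP; apply: scg_coord; exact: scg_base. Qed.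

Lemma schwartzRZ (c : R) f : schwartzR f -> schwartzR (fun x => c * f x).
Proof. by move=> sf; apply: schwartz_genP; apply: scg_scale; exact: scg_base. Qed.

(** The inverse of [wt] is a polynomial, so its powers preserve Schwartz functions, which are
    bounded. *)
Lemma schwartzR_wt k f : schwartzR f ->
  exists2 C : R, 0 <= C & forall x, `|f x| <= C * wt x ^+ k.
Proof.
move=> sf; suff [M HM] : exists M : R, forall x, `|(wt x)^-1 ^+ k * f x| <= M.
  exists `|M|; first by [].
  move=> x; have := HM x; rewrite normrM ger0_norm; last first.
    by rewrite exprn_ge0// invr_ge0 ltW// wt_gt0.
  have w0 := wt_gt0 x.
  rewrite exprVn ler_pdivrMl ?exprn_gt0// mulrC => /le_trans; apply.
  by rewrite ler_wpM2r ?ler_norm// exprn_ge0// ltW.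
have step g : schwartzR g -> schwartzR (fun x => (wt x)^-1 * g x).
  move=> sg; rewrite /wt; under eq_fun do rewrite -prodfV.
  elim: (index_enum _) => [|i r IH].
    by under eq_fun do rewrite big_nil mul1r.
  under eq_fun do rewrite big_cons invrK -mulrA mulrDl mul1r expr2 -mulrA.
  by apply: schwartzRD => //; do 2 apply: schwartzR_coord.
apply: schwartzR_bounded; elim: k => [|k IH].
  by under eq_fun do rewrite expr0 mul1r.
by under eq_fun do rewrite exprS -mulrA; exact: step.
Qed.

Lemma schwartzR_measurable f : schwartzR f -> measurable_fun setT f.
Proof. by move=> /schwartzR_smooth/smoothV_continuous; exact: measurable_continuous_rV. Qed.

Lemma schwartzR_integrable f : schwartzR f -> (leb R n).-integrable setT (EFin \o f).
Proof.
move=> sf; have [C _ fC] := schwartzR_wt 1 sf.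
by apply: (@integrable_le_wt _ _ C) => //; exact: schwartzR_measurable.
Qed.

Lemma coord_lt_open (L : R) j (x : 'rV[R]_n) : L < `|x ord0 j| ->
  \forall y \near x, L < `|(y : 'rV[R]_n) ord0 j|.
Proof.
move=> Lx; have : (fun y : 'rV[R]_n => `|y ord0 j|) y @[y --> x] --> `|x ord0 j|.
  have c : (y : 'rV[R]_n) ord0 j @[y --> x] --> x ord0 j.
    exact: (differentiable_continuous (differentiable_coord x ord0 j)).
  exact: (cvg_norm c).
by move=> /cvgr_gt; apply.
Qed.

Lemma smooth_compact_schwartz (L : R) f : smoothV f ->
  (forall (x : 'rV[R]_n) j, L < `|x ord0 j| -> f x = 0) -> schwartzR f.
Proof.
move=> sf f0.
apply: (@schwartz_class (fun f => smoothV f /\ forall (x : 'rV[R]_n) j, L < `|x ord0 j| -> f x = 0)) => //.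
- by move=> h [sh _] x; exact: smoothV_differentiable.
- move=> h i [sh h0]; split; first exact: smoothV_D.
  move=> x j xj; rewrite (@near_eq_derive _ _ _ h (cst 0)) ?derive_cst//.
  by apply: filterS (coord_lt_open xj) => y; exact: h0.
- move=> h i [sh h0]; split; first by apply: smoothVM => //; exact: smoothV_coord.
  by move=> x j /h0 ->; rewrite mulr0.
move=> h [/smoothV_continuous ch h0].
have cK : compact [set x : 'rV[R]_n | forall i, `[- L, L]%classic (x ord0 i)].
  exact: (@rV_compact R n (fun=> `[- L, L]%classic) (fun=> @segment_compact _ _ _)).
have [] : bounded_set (h @` [set x : 'rV[R]_n | forall i, `[- L, L]%classic (x ord0 i)]).
  by apply/compact_bounded/continuous_compact => //; exact: continuous_subspaceT.
move=> M [_ HM]; exists `|M + 1| => x.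
case: (pselect (exists j, L < `|x ord0 j|)) => [[j /h0 ->]|nL]; first by rewrite normr0.
apply: le_trans (ler_norm _); apply: (HM (M + 1)); first by rewrite ltrDl.
exists x => // i /=; rewrite in_itv/= -ler_norml leNgt; apply/negP => Lx.
by apply: nL; exists i.
Qed.

End Smooth.

(** * Cosine transforms of Schwartz functions *)

Section Trig.
Variable R : realType.
Implicit Types a b x y : R.

Lemma ler_lip_MVT (f df : R -> R) x y : (forall t : R, is_derive t 1 f (df t)) ->
  (forall t, `|df t| <= 1) -> `|f x - f y| <= `|x - y|.
Proof.
move=> fd d1; wlog xy : x y / y <= x.
  move=> H; have [/H//|/ltW/H] := leP y x.
  by rewrite distrC [X in _ -> _ <= X]distrC.
have [|c _ ->] := @MVT_segment _ f df y x xy.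
  by apply: continuous_subspaceT => t; apply: differentiable_continuous;
    apply/derivable1_diffP; case: (fd t).
by rewrite normrM ler_piMl.
Qed.

Lemma sin_lip x y : `|sin x - sin y| <= `|x - y|.
Proof. by apply: (ler_lip_MVT (df := cos)) => t; rewrite cos_max. Qed.

(** The mean value theorem applied to the remainder, whose derivative at [c] is at most [c]. The
    uniformity in [a] allows differentiation under the integral by a direct estimate. *)
Lemma cos_quad a b : `|cos (a + b) - cos a + b * sin a| <= b ^+ 2.
Proof.
wlog b0 : a b / 0 <= b.
  move=> H; have [/H//|/ltW b0] := leP 0 b.
  have := H (- a) (- b); rewrite oppr_ge0 => /(_ b0).
  by rewrite -opprD !cosN sinN mulrNN sqrrN.
pose f t := cos (a + t) - cos a + t * sin a.
have df (t : R) : is_derive t 1 f (- sin (a + t) + sin a).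
  rewrite /f; apply: is_derive_eq.
  by rewrite /GRing.scale/=; ring.
have [|c] := @MVT_segment _ f (fun t => - sin (a + t) + sin a) 0 b b0.
  by apply: continuous_subspaceT => t; apply: differentiable_continuous;
    apply/derivable1_diffP; case: (df t).
rewrite in_itv/= => /andP[c0 cb].
rewrite {2}/f addr0 subrr mul0r add0r !subr0 => E.
rewrite -/(f b) E normrM (ger0_norm b0) expr2 ler_wpM2r//.
rewrite addrC (le_trans (sin_lip _ _))// opprD addrA subrr add0r normrN.
by rewrite ger0_norm.
Qed.

End Trig.

Lemma differentiable0_of_quad (R : realType) (V : normedModType R)
    (r : V -> R) (x : V) (C : R) :
  (forall h, `|r (h + x) - r x| <= C * `|h| ^+ 2) ->
  differentiable r x /\ ('d r x : V -> R) = \0.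
Proof.
move=> rq.
have rE : r \o shift x = cst (r x) + (\0 : {linear V -> R}) +o_ 0 id.
  apply/eqaddoP => _/posnumP[e]; near=> h.
  rewrite /= !fctE addr0.
  apply: (le_trans (rq h)); rewrite expr2 mulrA ler_wpM2r//.
  near: h.
  have C0 : 0 < `|C| + 1 by rewrite ltr_wpDl.
  have /nbhs_ballP : nbhs (0 : V) (ball 0 (e%:num / (`|C| + 1))).
    by apply: nbhsx_ballx; rewrite divr_gt0.
  case=> d d0 H; apply/nbhs_ballP; exists d => // h /H.
  rewrite -ball_normE /= sub0r normrN ltr_pdivlMr// => /ltW.
  apply: le_trans; rewrite mulrC ler_wpM2l// (le_trans (ler_norm _))//.
  by rewrite lerDl.
have c0 : continuous (\0 : {linear V -> R}) by move=> y; exact: cvg_cst.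
have dr0 := diff_unique c0 rE.
by split=> //; apply/diff_locallyP; rewrite dr0; split.
Unshelve. all: by end_near. Qed.

Section CosTransform.
Variables (R : realType) (n : nat).
Implicit Types (u : 'rV[R]_n -> R) (i j : 'I_n) (th : R) (x xi : 'rV[R]_n).
Local Notation e_ i := (delta_mx ord0 i : 'rV[R]_n).
Local Notation mu := (leb R n).

Lemma Rintegral_sum d (T : measurableType d) (m : {measure set T -> \bar R})
    (I : eqType) (r : seq I) (F : I -> T -> R) :
  (forall k, m.-integrable setT (EFin \o F k)) ->
  \int[m]_x (\sum_(k <- r) F k x) = \sum_(k <- r) \int[m]_x F k x.
Proof.
move=> iF; rewrite /Rintegral; under eq_integral do rewrite -sumEFin.
rewrite integral_sum//; apply: EFin_inj; rewrite -sumEFin fineK.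
  by apply: eq_bigr => k _; rewrite fineK//; exact: (integrable_fin_num _ (iF k)).
by apply/sum_fin_numP => k _ _; exact: (integrable_fin_num _ (iF k)).
Qed.

Lemma dotDr x xi h : dot x (xi + h) = dot x xi + dot x h.
Proof. by rewrite /dot -big_split/=; apply: eq_bigr => j _; rewrite mxE mulrDr. Qed.

Lemma dotC x xi : dot x xi = dot xi x.
Proof. by apply: eq_bigr => j _; rewrite mulrC. Qed.

Lemma dotDl x h xi : dot (x + h) xi = dot x xi + dot h xi.
Proof. by rewrite ![dot _ xi]dotC dotDr. Qed.

Lemma dotZr x (t : R) xi : dot x (t *: xi) = t * dot x xi.
Proof. by rewrite /dot mulr_sumr; apply: eq_bigr => j _; rewrite mxE mulrCA. Qed.

Lemma dotZl x (t : R) xi : dot (t *: x) xi = t * dot x xi.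
Proof. by rewrite dotC dotZr dotC. Qed.

Lemma dot_delta x i : dot x (e_ i) = x ord0 i.
Proof.
rewrite /dot (bigD1 i)//= big1 ?addr0 ?mxE ?eqxx ?mulr1// => j ji.
by rewrite mxE eqxx (negbTE ji) mulr0.
Qed.

Lemma coord_le_wt x j : `|x ord0 j| <= (wt x)^-1.
Proof.
rewrite /wt -prodfV (bigD1 j)//= invrK.
have p (t : R) : 1 <= 1 + t ^+ 2 by rewrite lerDl sqr_ge0.
apply: (@le_trans _ _ (1 + x ord0 j ^+ 2)).
  rewrite -[x ord0 j ^+ 2]real_normK ?num_real//.
  move: `|_| => t; have : 0 <= (t - 1) ^+ 2 by exact: sqr_ge0.
  have := sqr_ge0 t; nra.
rewrite ler_peMr ?(le_trans ler01)//.
elim/big_ind: _ => // [a b a1 b1|k _]; last by rewrite invrK.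
by rewrite (le_trans a1)// ler_peMr// (le_trans ler01).
Qed.

Lemma dot_le_wt x h : `|dot x h| <= n%:R * `|h| / wt x.
Proof.
rewrite /dot (le_trans (ler_norm_sum _ _ _))//.
rewrite (@le_trans _ _ (\sum_(j < n) `|h| / wt x))//.
  apply: ler_sum => j _; rewrite normrM mulrC.
  by apply: ler_pM => //; [exact: coord_le_norm|exact: coord_le_wt].
by rewrite sumr_const card_ord -mulrA mulr_natl.
Qed.

Lemma measurable_dotl xi : measurable_fun setT (fun x => dot x xi).
Proof.
apply: measurable_sum => j; apply: measurable_funM => //; exact: measurable_coord.
Qed.

Lemma measurable_cos_dot th xi :
  measurable_fun setT (fun x => cos (2 * pi * dot x xi + th)).
Proof.
apply: (measurableT_comp (continuous_measurable_fun (@continuous_cos R))).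
apply: measurable_funD => //; apply: measurable_funM => //; exact: measurable_dotl.
Qed.

(* [th = 0] and [th = - pi / 2] give the cosine and sine transforms; letting the
   phase vary makes the family stable under the operations below. *)
Definition costr th u xi : R := \int[mu]_x (cos (2 * pi * dot x xi + th) * u x).

Lemma integrable_cosM th u xi : schwartzR u ->
  mu.-integrable setT (EFin \o (fun x => cos (2 * pi * dot x xi + th) * u x)).
Proof.
move=> su; apply: (@integrable_mul_bounded _ _ _ _ _ _ 1).
- exact: measurable_cos_dot.
- by move=> x; exact: cos_max.
- exact: schwartzR_integrable.
Qed.

(** After subtraction of the linear candidate, the remainder has a quadratically small increment and
    hence zero differential. *)
Lemma differentiable_of_quad (f : 'rV[R]_n -> R) (c : 'I_n -> R) (C : R) x :
  (forall h, `|f (h + x) - f x - \sum_(j < n) h ord0 j * c j| <= C * `|h| ^+ 2) ->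
  differentiable f x /\ forall i, 'D_(e_ i) f x = c i.
Proof.
move=> fq.
pose g (y : 'rV[R]_n) : R := \sum_(j < n) y ord0 j * c j.
have gE : g = \sum_(j < n) (c j *: (fun y : 'rV[R]_n => y ord0 j)).
  by apply/funext => y; rewrite fct_sumE /g; apply: eq_bigr => j _; rewrite /= mulrC.
have dg y : differentiable g y.
  by rewrite gE; apply: differentiable_sum => j; apply: differentiableZ;
    exact: differentiable_coord.
pose r : 'rV[R]_n -> R := f - g.
have fE : f = r + g by rewrite /r subrK.
have [dr dr0] : differentiable r x /\ ('d r x : 'rV[R]_n -> R) = \0.
  apply: (@differentiable0_of_quad _ _ r x C) => h; rewrite /r !fctE.
  rewrite (_ : _ - _ = f (h + x) - f x - g h); first exact: fq.
  rewrite (_ : g (h + x) = g h + g x); first by ring.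
  by rewrite /g -big_split/=; apply: eq_bigr => j _; rewrite mxE mulrDl.
split; first by rewrite fE; exact: differentiableD.
move=> i; rewrite fE deriveD; [|exact: diff_derivable|exact: diff_derivable].
rewrite deriveE// dr0 /= add0r gE derive_sum; last first.
  by move=> j; apply: derivableZ; apply: diff_derivable; exact: differentiable_coord.
rewrite (bigD1 i)//= big1 ?addr0.
  rewrite deriveZ; last by apply: diff_derivable; exact: differentiable_coord.
  by rewrite (congr1 (fun F => F x) (derive_coord i (e_ i))) /= mxE !eqxx /GRing.scale/= mulr1.
move=> j ji; rewrite deriveZ; last by apply: diff_derivable; exact: differentiable_coord.
rewrite (congr1 (fun F => F x) (derive_coord j (e_ i))) /= mxE eqxx (negbTE ji).
by rewrite scaler0.
Qed.

(** Differentiation in [xi] brings out [- 2 pi x_i sin], that is [2 pi x_i] times a cosine advanced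
    by [pi / 2]. By [cos_quad] the error is at most a constant times the square of [|h|]. *)
Lemma costr_differentiable th u xi : schwartzR u ->
  differentiable (costr th u) xi /\
  forall i, 'D_(e_ i) (costr th u) xi =
    costr (th + pi / 2) (fun x => 2 * pi * (x ord0 i * u x)) xi.
Proof.
(* Two powers of [wt] pay for the square of [dot x h], the third one for integrability. *)
move=> su; have [C C0 uC] := schwartzR_wt 3 su.
pose K := (2 * pi * n%:R) ^+ 2 * C * (pi : R) ^+ n.
have su' j : schwartzR (fun x => 2 * pi * (x ord0 j * u x)).
  by apply/schwartzRZ/schwartzR_coord.
apply: (@differentiable_of_quad _ _ K) => h.
pose A x := 2 * pi * dot x xi + th.
pose B x := 2 * pi * dot x h.
have E : costr th u (h + xi) - costr th u xi -
   \sum_(j < n) h ord0 j * costr (th + pi / 2) (fun x => 2 * pi * (x ord0 j * u x)) xi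
   = \int[mu]_x ((cos (A x + B x) - cos (A x) + B x * sin (A x)) * u x).
  have EZ j : h ord0 j * costr (th + pi / 2) (fun x => 2 * pi * (x ord0 j * u x)) xi =
     \int[mu]_x (h ord0 j * (cos (2 * pi * dot x xi + (th + pi / 2)) *
       (2 * pi * (x ord0 j * u x)))).
    by rewrite /costr -RintegralZl//; exact: integrable_cosM.
  under eq_bigr do rewrite EZ.
  rewrite -Rintegral_sum; last first.
    by move=> j; exact: (integrableZl measurableT (h ord0 j) (integrable_cosM _ _ (su' j))).
  rewrite /costr -RintegralB//; [|exact: integrable_cosM|exact: integrable_cosM].
  rewrite -RintegralB//; last 2 first.
  - exact: (integrableB measurableT (integrable_cosM _ _ su) (integrable_cosM _ _ su)).
  - have H := @integrable_sum _ _ _ mu setT measurableT _ (index_enum 'I_n) xpredT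
      (fun j x => (h ord0 j * (cos (2 * pi * dot x xi + (th + pi / 2)) *
                 (2 * pi * (x ord0 j * u x))))%:E)
      (fun j _ => integrableZl measurableT (h ord0 j) (integrable_cosM _ _ (su' j))).
    by apply: eq_integrable H => // x _; rewrite /= sumEFin.
  apply: eq_Rintegral => x _.
  have -> : 2 * pi * dot x (h + xi) + th = A x + B x by rewrite dotDr /A /B; ring.
  rewrite -/(A x).
  under eq_bigr do rewrite addrA -/(A x) cosDpihalf.
  set S := \sum_(i < n) _.
  suff -> : S = - (B x * sin (A x) * u x) by ring.
  rewrite /S /B /dot mulr_sumr !mulr_suml -sumrN; apply: eq_bigr => j _; ring.
rewrite E.
have uint : mu.-integrable setT (EFin \o (fun x => ((2 * pi * n%:R * `|h|) ^+ 2 * C) * wt x)).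
  exact: (integrableZl measurableT _ (@integrable_wt R n)).
apply: (@le_trans _ _ (\int[mu]_x (((2 * pi * n%:R * `|h|) ^+ 2 * C) * wt x))); last first.
  rewrite RintegralZl//; last exact: integrable_wt.
  rewrite /Rintegral integral_wt/= /K le_eqVlt; apply/orP; left; apply/eqP; ring.
apply: ler_norm_Rintegral => //.
  apply: measurable_funM; last exact: schwartzR_measurable.
  have mA : measurable_fun setT A.
    by apply: measurable_funD => //; apply: measurable_funM => //; exact: measurable_dotl.
  have mB : measurable_fun setT B by apply: measurable_funM => //; exact: measurable_dotl.
  have mcos := continuous_measurable_fun (@continuous_cos R).
  have msin := continuous_measurable_fun (@continuous_sin R).
  apply: measurable_funD.
    apply: measurable_funB; last exact: (measurableT_comp mcos).
    by apply: (measurableT_comp mcos); exact: measurable_funD.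
  by apply: measurable_funM => //; exact: (measurableT_comp msin).
move=> x; rewrite normrM.
apply: (le_trans (ler_pM (normr_ge0 _) (normr_ge0 _) (cos_quad _ _) (uC x))).
have w0 := wt_gt0 x.
have Bx : B x ^+ 2 <= (2 * pi * n%:R * `|h| / wt x) ^+ 2.
  rewrite -[B x ^+ 2]real_normK ?num_real// lerXn2r ?nnegrE//.
    by apply: divr_ge0; [rewrite !mulr_ge0 ?pi_ge0|exact: ltW].
  rewrite /B !normrM (ger0_norm (pi_ge0 _)) (@ger0_norm _ 2)// -!mulrA.
  by rewrite !ler_wpM2l ?pi_ge0// !mulrA dot_le_wt.
apply: (le_trans (ler_wpM2r _ Bx)); first by rewrite mulr_ge0// exprn_ge0// ltW.
rewrite le_eqVlt; apply/orP; left; apply/eqP; field.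
by rewrite gt_eqF.
Qed.

End CosTransform.

Section CosTransformSchwartz.
Variables (R : realType) (n : nat).
Implicit Types (u : 'rV[R]_n -> R) (i j : 'I_n) (th : R) (x xi : 'rV[R]_n).
Local Notation e_ i := (delta_mx ord0 i : 'rV[R]_n).
Local Notation mu := (leb R n).

(** Dominates the difference quotients uniformly in [t]: the mean value theorem gives a nearby
    point, and [wt_shift] brings its weight back to [x]. *)
Lemma differential_quotient_le u i x (t C : R) : schwartzR u -> 0 < t <= 1 ->
  (forall y, `|'D_(e_ i) u y| <= C * wt y) ->
  `|u (x + t *: e_ i) - u x| <= C * 3 ^+ n * wt x * t.
Proof.
move=> su /andP[t0 t1] uC.
have C0 : 0 <= C.
  by have := le_trans (normr_ge0 _) (uC 0); rewrite pmulr_lge0// wt_gt0.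
pose f (s : R) := u (x + s *: e_ i).
have df (s : R) : is_derive s 1 f ('D_(e_ i) u (x + s *: e_ i)).
  have E : (fun h : R => h^-1 *: ((f \o shift s) (h *: 1) - f s)) =
      (fun h => h^-1 *: ((u \o shift (x + s *: e_ i)) (h *: e_ i) - u (x + s *: e_ i))).
    apply/funext => h; rewrite /f /=; congr (_ *: (u _ - _)).
    by rewrite [h *: 1]mulr1 scalerDl addrCA.
  have du : derivable u (x + s *: e_ i) (e_ i).
    exact/diff_derivable/smoothV_differentiable/schwartzR_smooth.
  by apply: DeriveDef; rewrite /derivable /derive E.
have [|c] := @MVT_segment _ f _ 0 t (ltW t0) (fun s _ => df s).
  by apply: continuous_subspaceT => s; apply: differentiable_continuous;
    apply/derivable1_diffP; case: (df s).
rewrite in_itv/= => /andP[c0 ct]; rewrite /f scale0r addr0 subr0 => ->.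
rewrite normrM (gtr0_norm t0) ler_wpM2r// ?(ltW t0)//.
apply: (le_trans (uC _)); rewrite -mulrA ler_wpM2l//.
apply: wt_shift => j; rewrite !mxE eqxx/= normrM (ger0_norm c0).
case: (j == i); rewrite /= ?normr1 ?normr0 ?mulr1 ?mulr0//.
exact: le_trans t1.
Qed.

Lemma sin_quad (b : R) : `|sin b - b| <= b ^+ 2.
Proof.
have := cos_quad (- (pi / 2)) b.
by rewrite [- _ + b]addrC cosBpihalf cosN cos_pihalf sinN sin_pihalf subr0 mulrN1.
Qed.

Lemma costr_shift th u xi (y : 'rV[R]_n) : schwartzR u ->
  \int[mu]_x (cos (2 * pi * dot x xi + th) * u (x + y)) =
  cos (2 * pi * dot y xi) * costr th u xi +
  sin (2 * pi * dot y xi) * costr (th - pi / 2) u xi.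
Proof.
move=> su.
have i1 := integrable_cosM th xi su.
have i2 := integrable_cosM (th - pi / 2) xi su.
pose c := cos (2 * pi * dot y xi); pose s := sin (2 * pi * dot y xi).
pose F x := c * (cos (2 * pi * dot x xi + th) * u x) +
  s * (cos (2 * pi * dot x xi + (th - pi / 2)) * u x).
have iF : mu.-integrable setT (EFin \o F).
  exact: (integrableD measurableT (integrableZl measurableT c i1)
    (integrableZl measurableT s i2)).
rewrite [RHS](_ : _ = \int[mu]_x F x); last first.
  rewrite /F RintegralD//.
  - by rewrite !RintegralZl.
  - exact: (integrableZl measurableT c i1).
  - exact: (integrableZl measurableT s i2).
rewrite -(Rintegral_translate y iF); apply: eq_Rintegral => x _.
rewrite /F !mulrA -mulrDl; congr (_ * _).
rewrite /c /s addrA cosBpihalf [cos (_ * _ * dot y _) * _]mulrC [sin _ * _]mulrC -cosB.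
by congr cos; rewrite dotDl; ring.
Qed.

(** In place of an integration by parts, the transform of a difference quotient of [u] is computed
    exactly by translation invariance. Its limit is then found twice, by dominated convergence and
    by expanding sine and cosine at 0. *)
Lemma costr_D th u xi i : schwartzR u ->
  costr th ('D_(e_ i) u) xi = 2 * pi * xi ord0 i * costr (th - pi / 2) u xi.
Proof.
move=> su; have [C _ uC] := schwartzR_wt 1 (schwartzR_D i su).
have {}uC y : `|'D_(e_ i) u y| <= C * wt y by rewrite -[wt y]expr1.
pose t (k : nat) : R := k.+1%:R^-1.
have t0 k : 0 < t k by rewrite invr_gt0.
have t1 k : t k <= 1 by rewrite invf_le1 ?ler1n.
have ct : t @ \oo --> 0 by exact: cvg_harmonic.
pose f k x := cos (2 * pi * dot x xi + th) * ((t k)^-1 * (u (x + t k *: e_ i) - u x)).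
have mu_u : measurable_fun setT u by exact: schwartzR_measurable.
have iu k : mu.-integrable setT (EFin \o (fun x => u (x + t k *: e_ i))).
  have := integrable_affine (t k *: e_ i) (@ltr01 R) (schwartzR_integrable su).
  by apply: eq_integrable => // x _ /=; rewrite scale1r.
have icu k : mu.-integrable setT
    (EFin \o (fun x => cos (2 * pi * dot x xi + th) * u (x + t k *: e_ i))).
  apply: (@integrable_mul_bounded _ _ _ _ _ _ 1); last exact: iu.
    exact: measurable_cos_dot.
  by move=> x; exact: cos_max.
have fE k : \int[mu]_x f k x = (t k)^-1 *
   ((cos (2 * pi * (t k * xi ord0 i)) - 1) * costr th u xi +
    sin (2 * pi * (t k * xi ord0 i)) * costr (th - pi / 2) u xi).
  have -> : \int[mu]_x f k x = \int[mu]_x ((t k)^-1 *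
     (cos (2 * pi * dot x xi + th) * u (x + t k *: e_ i) -
      cos (2 * pi * dot x xi + th) * u x)).
    by apply: eq_Rintegral => x _; rewrite /f; ring.
  have i2 := integrable_cosM th xi su.
  rewrite RintegralZl//; last exact: (integrableB measurableT (icu k) i2).
  rewrite RintegralB// costr_shift// dotZl dotC dot_delta -/(costr th u xi).
  by congr (_ * _); ring.
have c1 : (fun k => \int[mu]_x f k x) @ \oo --> costr th ('D_(e_ i) u) xi.
  apply: (@Rintegral_cvg _ _ _ _ _ _ (fun x => C * 3 ^+ n * wt x)).
  - move=> k; apply: measurable_funM; first exact: measurable_cos_dot.
    apply: measurable_funM => //; apply: measurable_funB => //.
    by apply/measurable_EFinP; exact: measurable_int (iu k).
  - move=> x; apply: cvgM; first exact: cvg_cst.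
    have du : derivable u x (e_ i).
      exact/diff_derivable/smoothV_differentiable/schwartzR_smooth.
    have := cvgr_dnbhsP (fun h : R => h^-1 *: (u (h *: e_ i + x) - u x)) 0 ('D_(e_ i) u x).
    move=> [/(_ du) H _].
    have Ht := H t (conj (fun k => lt0r_neq0 (t0 k)) ct).
    rewrite (_ : (fun k => _) = (fun k => (t k)^-1 *: (u (t k *: e_ i + x) - u x))); first exact: Ht.
    by apply/funext => k; rewrite [x + _]addrC.
  - move=> k x; rewrite /f normrM (@le_trans _ _ (1 * `|(t k)^-1 * (u (x + t k *: e_ i) - u x)|))//.
      by rewrite ler_wpM2r// cos_max.
    rewrite mul1r normrM gtr0_norm ?invr_gt0// ler_pdivrMl// mulrC.
    by apply: differential_quotient_le => //; rewrite t0 t1.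
  - exact: (integrableZl measurableT _ (@integrable_wt R n)).
have c2 : (fun k => \int[mu]_x f k x) @ \oo -->
    2 * pi * xi ord0 i * costr (th - pi / 2) u xi.
  pose c := 2 * pi * xi ord0 i.
  pose E1 := costr th u xi; pose E2 := costr (th - pi / 2) u xi.
  apply/cvgrPdist_le => e e0.
  pose K := c ^+ 2 * (`|E1| + `|E2|) + 1.
  have K0 : 0 < K by rewrite ltr_wpDl// mulr_ge0 ?sqr_ge0 ?addr_ge0.
  have eK : 0 < e / K by rewrite divr_gt0.
  move: (ct) => /cvgrPdist_le/(_ _ eK); apply: filterS => k.
  rewrite sub0r normrN gtr0_norm// ler_pdivlMr// => tk.
  rewrite fE -/c -/E1 -/E2 (_ : 2 * pi * (t k * xi ord0 i) = c * t k); last by rewrite /c; ring.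
  have b1 : `|cos (c * t k) - 1| <= (c * t k) ^+ 2.
    by have := cos_quad 0 (c * t k); rewrite add0r cos0 sin0 mulr0 addr0.
  have b2 := sin_quad (c * t k).
  have -> : c * E2 - (t k)^-1 * ((cos (c * t k) - 1) * E1 + sin (c * t k) * E2) =
     - (t k)^-1 * ((cos (c * t k) - 1) * E1 + (sin (c * t k) - c * t k) * E2).
    by field; rewrite gt_eqF.
  rewrite normrM normrN (gtr0_norm (_ : 0 < (t k)^-1)) ?invr_gt0// ler_pdivrMl//.
  rewrite (le_trans (ler_normD _ _))// !normrM.
  rewrite (@le_trans _ _ ((c * t k) ^+ 2 * (`|E1| + `|E2|)))//.
    by rewrite mulrDr lerD// ler_wpM2r.
  rewrite (_ : _ * _ = t k * (t k * (c ^+ 2 * (`|E1| + `|E2|)))); last by ring.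
  rewrite ler_wpM2l ?(ltW (t0 k))// (le_trans _ tk)// ler_wpM2l ?(ltW (t0 k))//.
  by rewrite /K lerDl.
by rewrite -(cvg_lim _ c1)// (cvg_lim _ c2).
Qed.

(** The class of all [costr th u] is stable: a derivative multiplies [u] by a coordinate and a
    coordinate factor differentiates [u], each with a phase shift and a constant. Its members are
    bounded by L^1 norms. *)
Lemma costr_schwartz th u : schwartzR u -> schwartzR (costr th u).
Proof.
move=> su.
apply: (@schwartz_class R n (fun h => exists th u, schwartzR u /\ h = costr th u)); last by exists th, u.
- by move=> _ [th' [u' [su' ->]]] x; case: (costr_differentiable th' x su').
- move=> _ i [th' [u' [su' ->]]].
  exists (th' + pi / 2), (fun x => 2 * pi * (x ord0 i * u' x)); split.
    by apply/schwartzRZ/schwartzR_coord.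
  by apply/funext => x; case: (costr_differentiable th' x su').
- move=> _ i [th' [u' [su' ->]]].
  exists (th' + pi / 2), (fun x => (2 * pi)^-1 * 'D_(e_ i) u' x); split.
    by apply/schwartzRZ/schwartzR_D.
  apply/funext => x; have := costr_D (th' + pi / 2) x i su'.
  rewrite addrK => H.
  have -> : costr (th' + pi / 2) (fun y => (2 * pi)^-1 * 'D_(e_ i) u' y) x =
     (2 * pi)^-1 * costr (th' + pi / 2) ('D_(e_ i) u') x.
    rewrite /costr -RintegralZl//; last exact/integrable_cosM/schwartzR_D.
    by apply: eq_Rintegral => y _; ring.
  have pi0 : (pi : R) != 0 by rewrite gt_eqF// pi_gt0.
  by rewrite H -(mulrA (2 * pi)) mulKf// mulf_neq0.
- move=> _ [th' [u' [su' ->]]]; exists (\int[mu]_x `|u' x|) => xi.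
  apply: ler_norm_Rintegral.
  + apply: measurable_funM; [exact: measurable_cos_dot|exact: schwartzR_measurable].
  + by move=> x; rewrite normrM ler_piMl// cos_max.
  + exact/integrable_norm/schwartzR_integrable.
Qed.

End CosTransformSchwartz.

(** * Fourier inversion *)

Section LaplaceKernel.
Variable R : realType.
Local Notation mu1 := (@lebesgue_measure R).
Implicit Types eps b th t : R.

(** The constant comes from [exp s >= (1 + s / 2)^2] at [s = eps |t|]. *)
Lemma expR_le_inv (eps t : R) : 0 < eps ->
  expR (- eps * `|t|) <= (1 + 4 / eps ^+ 2) * (1 + t ^+ 2)^-1.
Proof.
move=> e0; rewrite mulNr expRN.
have p : 0 < 1 + t ^+ 2 by rewrite ltr_wpDr ?sqr_ge0.
rewrite -[X in X <= _]mul1r ler_pdivrMr ?expR_gt0// -mulrA mulrC -mulrA.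
rewrite ler_pdivlMl// mulr1.
have H : (1 + eps * `|t| / 2) ^+ 2 <= expR (eps * `|t|).
  rewrite [X in expR X](_ : _ = eps * `|t| / 2 + eps * `|t| / 2); last by field.
  rewrite expRD -expr2 lerXn2r ?nnegrE ?expR_ge0 ?expR_ge1Dx//.
  by rewrite addr_ge0// divr_ge0// mulr_ge0// ltW.
have E2 : 0 < eps ^+ 2 by rewrite exprn_gt0.
have H2 : t ^+ 2 <= 4 / eps ^+ 2 * expR (eps * `|t|).
  rewrite mulrAC ler_pdivlMr//.
  have := normr_ge0 t; rewrite -[t ^+ 2]real_normK ?num_real//.
  move: H; move: (`|t|) (expR (eps * `|t|)) => s X H s0.
  have : 0 <= eps * s by rewrite mulr_ge0// ltW.
  nra.
have := expR_ge0 (eps * `|t|); have := expR_ge1Dx (eps * `|t|).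
have : 0 <= eps * `|t| by rewrite mulr_ge0// ltW.
have : 0 <= 4 / eps ^+ 2 by rewrite divr_ge0// ltW.
move: H2; move: (eps * `|t|) (4 / eps ^+ 2) (t ^+ 2) => s k q; move: (expR s) => X; nra.
Qed.

Lemma measurable_exp_cos eps b th : measurable_fun (setT : set (measurableTypeR R))
  (fun t : R => expR (- eps * `|t|) * cos (b * t + th)).
Proof.
apply: continuous_measurable_fun => t; apply: cvgM.
  apply: continuous_comp; last exact: continuous_expR.
  by apply: cvgM; [exact: cvg_cst|exact: norm_continuous].
apply: continuous_comp; last exact: continuous_cos.
by apply: cvgD; [apply: cvgM; [exact: cvg_cst|exact: cvg_id]|exact: cvg_cst].
Qed.

Lemma integrable_inv1Dsqr (C : R) :
  mu1.-integrable setT (EFin \o (fun t : R => C * (1 + t ^+ 2)^-1)).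
Proof.
have i1 : mu1.-integrable setT (EFin \o (fun t : R => (1 + t ^+ 2)^-1)).
  apply/integrableP; split.
    by apply/measurable_EFinP; apply: continuous_measurable_fun; exact: continuous_oneDsqrV.
  under eq_integral => t _.
    rewrite gee0_abs; last by rewrite lee_fin invr_ge0 addr_ge0 ?sqr_ge0.
    over.
  by rewrite integral_inv1Dsqr ltry.
exact: (integrableZl measurableT C i1).
Qed.

Lemma integrable_exp_cos eps b th : 0 < eps ->
  mu1.-integrable setT (EFin \o (fun t : R => expR (- eps * `|t|) * cos (b * t + th))).
Proof.
move=> e0; apply: integrable_le (integrable_inv1Dsqr (1 + 4 / eps ^+ 2)).
  exact: measurable_exp_cos.
move=> t; rewrite normrM (ger0_norm (expR_ge0 _)).
apply: (le_trans _ (expR_le_inv t e0)).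
by rewrite ler_piMr ?expR_ge0// cos_max.
Qed.

Lemma Rintegral_FTC2 (f F : R -> R) (a b : R) : a < b ->
  (forall t : R, is_derive t 1 F (f t)) -> continuous f ->
  \int[mu1]_(t in `[a, b]) f t = F b - F a.
Proof.
move=> ab dF cf.
have cF : continuous F.
  by move=> t; apply: differentiable_continuous; apply/derivable1_diffP; case: (dF t).
rewrite /Rintegral (@continuous_FTC2 _ f F)//.
- exact: continuous_subspaceT.
- split; [by move=> t _; case: (dF t)|apply: cvg_at_right_filter; exact: cF|apply: cvg_at_left_filter; exact: cF].
- by move=> t _; rewrite derive1E; case: (dF t).
Qed.

Lemma integral_exp_cos eps b th : 0 < eps ->
  \int[mu1]_t (expR (- eps * `|t|) * cos (b * t + th)) =
  cos th * (2 * eps / (eps ^+ 2 + b ^+ 2)).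
Proof.
move=> e0; pose D := eps ^+ 2 + b ^+ 2.
have D0 : 0 < D by rewrite ltr_pwDl ?exprn_gt0// sqr_ge0.
pose f t := expR (- eps * `|t|) * cos (b * t + th).
(* An antiderivative of [exp (- s t) cos (b t + th)] as soon as [s ^+ 2 = eps ^+ 2]: [s = eps]
   serves the positive half-line and [s = - eps] the negative one. *)
pose F (s : R) (t : R) := expR (- s * t) * (b * sin (b * t + th) - s * cos (b * t + th)) / D.
have dF (s t : R) : s ^+ 2 = eps ^+ 2 ->
    is_derive t 1 (F s) (expR (- s * t) * cos (b * t + th)).
  move=> s2; rewrite /F; apply: is_derive_eq.
  rewrite /GRing.scale/= !(mulr1, mulr0, addr0, add0r).
  have -> : D = s ^+ 2 + b ^+ 2 by rewrite /D s2.
  by field; rewrite s2 gt_eqF.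
have cc (s : R) : continuous (fun t : R => expR (- s * t) * cos (b * t + th)).
  move=> t; apply: cvgM.
    apply: continuous_comp; last exact: continuous_expR.
    by apply: cvgM; [exact: cvg_cst|exact: cvg_id].
  apply: continuous_comp; last exact: continuous_cos.
  by apply: cvgD; [apply: cvgM; [exact: cvg_cst|exact: cvg_id]|exact: cvg_cst].
pose N (k : nat) : R := k.+1%:R.
have N0 k : 0 < N k by rewrite ltr0n.
have I1 k : \int[mu1]_(t in `[0, N k]) f t = F eps (N k) - F eps 0.
  rewrite -(Rintegral_FTC2 (N0 k) (fun t => dF eps t erefl) (cc eps)).
  apply: eq_Rintegral => t; rewrite inE/= in_itv/= => /andP[t0 _].
  by rewrite /f ger0_norm.
have I2 k : \int[mu1]_(t in `[- N k, 0]) f t = F (- eps) 0 - F (- eps) (- N k).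
  have Nk : - N k < 0 by rewrite oppr_lt0.
  rewrite -(Rintegral_FTC2 Nk (fun t => dF (- eps) t (sqrrN _)) (cc (- eps))).
  apply: eq_Rintegral => t; rewrite inE/= in_itv/= => /andP[_ t0].
  by rewrite /f ler0_norm// mulrNN opprK.
have iF := integrable_exp_cos b th e0.
have mf := measurable_exp_cos eps b th.
have I3 k : \int[mu1]_(t in `[- N k, N k]) f t =
    (F (- eps) 0 - F (- eps) (- N k)) + (F eps (N k) - F eps 0).
  rewrite -I1 -I2.
  have iS (A : set (measurableTypeR R)) : measurable A -> mu1.-integrable A (EFin \o f).
    by move=> mA; exact: (integrableS measurableT mA).
  rewrite -(@Rintegral_itv_obnd_cbnd _ 0); last exact: iS.
  rewrite -(@Rintegral_itvB _ f (BLeft (- N k)) (BRight (N k)) 0).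
  - by rewrite addrC subrK.
  - exact: iS.
  - by rewrite bnd_simp oppr_le0 ltW.
  - by rewrite bnd_simp ltW.
pose g k t := f t * (\1_`[- N k, N k] t : R).
have c1 : (fun k => \int[mu1]_t g k t) @ \oo --> \int[mu1]_t f t.
  apply: (@Rintegral_cvg _ _ _ mu1 _ _ (fun t => `|f t|)).
  - by move=> k; apply: measurable_funM.
  - move=> t; apply: cvg_near_cst; exists (Num.truncn `|t|) => // k /= tk.
    rewrite /g indicE mem_set ?mulr1//= in_itv/= -ler_norml.
    by rewrite (le_trans (ltW (truncnS_gt _)))// /N ler_nat ltnS.
  - move=> k t; rewrite /g normrM ler_piMr// indicE.
    by case: (_ \in _); rewrite ?normr1 ?normr0.
  - exact: integrable_norm iF.
have gE k : \int[mu1]_t g k t = \int[mu1]_(t in `[- N k, N k]) f t.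
  rewrite [RHS]Rintegral_mkcond; apply: eq_Rintegral => t _.
  by rewrite /g patchE indicE; case: ifPn; rewrite ?mulr1 ?mulr0.
pose L := cos th * (2 * eps / D).
have c2 : (fun k => \int[mu1]_t g k t) @ \oo --> L.
  have Fb s t : s ^+ 2 = eps ^+ 2 -> `|F s t| <= expR (- s * t) * ((`|b| + eps) / D).
    move=> s2; rewrite /F normrM normrM (ger0_norm (expR_ge0 _)) (gtr0_norm (_ : 0 < D^-1)) ?invr_gt0//.
    rewrite -mulrA ler_wpM2l ?expR_ge0// ler_wpM2r ?invr_ge0 ?(ltW D0)//.
    rewrite (le_trans (ler_normB _ _))// !normrM.
    have -> : `|s| = eps.
      apply/eqP; rewrite -(@eqrXn2 _ 2)//; last exact: ltW.
      by rewrite real_normK ?num_real// s2.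
    by rewrite lerD// ler_piMr ?sin_max ?cos_max// ltW.
  have Ex k : expR (- eps * N k) <= (1 + 4 / eps ^+ 2) * k.+1%:R^-1.
    have := expR_le_inv (N k) e0; rewrite gtr0_norm// => /le_trans; apply.
    rewrite ler_wpM2l// ?addr_ge0// ?divr_ge0 ?sqr_ge0//.
    rewrite lef_pV2 ?posrE ?ltr0n// ?ltr_wpDr ?sqr_ge0//.
    rewrite /N; have : (1 : R) <= k.+1%:R by rewrite ler1n.
    move: (k.+1%:R) => m m1; nra.
  have z (G : nat -> R) (c : R) : (forall k, `|G k| <= c * k.+1%:R^-1) -> G @ \oo --> 0.
    move=> Gc; apply: (@norm_cvg0 _ _ _ _ _ _).
    apply: (@squeeze_cvgr _ _ _ _ (cst 0) (fun k => c * k.+1%:R^-1)).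
    - by apply: nearW => k; rewrite normr_ge0 Gc.
    - exact: cvg_cst.
    - rewrite -[X in _ --> X](mulr0 c); apply: cvgM; first exact: cvg_cst.
      exact: cvg_harmonic.
  have z1 : (fun k => F eps (N k)) @ \oo --> 0.
    apply: (z _ ((1 + 4 / eps ^+ 2) * ((`|b| + eps) / D))) => k.
    apply: (le_trans (Fb _ _ erefl)); rewrite mulrAC ler_wpM2r//.
    by apply: divr_ge0; [apply: addr_ge0 => //; exact: ltW|exact: ltW].
  have z2 : (fun k => F (- eps) (- N k)) @ \oo --> 0.
    apply: (z _ ((1 + 4 / eps ^+ 2) * ((`|b| + eps) / D))) => k.
    apply: (le_trans (Fb _ _ (sqrrN _))); rewrite opprK mulrN -mulNr mulrAC ler_wpM2r//.
    by apply: divr_ge0; [apply: addr_ge0 => //; exact: ltW|exact: ltW].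
  have -> : L = (F (- eps) 0 - 0) + (0 - F eps 0).
    rewrite /F !(mulr0, add0r) expR0 /L; field; exact: lt0r_neq0.
  under eq_fun do rewrite gE I3.
  by apply: cvgD; apply: cvgB => //; exact: cvg_cst.
by rewrite -/(f _) -(cvg_lim _ c1)// (cvg_lim _ c2).
Qed.

Definition lap n eps (x : 'rV[R]_n) : R := \prod_(j < n) expR (- eps * `|x ord0 j|).

Lemma lap_gt0 n eps (x : 'rV[R]_n) : 0 < lap eps x.
Proof. by apply: prodr_gt0 => j _; exact: expR_gt0. Qed.

Lemma lap_le1 n eps (x : 'rV[R]_n) : 0 < eps -> lap eps x <= 1.
Proof.
move=> e0; rewrite /lap; apply: prodr_ile1 => j _; rewrite expR_ge0/=.
by rewrite -expR0 ler_expR mulNr oppr_le0 mulr_ge0// ltW.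
Qed.

Lemma measurable_lap n eps : measurable_fun setT (@lap n eps).
Proof.
apply: measurable_prod => j _.
apply: (measurableT_comp (continuous_measurable_fun (@continuous_expR R))).
apply: measurable_funM => //; apply: measurableT_comp => //; exact: measurable_coord.
Qed.

Lemma lap_le_wt n eps (x : 'rV[R]_n) : 0 < eps ->
  lap eps x <= (1 + 4 / eps ^+ 2) ^+ n * wt x.
Proof.
move=> e0; have -> : (1 + 4 / eps ^+ 2) ^+ n = \prod_(j < n) (1 + 4 / eps ^+ 2) :> R.
  by rewrite prodr_const card_ord.
rewrite /wt -big_split/=; apply: ler_prod => j _.
by rewrite expR_ge0/= expR_le_inv.
Qed.

Lemma integrable_cos_lap n eps th (z : 'rV[R]_n) : 0 < eps -> (leb R n).-integrable setT
  (EFin \o (fun x => cos (2 * pi * dot z x + th) * lap eps x)).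
Proof.
move=> e0; apply: (@integrable_le_wt _ _ ((1 + 4 / eps ^+ 2) ^+ n)).
  apply: measurable_funM; last exact: measurable_lap.
  under eq_fun do rewrite dotC; exact: measurable_cos_dot.
move=> x; rewrite normrM (gtr0_norm (lap_gt0 _ _)).
apply: le_trans (lap_le_wt x e0).
by rewrite ler_piMl ?(ltW (lap_gt0 _ _))// cos_max.
Qed.

(** The free phase carries the induction: seen from the other coordinates, the first one is only a
    phase. *)
Lemma integral_cos_lap n eps th (z : 'rV[R]_n) : 0 < eps ->
  \int[leb R n]_x (cos (2 * pi * dot z x + th) * lap eps x) =
  cos th * \prod_(j < n) (2 * eps / (eps ^+ 2 + (2 * pi * z ord0 j) ^+ 2)).
Proof.
move=> e0; elim: n z th => [|n IH] z th.
  rewrite big_ord0 mulr1 /= /Rintegral integral_dirac//.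
    by rewrite diracT mul1e /= /dot /lap !big_ord0 mulr0 add0r mulr1.
  by apply: measurable_int (integrable_cos_lap _ _ e0).
pose z' : 'rV[R]_n := (unconsrV z).2.
have E t v : cos (2 * pi * dot z (consrV (t, v)) + th) * lap eps (consrV (t, v)) =
   expR (- eps * `|t|) *
   (cos (2 * pi * dot z' v + (2 * pi * z ord0 ord0 * t + th)) * lap eps v).
  rewrite /dot /lap !big_ord_recl !consrV0 mulrCA; congr (_ * (cos _ * _)).
    rewrite mulrDr -addrA addrCA mulrA; congr (_ * _ + _).
    by apply: eq_bigr => j _; rewrite consrVS mxE.
  by apply: eq_bigr => j _; rewrite consrVS.
rewrite Rintegral_lebS; first last.
- move=> t; under eq_fun do rewrite E.
  exact: (integrableZl measurableT _ (integrable_cos_lap _ _ e0)).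
- exact: integrable_cos_lap.
under eq_Rintegral => t _.
  under eq_Rintegral => v _ do rewrite E.
  rewrite RintegralZl//; last exact: integrable_cos_lap.
  rewrite IH mulrA.
  over.
rewrite RintegralZr//; last exact: integrable_exp_cos.
rewrite integral_exp_cos// [in RHS]big_ord_recl [RHS]mulrA; congr (_ * _).
by apply: eq_bigr => j _; rewrite mxE.
Qed.

End LaplaceKernel.

Section Inversion.
Variables (R : realType) (n : nat).
Local Notation mu := (leb R n).
Implicit Types (u : 'rV[R]_n -> R) (th : R) (x y xi : 'rV[R]_n).

Lemma dotBl x y xi : dot (x - y) xi = dot x xi - dot y xi.
Proof. by rewrite -scaleN1r dotDl dotZl mulN1r. Qed.

Lemma measurable_dotr x : measurable_fun setT (fun xi => dot x xi).
Proof.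
rewrite (_ : (fun xi => dot x xi) = (fun xi => dot xi x)); first exact: measurable_dotl.
by apply/funext => xi; rewrite dotC.
Qed.

Lemma measurable_dot_sub x xi : measurable_fun setT (fun y => dot (x - y) xi).
Proof.
apply: measurable_sum => j; apply: measurable_funM => //.
by under eq_fun do rewrite !mxE; apply: measurable_funB => //; exact: measurable_coord.
Qed.

(** The integrand of the inversion formula, [\int u(y) cos (2 pi (x - y).xi + th) dy], expanded
    through transforms of [u] so that its integrability in [xi] is visible. *)
Definition inner_cos th u x xi : R :=
  cos (2 * pi * dot x xi + th) * costr 0 u xi +
  sin (2 * pi * dot x xi + th) * costr (- (pi / 2)) u xi.

Lemma inner_cosE th u x xi : schwartzR u ->
  inner_cos th u x xi = \int[mu]_y (cos (2 * pi * dot (x - y) xi + th) * u y).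
Proof.
move=> su; rewrite /inner_cos /costr -!RintegralZl//; try exact: integrable_cosM.
rewrite -RintegralD//; last 2 first.
- exact: (integrableZl measurableT _ (integrable_cosM _ _ su)).
- exact: (integrableZl measurableT _ (integrable_cosM _ _ su)).
apply: eq_Rintegral => y _; rewrite addr0 cosBpihalf !mulrA -mulrDl -cosB.
by congr (cos _ * _); rewrite dotBl; ring.
Qed.

Lemma inner_cos_integrable th u x : schwartzR u ->
  mu.-integrable setT (EFin \o inner_cos th u x) /\
  mu.-integrable setT (EFin \o (fun xi => `|costr 0 u xi| + `|costr (- (pi / 2)) u xi|)) /\
  forall xi, `|inner_cos th u x xi| <= `|costr 0 u xi| + `|costr (- (pi / 2)) u xi|.
Proof.
move=> su.
have s0 := costr_schwartz 0 su; have s1 := costr_schwartz (- (pi / 2)) su.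
have ib : mu.-integrable setT (EFin \o (fun xi => `|costr 0 u xi| + `|costr (- (pi / 2)) u xi|)).
  exact: (integrableD measurableT (integrable_norm (schwartzR_integrable s0))
    (integrable_norm (schwartzR_integrable s1))).
have lb xi : `|inner_cos th u x xi| <= `|costr 0 u xi| + `|costr (- (pi / 2)) u xi|.
  rewrite /inner_cos (le_trans (ler_normD _ _))// !normrM.
  by rewrite lerD// ler_piMl ?cos_max ?sin_max.
split; last by split.
apply: (integrable_le _ lb) => //.
have md : measurable_fun setT (fun xi => 2 * pi * dot x xi + th).
  apply: measurable_funD => //; apply: measurable_funM => //.
  exact: measurable_dotr.
apply: measurable_funD; apply: measurable_funM.
- exact: (measurableT_comp (continuous_measurable_fun (@continuous_cos R)) md).
- exact: schwartzR_measurable.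
- exact: (measurableT_comp (continuous_measurable_fun (@continuous_sin R)) md).
- exact: schwartzR_measurable.
Qed.

(* Fubini against the Laplace kernel [lap], whose transform is a product of
   Poisson kernels; [eps] tends to 0 in [cos_inversion]. *)
Lemma lap_inversion th u x (eps : R) : 0 < eps -> schwartzR u ->
  \int[mu]_xi (lap eps xi * inner_cos th u x xi) =
  cos th * (pi ^- n * \int[mu]_y (u ((eps / (2 * pi)) *: y + x) * wt y)).
Proof.
move=> e0 su; have [C C0 uC] := schwartzR_wt 1 su.
have {}uC y : `|u y| <= C * wt y by rewrite -[wt y]expr1.
pose f (p : 'rV[R]_n * 'rV[R]_n) :=
  lap eps p.1 * (cos (2 * pi * dot (x - p.2) p.1 + th) * u p.2).
pose M := (1 + 4 / eps ^+ 2) ^+ n.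
have M0 : 0 <= M by rewrite exprn_ge0// addr_ge0// divr_ge0// sqr_ge0.
have mu_u := schwartzR_measurable su.
have mdot : measurable_fun setT (fun p : 'rV[R]_n * 'rV[R]_n => dot (x - p.2) p.1).
  apply: measurable_sum => j; apply: measurable_funM.
    under eq_fun do rewrite !mxE; apply: measurable_funB => //.
    by apply: (measurableT_comp (measurable_coord j)).
  by apply: (measurableT_comp (measurable_coord j)).
have mf : measurable_fun setT f.
  apply: measurable_funM.
    exact: (measurableT_comp (@measurable_lap R n eps) measurable_fst).
  apply: measurable_funM; last exact: (measurableT_comp mu_u measurable_snd).
  apply: (measurableT_comp (continuous_measurable_fun (@continuous_cos R))).
  by apply: measurable_funD => //; apply: measurable_funM.
have w0 := @wt_gt0 R n.
have iw c := integrableZl measurableT c (@integrable_wt R n).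
have fb a y : `|f (a, y)| <= (M * wt a) * (C * wt y).
  rewrite /f /= normrM (gtr0_norm (lap_gt0 _ _)) ler_pM ?(ltW (lap_gt0 _ _))//.
    exact: lap_le_wt.
  rewrite normrM; apply: le_trans (uC y).
  by rewrite ler_piMl// cos_max.
have iF : (mu \x mu)%E.-integrable setT (EFin \o f).
  apply: (integrable_prod (g := fun a => M * wt a) (h := fun y => C * wt y)) => //.
  - by move=> a; rewrite mulr_ge0// ltW.
  - by move=> y; rewrite mulr_ge0// ltW.
  - exact: iw.
  - exact: iw.
have i1 a : mu.-integrable setT (fun y => (f (a, y))%:E).
  apply: (integrable_le (g := fun y => (M * wt a * C) * wt y)).
  - by apply: (measurableT_comp mf); exact: measurable_fun_pair.
  - by move=> y; rewrite -mulrA.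
  - exact: iw.
have i2 y : mu.-integrable setT (fun a => (f (a, y))%:E).
  apply: (integrable_le (g := fun a => (M * (C * wt y)) * wt a)).
  - by apply: (measurableT_comp mf); exact: measurable_fun_pair.
  - by move=> a; rewrite mulrAC.
  - exact: iw.
have -> : \int[mu]_xi (lap eps xi * inner_cos th u x xi) = \int[mu]_a \int[mu]_y f (a, y).
  apply: eq_Rintegral => a _; rewrite inner_cosE// -RintegralZl//.
  apply: (@integrable_mul_bounded _ _ _ _ _ _ 1).
  - apply: (measurableT_comp (continuous_measurable_fun (@continuous_cos R))).
    apply: measurable_funD => //; apply: measurable_funM => //.
    exact: measurable_dot_sub.
  - by move=> y; exact: cos_max.
  - exact: schwartzR_integrable.
rewrite (Rintegral_fubini iF i1 i2).
pose k y := \prod_(j < n) (2 * eps / (eps ^+ 2 + (2 * pi * (x - y) ord0 j) ^+ 2)).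
have d0 (s : R) : 0 < eps ^+ 2 + s ^+ 2 by rewrite ltr_pwDl ?exprn_gt0// sqr_ge0.
have k0 y : 0 <= k y <= (2 / eps) ^+ n.
  rewrite /k; apply/andP; split.
    by apply: prodr_ge0 => j _; rewrite divr_ge0 ?mulr_ge0 ?(ltW (d0 _)) ?(ltW e0).
  have -> : (2 / eps) ^+ n = \prod_(j < n) (2 / eps) :> R by rewrite prodr_const card_ord.
  apply: ler_prod => j _; rewrite divr_ge0 ?mulr_ge0 ?(ltW (d0 _)) ?(ltW e0)//=.
  rewrite ler_pdivrMr// mulrDr (_ : 2 / eps * eps ^+ 2 = 2 * eps); last by field; exact: lt0r_neq0.
  by rewrite lerDl mulr_ge0 ?sqr_ge0 ?divr_ge0// ltW.
have mk : measurable_fun setT k.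
  apply: measurable_prod => j _; apply: measurable_funM => //.
  apply: (measurableT_comp (f := fun s : R => (eps ^+ 2 + (2 * pi * s) ^+ 2)^-1)).
    apply: continuous_measurable_fun => s; apply: cvgV; first exact: lt0r_neq0.
    apply: cvgD; first exact: cvg_cst.
    apply: (@continuous_comp _ _ _ (fun s : R => 2 * pi * s) (fun t : R => t ^+ 2)).
      by apply: cvgM; [exact: cvg_cst|exact: cvg_id].
    exact: exprn_continuous.
  under eq_fun do rewrite !mxE; apply: measurable_funB => //; exact: measurable_coord.
have iku : mu.-integrable setT (EFin \o (fun y => k y * u y)).
  apply: (@integrable_mul_bounded _ _ _ _ _ _ ((2 / eps) ^+ n)) => //.
  - by move=> y; have /andP[k1 k2] := k0 y; rewrite ger0_norm.
  - exact: schwartzR_integrable.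
have -> : \int[mu]_y \int[mu]_a f (a, y) = \int[mu]_y (cos th * (k y * u y)).
  apply: eq_Rintegral => y _; rewrite /f mulrA -integral_cos_lap//.
  rewrite -RintegralZr//; last exact: integrable_cos_lap.
  by apply: eq_Rintegral => a _; ring.
rewrite RintegralZl//; congr (_ * _).
have a0 : 0 < eps / (2 * pi) by rewrite divr_gt0// mulr_gt0// pi_gt0.
(* This substitution rescales the Poisson kernel to the fixed weight [wt]; [eps] survives only in
   the argument of [u]. *)
rewrite -(Rintegral_affine x a0 iku).
have iwu : mu.-integrable setT (EFin \o (fun y => u ((eps / (2 * pi)) *: y + x) * wt y)).
  apply: (@integrable_mul_bounded _ _ _ _ _ _ C); last exact: integrable_wt.
    by apply: (measurableT_comp mu_u); exact: measurable_affine.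
  move=> y; rewrite (le_trans (uC _))// ler_piMr// /wt.
  by apply: prodr_ile1 => j _; rewrite invr_ge0 addr_ge0 ?sqr_ge0//= invf_le1 ?ltr_wpDr ?sqr_ge0// lerDl sqr_ge0.
rewrite -!RintegralZl//; last first.
  exact: (integrable_affine x a0 iku).
apply: eq_Rintegral => y _.
rewrite [_ * wt y]mulrC !mulrA; congr (_ * _).
rewrite /k /wt.
have prc (c : R) : c ^+ n = \prod_(j < n) c by rewrite prodr_const card_ord.
rewrite -exprVn !prc -!big_split/=; apply: eq_bigr => j _.
rewrite !mxE opprD addrA addrAC subrr add0r mulrN sqrrN.
have p0 : (pi : R) != 0 by rewrite gt_eqF// pi_gt0.
have y0 : 1 + y ord0 j ^+ 2 != 0 by rewrite gt_eqF// ltr_wpDr ?sqr_ge0.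
rewrite (_ : 2 * pi * (eps / (2 * pi) * y ord0 j) = eps * y ord0 j); last first.
  by rewrite mulrA [2 * pi * _]mulrC divfK// mulf_neq0.
rewrite (_ : eps ^+ 2 + (eps * y ord0 j) ^+ 2 = eps ^+ 2 * (1 + y ord0 j ^+ 2)); last by ring.
have := lt0r_neq0 e0; move: y0 p0; move: (1 + _) (pi : R) => Y q Y0 q0 E0.
by field; rewrite ?q0 ?Y0 ?E0.
Qed.

(** Both sides of [lap_inversion] converge by domination: on the left [lap] increases to 1, on the
    right [u] is bounded and continuous against [wt], whose mass [pi ^+ n] cancels the
    normalization. *)
Theorem cos_inversion th u x : schwartzR u ->
  \int[mu]_xi inner_cos th u x xi = cos th * u x.
Proof.
move=> su.
pose e (k : nat) : R := k.+1%:R^-1.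
have e0 k : 0 < e k by rewrite invr_gt0.
have ce : e @ \oo --> 0 by exact: cvg_harmonic.
have [ii [ib lb]] := inner_cos_integrable th x su.
have [C uC] := schwartzR_bounded su.
have mi : measurable_fun setT (inner_cos th u x).
  by apply/measurable_EFinP; exact: measurable_int ii.
have c1 : (fun k => \int[mu]_xi (lap (e k) xi * inner_cos th u x xi)) @ \oo -->
    \int[mu]_xi inner_cos th u x xi.
  apply: (@Rintegral_cvg _ _ _ mu _ _ (fun xi => `|costr 0 u xi| + `|costr (- (pi / 2)) u xi|)) => //.
  - by move=> k; apply: measurable_funM => //; exact: measurable_lap.
  - move=> xi; rewrite -[X in _ --> X]mul1r; apply: cvgM; last exact: cvg_cst.
    rewrite /lap; elim: (index_enum _) => [|j s IH].
      rewrite (_ : (fun k => _) = cst 1); first exact: cvg_cst.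
      by apply/funext => k; rewrite big_nil.
    rewrite (_ : (fun k => _) = (fun k => expR (- e k * `|xi ord0 j|) *
      \prod_(j <- s) expR (- e k * `|xi ord0 j|))); last first.
      by apply/funext => k; rewrite big_cons.
    rewrite -[X in _ --> X]mul1r; apply: cvgM => //.
    have H : (fun k => - e k * `|xi ord0 j|) @ \oo --> 0.
      rewrite [X in _ --> X](_ : 0 = - 0 * `|xi ord0 j|); last by rewrite oppr0 mul0r.
      by apply: cvgM; [exact: cvgN|exact: cvg_cst].
    by have := cvg_comp _ _ H (@continuous_expR R 0); rewrite expR0.
  - move=> k xi; rewrite normrM gtr0_norm ?lap_gt0//.
    by apply: le_trans (lb xi); rewrite ler_piMl// lap_le1.
rewrite (_ : (fun k => _) = fun k => cos th *
  (pi ^- n * \int[mu]_y (u ((e k / (2 * pi)) *: y + x) * wt y))) in c1; last first.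
  by apply/funext => k; exact: lap_inversion.
have c2 : (fun k => \int[mu]_y (u ((e k / (2 * pi)) *: y + x) * wt y)) @ \oo -->
    \int[mu]_y (u x * wt y).
  apply: (@Rintegral_cvg _ _ _ mu _ _ (fun y => C * wt y)).
  - move=> k; apply: measurable_funM; last exact: measurable_wt.
    by apply: (measurableT_comp (schwartzR_measurable su)); exact: measurable_affine.
  - move=> y; apply: cvgM; last exact: cvg_cst.
    have H : (fun k => (e k / (2 * pi)) *: y + x) @ \oo --> x.
      rewrite -[X in _ --> X]add0r; apply: cvgD; last exact: cvg_cst.
      rewrite -[X in _ --> X](scale0r y); apply: cvgZr_tmp.
      rewrite -[X in _ --> X](mul0r ((2 * pi)^-1 : R)).
      by apply: cvgM => //; exact: cvg_cst.
    exact: (cvg_comp _ _ H (smoothV_continuous (schwartzR_smooth su) (x := x))).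
  - move=> k y; rewrite normrM (gtr0_norm (wt_gt0 _)) ler_wpM2r// ltW//; exact: wt_gt0.
  - exact: (integrableZl measurableT C (@integrable_wt R n)).
have E : \int[mu]_y (u x * wt y) = u x * pi ^+ n.
  rewrite RintegralZl//; last exact: integrable_wt.
  by rewrite /Rintegral integral_wt.
have c3 : (fun k => cos th * (pi ^- n * \int[mu]_y (u ((e k / (2 * pi)) *: y + x) * wt y)))
    @ \oo --> cos th * u x.
  rewrite (_ : u x = pi ^- n * \int[mu]_y (u x * wt y)); last first.
    by rewrite E mulrCA mulVf ?mulr1// expf_neq0// gt_eqF// pi_gt0.
  by apply: cvgM; [exact: cvg_cst|apply: cvgM => //; exact: cvg_cst].
by rewrite -(cvg_lim _ c1)// (cvg_lim _ c3).
Qed.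

End Inversion.

(** * Complex Fourier inversion and multiplier operators *)

Section ComplexFourier.
Variables (R : realType) (n : nat).
Local Notation mu := (leb R n).
Implicit Types (f g G h : 'rV[R]_n -> R[i]) (x xi : 'rV[R]_n).

Lemma complex_ReM (z w : R[i]) : Re (z * w) = Re z * Re w - Im z * Im w.
Proof. by case: z => a b; case: w. Qed.

Lemma complex_ImM (z w : R[i]) : Im (z * w) = Re z * Im w + Im z * Re w.
Proof. by case: z => a b; case: w. Qed.

Lemma complex_ext (z w : R[i]) : Re z = Re w -> Im z = Im w -> z = w.
Proof. by case: z => a b; case: w => c d /= -> ->. Qed.

Definition invF G x : R[i] := integralC (fun xi => expi (2 * pi * dot x xi) * G xi).

Lemma Re_fourier f xi : schwartz f ->
  Re (fourier f xi) = costr 0 (Re \o f) xi + costr (- (pi / 2)) (Im \o f) xi.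
Proof.
move=> [sr si]; rewrite /fourier /= /costr -RintegralD//; try exact: integrable_cosM.
apply: eq_Rintegral => x _; rewrite complex_ReM/= cosN sinN addr0 cosBpihalf; ring.
Qed.

Lemma Im_fourier f xi : schwartz f ->
  Im (fourier f xi) = costr 0 (Im \o f) xi - costr (- (pi / 2)) (Re \o f) xi.
Proof.
move=> [sr si]; rewrite /fourier /= /costr -RintegralB//; try exact: integrable_cosM.
apply: eq_Rintegral => x _; rewrite complex_ImM/= cosN sinN addr0 cosBpihalf; ring.
Qed.

Lemma Re_invF G x : schwartz G ->
  Re (invF G x) = costr 0 (Re \o G) x - costr (- (pi / 2)) (Im \o G) x.
Proof.
move=> [sr si]; rewrite /invF /= /costr -RintegralB//; try exact: integrable_cosM.
by apply: eq_Rintegral => y _; rewrite complex_ReM/= dotC addr0 cosBpihalf.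
Qed.

Lemma Im_invF G x : schwartz G ->
  Im (invF G x) = costr 0 (Im \o G) x + costr (- (pi / 2)) (Re \o G) x.
Proof.
move=> [sr si]; rewrite /invF /= /costr -RintegralD//; try exact: integrable_cosM.
by apply: eq_Rintegral => y _; rewrite complex_ImM/= dotC addr0 cosBpihalf.
Qed.

Lemma fourier_schwartz f : schwartz f -> schwartz (fourier f).
Proof.
move=> sf; have [sr si] := sf; split.
- rewrite (_ : _ \o _ = fun xi => costr 0 (Re \o f) xi + costr (- (pi / 2)) (Im \o f) xi).
    by apply: schwartzRD; exact: costr_schwartz.
  by apply/funext => xi; rewrite /= -Re_fourier.
- rewrite (_ : _ \o _ = fun xi => costr 0 (Im \o f) xi + -1 * costr (- (pi / 2)) (Re \o f) xi).
    by apply: schwartzRD; [|apply: schwartzRZ]; exact: costr_schwartz.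
  by apply/funext => xi; rewrite mulN1r -Im_fourier.
Qed.

Lemma invF_schwartz G : schwartz G -> schwartz (invF G).
Proof.
move=> sG; have [sr si] := sG; split.
- rewrite (_ : _ \o _ = fun xi => costr 0 (Re \o G) xi + -1 * costr (- (pi / 2)) (Im \o G) xi).
    by apply: schwartzRD; [|apply: schwartzRZ]; exact: costr_schwartz.
  by apply/funext => xi; rewrite mulN1r -Re_invF.
- rewrite (_ : _ \o _ = fun xi => costr 0 (Im \o G) xi + costr (- (pi / 2)) (Re \o G) xi).
    by apply: schwartzRD; exact: costr_schwartz.
  by apply/funext => xi; rewrite /= -Im_invF.
Qed.

Lemma inner_cos_sum (th1 th2 : R) (u v : 'rV[R]_n -> R) x :
  schwartzR u -> schwartzR v ->
  \int[mu]_xi (inner_cos th1 u x xi + inner_cos th2 v x xi) =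
  cos th1 * u x + cos th2 * v x.
Proof.
move=> su sv; rewrite RintegralD//; first by rewrite !cos_inversion.
- by case: (inner_cos_integrable th1 x su).
- by case: (inner_cos_integrable th2 x sv).
Qed.

(** Each component is the integral of two [inner_cos]: phase 0 returns the function, and phase
    [pi / 2] or [- pi / 2] contributes 0. *)
Theorem invF_fourier h x : schwartz h -> invF (fourier h) x = h x.
Proof.
move=> sh; have [sr si] := sh; apply: complex_ext.
- change (\int[mu]_xi Re (expi (2 * pi * dot x xi) * fourier h xi) = Re (h x)).
  under eq_Rintegral => xi _ do rewrite complex_ReM Re_fourier// Im_fourier//=.
  transitivity (\int[mu]_xi (inner_cos 0 (Re \o h) x xi + inner_cos (pi / 2) (Im \o h) x xi)).
    apply: eq_Rintegral => xi _; rewrite /inner_cos !addr0 cosDpihalf sinDpihalf; ring.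
  by rewrite inner_cos_sum// cos0 cos_pihalf mul1r mul0r addr0.
- change (\int[mu]_xi Im (expi (2 * pi * dot x xi) * fourier h xi) = Im (h x)).
  under eq_Rintegral => xi _ do rewrite complex_ImM Re_fourier// Im_fourier//=.
  transitivity (\int[mu]_xi (inner_cos 0 (Im \o h) x xi + inner_cos (- (pi / 2)) (Re \o h) x xi)).
    apply: eq_Rintegral => xi _; rewrite /inner_cos !addr0 cosBpihalf sinBpihalf; ring.
  by rewrite inner_cos_sum// cos0 cosN cos_pihalf mul1r mul0r addr0.
Qed.

Theorem fourier_invF G xi : schwartz G -> fourier (invF G) xi = G xi.
Proof.
move=> sG; have [sr si] := sG; apply: complex_ext.
- change (\int[mu]_x Re (expi (- (2 * pi * dot x xi)) * invF G x) = Re (G xi)).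
  under eq_Rintegral => x _ do rewrite complex_ReM Re_invF// Im_invF//= cosN sinN dotC.
  transitivity (\int[mu]_x (inner_cos 0 (Re \o G) xi x + inner_cos (- (pi / 2)) (Im \o G) xi x)).
    apply: eq_Rintegral => x _; rewrite /inner_cos !addr0 cosBpihalf sinBpihalf; ring.
  by rewrite inner_cos_sum// cos0 cosN cos_pihalf mul1r mul0r addr0.
- change (\int[mu]_x Im (expi (- (2 * pi * dot x xi)) * invF G x) = Im (G xi)).
  under eq_Rintegral => x _ do rewrite complex_ImM Re_invF// Im_invF//= cosN sinN dotC.
  transitivity (\int[mu]_x (inner_cos 0 (Im \o G) xi x + inner_cos (pi / 2) (Re \o G) xi x)).
    apply: eq_Rintegral => x _; rewrite /inner_cos !addr0 cosDpihalf sinDpihalf; ring.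
  by rewrite inner_cos_sum// cos0 cos_pihalf mul1r mul0r addr0.
Qed.

(** [fourier_invF] supplies a witness, so [xget] does not fall back on 0; [invF_fourier] identifies
    whatever was chosen with that witness. *)
Lemma multiplierE (m : 'rV[R]_n -> R[i]) f :
  schwartz (fun xi => m xi * fourier f xi) ->
  multiplier m f = invF (fun xi => m xi * fourier f xi).
Proof.
set G := fun xi => _ => sG; rewrite /multiplier.
have e : [set h | schwartz h /\ forall xi, fourier h xi = G xi] (invF G).
  by split; [exact: invF_schwartz|move=> xi; exact: fourier_invF].
have [sh hG] := xgetPex (fun=> 0) (ex_intro _ _ e).
apply/funext => x; rewrite -[LHS]invF_fourier//.
by congr (invF _ x); apply/funext => xi; rewrite hG.
Qed.

Lemma schwartz_radial_mul (phi : R -> R[i]) (rho delta : R) f : 0 < delta ->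
  smoothC phi -> (forall t, 1 < `|t| -> phi t = 0) -> schwartz f ->
  schwartz (fun xi => phi ((sqnorm xi - rho) / delta) * f xi).
Proof.
move=> d0 [sr si] phi0 [fr fi].
have sq : smoothV (fun xi : 'rV[R]_n => (sqnorm xi - rho) / delta).
  apply: smoothVM; last exact: smoothV_cst.
  by apply: smoothVD; [exact: smoothV_sqnorm|exact: smoothV_cst].
have pr := smoothV_comp sr sq; have pI := smoothV_comp si sq.
have gr := schwartzR_smooth fr; have gi := schwartzR_smooth fi.
have z xi j : 1 + `|rho| + delta < `|xi ord0 j| -> phi ((sqnorm xi - rho) / delta) = 0.
  move=> H; apply: phi0.
  (* A coordinate larger than 1 is at most its square, hence at most [sqnorm xi], so that
     [sqnorm xi - rho] exceeds [delta]. *)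
  rewrite normrM (gtr0_norm (_ : 0 < delta^-1)) ?invr_gt0// ltr_pdivlMr// mul1r.
  have h1 : xi ord0 j ^+ 2 <= sqnorm xi.
    rewrite /sqnorm /dot (bigD1 j)//= -expr2 lerDl.
    by apply: sumr_ge0 => k _; rewrite -expr2 sqr_ge0.
  have h2 : `|xi ord0 j| <= xi ord0 j ^+ 2.
    rewrite -[leRHS]real_normK ?num_real// expr2 ler_peMr//.
    by have := normr_ge0 rho; lra.
  by have := ler_norm rho; have := ler_norm (sqnorm xi - rho); lra.
split; apply: (@smooth_compact_schwartz _ _ (1 + `|rho| + delta)).
- rewrite (_ : _ \o _ = fun xi => (Re \o phi) ((sqnorm xi - rho) / delta) * (Re \o f) xi +
    -1 * ((Im \o phi) ((sqnorm xi - rho) / delta) * (Im \o f) xi)).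
    apply: smoothVD; first exact: smoothVM.
    by apply: smoothVM; [exact: smoothV_cst|exact: smoothVM].
  by apply/funext => xi; rewrite mulN1r /= complex_ReM.
- by move=> xi j /z /= ->; rewrite mul0r.
- rewrite (_ : _ \o _ = fun xi => (Re \o phi) ((sqnorm xi - rho) / delta) * (Im \o f) xi +
    (Im \o phi) ((sqnorm xi - rho) / delta) * (Re \o f) xi).
    by apply: smoothVD; exact: smoothVM.
  by apply/funext => xi; rewrite /= complex_ImM.
- by move=> xi j /z /= ->; rewrite mul0r.
Qed.

Lemma classC_eq0 (N : nat) (phi : R -> R[i]) (t : R) :
  classC N `[-1, 1] phi -> 1 < `|t| -> phi t = 0.
Proof.
move=> [_ sub _] t1; apply/eqP/negPn/negP => pt.
have /sub /= : csupport phi t by exact: subset_closure.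
by rewrite in_itv/= -ler_norml leNgt t1.
Qed.

Lemma Sop_invF (N : nat) (phi : R -> R[i]) (rho delta : R) f : 0 < delta ->
  classC N `[-1, 1] phi -> schwartz f ->
  schwartz (fun xi => phi ((sqnorm xi - rho) / delta) * fourier f xi) /\
  Sop phi rho delta f = invF (fun xi => phi ((sqnorm xi - rho) / delta) * fourier f xi).
Proof.
move=> d0 cphi sf.
have sG : schwartz (fun xi => phi ((sqnorm xi - rho) / delta) * fourier f xi).
  apply: schwartz_radial_mul => //; [by case: cphi|exact: (fun t => classC_eq0 cphi)|exact: fourier_schwartz].
by split => //; exact: multiplierE.
Qed.

End ComplexFourier.

(** * Fourier series of period 8 *)

Section FourierSeriesPoint.
Variable R : realType.
Local Notation mu := (@lebesgue_measure R).
Local Notation J := (`[- 4, 4]%classic : set (measurableTypeR R)).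
Implicit Types (f g u : R -> R).

Let mJ : measurable J. Proof. exact: measurable_itv. Qed.

Let mu_J : mu J = (8 : R)%:E.
Proof.
apply: etrans (lebesgue_measure_itv _) _; rewrite /= lte_fin ifT; last by lra.
by rewrite -EFinD; congr EFin; ring.
Qed.

Lemma integrable_J f (C : R) :
  measurable_fun (setT : set (measurableTypeR R)) f -> (forall y, J y -> `|f y| <= C) ->
  mu.-integrable J (EFin \o f).
Proof.
move=> mf fC; apply: measurable_bounded_integrable => //.
- have H : (mu J < +oo)%E by rewrite mu_J ltry.
  exact: H.
- exact: measurable_funS mf.
- exists C; split; first exact: num_real.
  by move=> M CM y Jy; apply: (le_trans (fC y Jy)); exact: ltW.
Qed.

Lemma measurable_cosM (c : R) :
  measurable_fun (setT : set (measurableTypeR R)) (fun y : R => cos (c * y)).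
Proof.
apply: (measurableT_comp (continuous_measurable_fun (@continuous_cos R))).
exact: measurable_funM.
Qed.

Lemma measurable_sinM (c : R) :
  measurable_fun (setT : set (measurableTypeR R)) (fun y : R => sin (c * y)).
Proof.
apply: (measurableT_comp (continuous_measurable_fun (@continuous_sin R))).
exact: measurable_funM.
Qed.

(** A pointwise limit of continuous functions, which all vanish at 0 in agreement with the
    convention [0^-1 = 0]. *)
Lemma measurable_inv :
  measurable_fun (setT : set (measurableTypeR R)) (fun s : R => s^-1).
Proof.
apply: (@measurable_fun_cvg _ (measurableTypeR R) _ setT
  (fun k s => s * (s ^+ 2 + k.+1%:R^-1)^-1)).
  move=> k; apply: continuous_measurable_fun => s; apply: cvgM; first exact: cvg_id.
  apply: cvgV; first by rewrite gt_eqF// ltr_wpDl ?sqr_ge0.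
  by apply: cvgD; [exact: exprn_continuous|exact: cvg_cst].
move=> s _; have [->|s0] := eqVneq s 0.
  rewrite (_ : (fun k => _) = cst 0); first by rewrite invr0; exact: cvg_cst.
  by apply/funext => k; rewrite mul0r.
have -> : s^-1 = s * (s ^+ 2 + 0)^-1 by rewrite addr0; field.
apply: cvgM; first exact: cvg_cst.
apply: cvgV; first by rewrite addr0 expf_neq0.
by apply: cvgD; [exact: cvg_cst|exact: cvg_harmonic].
Qed.

Lemma sin_natpi (k : nat) : sin (k%:R * pi : R) = 0.
Proof.
elim: k => [|k IH]; first by rewrite mul0r sin0.
by rewrite mulrSr mulrDl mul1r sinD IH sinpi mulr0 mul0r addr0.
Qed.

Lemma integral_cos_J (k : nat) :
  \int[mu]_(y in J) cos (k%:R * pi / 4 * y) = if k == 0%N then 8 else 0.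
Proof.
have lt44 : (- 4 : R) < 4 by lra.
case: k => [|k] /=.
  under eq_Rintegral do rewrite !mul0r cos0.
  transitivity (1 * fine (mu J)); first exact: Rintegral_cst.
  by rewrite mu_J mul1r.
set c := k.+1%:R * pi / 4.
have c0 : c != 0 by rewrite gt_eqF// divr_gt0// mulr_gt0 ?pi_gt0// ltr0n.
have dF (t : R) : is_derive t 1 (fun y => sin (c * y) / c) (cos (c * t)).
  apply: is_derive_eq.
  by rewrite /GRing.scale/= !(mulr1, mulr0, addr0, add0r); field.
rewrite (Rintegral_FTC2 lt44 dF); last first.
  move=> t; apply: continuous_comp; last exact: continuous_cos.
  by apply: cvgM; [exact: cvg_cst|exact: cvg_id].
have -> : c * 4 = k.+1%:R * pi by rewrite /c divfK// pnatr_eq0.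
have -> : c * - 4 = - (k.+1%:R * pi) by rewrite mulrN /c divfK// pnatr_eq0.
by rewrite sinN sin_natpi oppr0 !mul0r subrr.
Qed.

(** The numerator of the Dirichlet kernel of period 8. These half-integer modes are orthogonal on
    [J], so Bessel's inequality applies to them directly. *)
Definition sodd (M : nat) (y : R) : R := sin ((2 * M%:R + 1) * pi / 8 * y).

Lemma measurable_sodd M : measurable_fun (setT : set (measurableTypeR R)) (sodd M).
Proof. exact: measurable_sinM. Qed.

Lemma sodd_le1 M y : `|sodd M y| <= 1. Proof. exact: sin_max. Qed.

Lemma sodd_orthogonal (M N : nat) :
  \int[mu]_(y in J) (sodd M y * sodd N y) = if M == N then 4 else 0.
Proof.
wlog MN : M N / (M <= N)%N.
  move=> H; have [/H//|/ltnW/H] := leqP M N.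
  by rewrite eq_sym => <-; apply: eq_Rintegral => y _; rewrite mulrC.
have E y : sodd M y * sodd N y =
    2^-1 * cos ((N - M)%:R * pi / 4 * y) - 2^-1 * cos ((M + N).+1%:R * pi / 4 * y).
  rewrite /sodd; set a := _ * y; set b := _ * y.
  have -> : (N - M)%:R * pi / 4 * y = b - a by rewrite /a /b natrB//; field.
  have -> : (M + N).+1%:R * pi / 4 * y = a + b by rewrite /a /b mulrSr natrD; field.
  by rewrite cosB cosD; field.
under eq_Rintegral do rewrite E.
have ic c : mu.-integrable J (EFin \o (fun y => cos (c * y))).
  by apply: (@integrable_J _ 1); [exact: measurable_cosM|move=> y _; exact: cos_max].
rewrite RintegralB//; last 2 first.
- exact: (integrableZl mJ _ (ic _)).
- exact: (integrableZl mJ _ (ic _)).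
rewrite !RintegralZl// !integral_cos_J /= mulr0 subr0 subn_eq0.
have [->|nMN] := eqVneq M N; first by rewrite leqnn; field.
by rewrite leqNgt ltn_neqAle nMN MN/= mulr0.
Qed.

(** Removing mode [K] lowers the squared norm of the residual [H K] by [g K ^+ 2 / 4]. The squares
    are thus summable and tend to 0. *)
Lemma bessel_cvg0 (G : R -> R) (C : R) :
  measurable_fun (setT : set (measurableTypeR R)) G ->
  (forall y, J y -> `|G y| <= C) ->
  (fun M => \int[mu]_(y in J) (G y * sodd M y)) @ \oo --> 0.
Proof.
move=> mG GC; pose g M := \int[mu]_(y in J) (G y * sodd M y).
pose P (K : nat) y := \sum_(M < K) (g M / 4 * sodd M y).
have mP K : measurable_fun (setT : set (measurableTypeR R)) (P K).
  by apply: measurable_sum => M; apply: measurable_funM => //; exact: measurable_sodd.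
have Pb K y : `|P K y| <= \sum_(M < K) `|g M / 4|.
  rewrite /P (le_trans (ler_norm_sum _ _ _))//; apply: ler_sum => M _.
  by rewrite normrM ler_piMr// sodd_le1.
pose H K y := G y - P K y.
have mH K : measurable_fun (setT : set (measurableTypeR R)) (H K) by exact: measurable_funB.
pose B K := C + \sum_(M < K) `|g M / 4|.
have Hb K y : J y -> `|H K y| <= B K.
  by move=> Jy; rewrite /H (le_trans (ler_normB _ _))// lerD// GC.
have iMb f1 f2 (C1 C2 : R) : measurable_fun (setT : set (measurableTypeR R)) f1 ->
    measurable_fun (setT : set (measurableTypeR R)) f2 ->
    (forall y, J y -> `|f1 y| <= C1) -> (forall y, J y -> `|f2 y| <= C2) ->
    mu.-integrable J (EFin \o (fun y => f1 y * f2 y)).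
  move=> m1 m2 b1 b2; apply: (@integrable_J _ (C1 * C2)); first exact: measurable_funM.
  by move=> y Jy; rewrite normrM ler_pM// ?b1 ?b2.
have iGs M := iMb _ _ _ _ mG (measurable_sodd M) GC (fun y _ => sodd_le1 M y).
have iss M N := iMb _ _ _ _ (measurable_sodd M) (measurable_sodd N)
  (fun y _ => sodd_le1 M y) (fun y _ => sodd_le1 N y).
have iHs K M := iMb _ _ _ _ (mH K) (measurable_sodd M) (Hb K) (fun y _ => sodd_le1 M y).
have iHH K := iMb _ _ _ _ (mH K) (mH K) (Hb K) (Hb K).
have HsE K M : (K <= M)%N -> \int[mu]_(y in J) (H K y * sodd M y) = g M.
  elim: K => [_|K IH KM].
    by apply: eq_Rintegral => y _; rewrite /H /P big_ord0 subr0.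
  have -> : \int[mu]_(y in J) (H K.+1 y * sodd M y) =
      \int[mu]_(y in J) (H K y * sodd M y - g K / 4 * (sodd K y * sodd M y)).
    by apply: eq_Rintegral => y _; rewrite /H /P big_ord_recr/=; ring.
  rewrite RintegralB//; last exact: (integrableZl mJ _ (iss _ _)).
  rewrite IH ?(ltnW KM)// RintegralZl// sodd_orthogonal.
  by rewrite (ltn_eqF KM) mulr0 subr0.
have HHE K : \int[mu]_(y in J) (H K.+1 y * H K.+1 y) =
    \int[mu]_(y in J) (H K y * H K y) - g K ^+ 2 / 4.
  have -> : \int[mu]_(y in J) (H K.+1 y * H K.+1 y) =
      \int[mu]_(y in J) (H K y * H K y - (g K / 2 * (H K y * sodd K y) -
        (g K / 4) ^+ 2 * (sodd K y * sodd K y))).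
    by apply: eq_Rintegral => y _; rewrite /H /P big_ord_recr/=; field.
  have i1 := integrableZl mJ (g K / 2) (iHs K K).
  have i2 := integrableZl mJ ((g K / 4) ^+ 2) (iss K K).
  rewrite RintegralB//; last exact: (integrableB mJ i1 i2).
  by rewrite RintegralB// !RintegralZl// HsE// sodd_orthogonal eqxx; field.
pose s K := \sum_(0 <= M < K) g M ^+ 2.
have sE K : s K = 4 * (\int[mu]_(y in J) (G y * G y) - \int[mu]_(y in J) (H K y * H K y)).
  elim: K => [|K IH].
    rewrite /s big_geq// (_ : \int[mu]_(y in J) (H 0%N y * H 0%N y) = \int[mu]_(y in J) (G y * G y)) ?subrr ?mulr0//.
    by apply: eq_Rintegral => y _; rewrite /H /P big_ord0 subr0.
  by rewrite /s big_nat_recr//= -/(s K) IH HHE; field.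
have sc : cvgn s.
  apply: nondecreasing_is_cvgn.
    by apply/nondecreasing_seqP => K; rewrite /s big_nat_recr//= lerDl sqr_ge0.
  exists (4 * \int[mu]_(y in J) (G y * G y)) => _ [K _ <-].
  rewrite sE ler_wpM2l// lerBlDr lerDl; apply: Rintegral_ge0 => y _.
  by rewrite -expr2 sqr_ge0.
have /cvgrPdist_lt g2 : (fun M => g M ^+ 2) @ \oo --> 0 by exact: (cvg_series_cvg_0 sc).
apply/cvgrPdist_lt => e e0.
have e2 : 0 < e ^+ 2 by rewrite exprn_gt0.
apply: filterS (g2 _ e2) => M; rewrite !sub0r !normrN normrX -/(g M).
by rewrite ltr_pXn2r// nnegrE// ltW.
Qed.

(** Up to 1/2, [sin x >= x - x^2 >= x / 2]; beyond, monotonicity gives [sin x >= 1/4 >= x / 8],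
    since [x <= pi / 2 <= 2]. *)
Lemma sin_lb (x : R) : `|x| <= pi / 2 -> `|x| / 8 <= `|sin x|.
Proof.
wlog x0 : x / 0 <= x.
  move=> H; have [/H//|/ltW x0] := leP 0 x.
  by have := H (- x); rewrite oppr_ge0 sinN !normrN; exact.
rewrite (ger0_norm x0) => xp.
have p2 : (pi : R) / 2 <= 2 by case/andP: (@pihalf_02 R) => _ /ltW.
apply: le_trans (ler_norm _).
have [x1|x1] := leP x 2^-1.
  have := sin_quad x; rewrite ler_norml => /andP[H _]; nra.
have : sin 2^-1 <= sin x.
  have p0 := @pi_gt0 R.
  rewrite ltW// ltr_sin// in_itv/=; apply/andP; split; lra.
have := sin_quad (2^-1 : R); rewrite ler_norml => /andP[H _]; lra.
Qed.

(** The product telescopes by [2 cos a sin b = sin (a + b) - sin (a - b)]; in this form it also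
    holds where the sine vanishes. *)
Lemma dirichlet_kernel (M : nat) (y : R) :
  (1 + \sum_(1 <= n < M.+1) 2 * cos (n%:R * pi / 4 * y)) * sin (pi / 8 * y) = sodd M y.
Proof.
elim: M => [|M IH].
  by rewrite big_geq// addr0 mul1r /sodd mulr0 add0r mul1r.
rewrite big_nat_recr//= addrA mulrDl IH /sodd.
set a := M.+1%:R * pi / 4 * y; set b := pi / 8 * y.
have -> : (2 * M%:R + 1) * pi / 8 * y = a - b by rewrite /a /b mulrSr; field.
have -> : (2 * M.+1%:R + 1) * pi / 8 * y = a + b by rewrite /a /b; field.
by rewrite sinB sinD; ring.
Qed.

(* Chernoff's argument: the error of the partial sum is the pairing of a sine mode
   with the bounded function [G], which tends to 0 by Bessel's inequality. *)
Lemma fourier_series_cvg u (z : R) : smoothR u ->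
  (forall t, ~~ (1/2 < t < 2) -> u t = 0) -> - (1/2) <= z <= 3 ->
  (fun M => 8^-1 * (\int[mu]_t u t + \sum_(1 <= n < M.+1)
     2 * \int[mu]_t (cos (n%:R * pi / 4 * (t - z)) * u t))) @ \oo --> u z.
Proof.
move=> su u0 /andP[z1 z2].
have cu : continuous u.
  by move=> t; apply: differentiable_continuous; apply/derivable1_diffP; exact: (su 0%N).
have cu' : continuous u^`()%classic.
  by move=> t; apply: differentiable_continuous; apply/derivable1_diffP; exact: (su 1%N).
have [L L0 uL] : exists2 L : R, 0 <= L & forall y, J y -> `|u (z + y) - u z| <= L * `|y|.
  (* For [z] in [-1/2, 3] and [y] in [J], both [z] and [z + y] stay in [-8, 8]. *)
  have [] : bounded_set (u^`()%classic @` `[- 8, 8]%classic).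
    apply/compact_bounded/continuous_compact; last exact: segment_compact.
    exact: continuous_subspaceT.
  move=> M0 [_ HM]; pose L := `|M0 + 1|.
  have dL (t : R) : - 8 <= t <= 8 -> `|u^`()%classic t| <= L.
    move=> t8; apply: le_trans (ler_norm _); apply: (HM (M0 + 1)); first by rewrite ltrDl.
    by exists t => //=; rewrite in_itv.
  exists L; first exact: normr_ge0.
  move=> y /=; rewrite in_itv/= => /andP[y1 y2].
  have du (t : R) : is_derive t 1 u (u^`()%classic t).
    by rewrite derive1E; apply: DeriveDef => //; exact: (su 0%N).
  have [y0|y0] := leP 0 y.
    have [||c] := @MVT_segment _ u _ z (z + y) _ (fun t _ => du t).
    - by rewrite lerDl.
    - exact: continuous_subspaceT.
    rewrite in_itv/= => /andP[c1 c2] ->.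
    by rewrite normrM addrAC subrr add0r ler_wpM2r// dL//; lra.
  have [||c] := @MVT_segment _ u _ (z + y) z _ (fun t _ => du t).
  - by rewrite gerDl ltW.
  - exact: continuous_subspaceT.
  rewrite in_itv/= => /andP[c1 c2]; rewrite distrC => ->.
  by rewrite normrM opprD addrA subrr add0r normrN ler_wpM2r// dL//; lra.
(* It is 0 at [y = 0] by the convention on division; elsewhere [uL] against [sin_lb] bounds it. *)
pose G y := (u (z + y) - u z) / sin (pi / 8 * y).
have muz : measurable_fun (setT : set (measurableTypeR R)) (fun y => u (z + y)).
  by apply: (measurableT_comp (continuous_measurable_fun cu)); exact: measurable_funD.
have mG : measurable_fun (setT : set (measurableTypeR R)) G.
  apply: measurable_funM; first exact: measurable_funB.
  apply: (measurableT_comp (f := fun s : R => s^-1)); last exact: measurable_sinM.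
  exact: measurable_inv.
have p0 := @pi_gt0 R.
have arg y : J y -> `|pi / 8 * y| <= pi / 2.
  rewrite /= in_itv/= -ler_norml => y4.
  rewrite normrM ger0_norm; last by rewrite divr_ge0// ltW.
  by nra.
have GL y : J y -> `|G y| <= 64 * L / pi.
  move=> Jy; rewrite /G normrM normfV.
  have [->|y0] := eqVneq y 0.
    by rewrite addr0 subrr normr0 mul0r divr_ge0 ?mulr_ge0// ltW.
  have y0' : 0 < `|y| by rewrite normr_gt0.
  have sl := sin_lb (arg y Jy).
  have s0 : 0 < `|sin (pi / 8 * y)|.
    apply: lt_le_trans sl; rewrite normrM (gtr0_norm (_ : 0 < pi / 8)) ?divr_gt0//.
    by rewrite ?divr_gt0// ?mulr_gt0// ?divr_gt0.
  rewrite ler_pdivrMr// (le_trans (uL y Jy))//.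
  move: sl; rewrite normrM (gtr0_norm (_ : 0 < pi / 8)) ?divr_gt0// => sl.
  rewrite (_ : L * `|y| = 64 * L / pi * (pi / 8 * `|y| / 8)); last first.
    by have := lt0r_neq0 p0; move: (pi : R) `|y| => q t q0; field.
  by rewrite ler_wpM2l// divr_ge0 ?mulr_ge0// ltW.
have := bessel_cvg0 mG GL => cG.
(* No aliasing: [t] in ]1/2, 2[ and [z] in [-1/2, 3] give [|t - z| < 5/2], so a single period sees
   all of [u]. *)
have ucJ (h : R -> R) : measurable_fun (setT : set (measurableTypeR R)) h ->
    \int[mu]_t (h (t - z) * u t) = \int[mu]_(y in J) (h y * u (z + y)).
  move=> mh.
  have tr : \int[mu]_t (h (t - z) * u t) = \int[mu]_y (h y * u (z + y)).
    rewrite /Rintegral.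
    have mhu : measurable_fun (setT : set (measurableTypeR R)) (fun t => (h (t - z) * u t)%:E).
      apply/measurable_EFinP; apply: measurable_funM; last exact: continuous_measurable_fun.
      by apply: (measurableT_comp mh); exact: measurable_funB.
    rewrite integralE [in RHS]integralE.
    have aff (F : R -> \bar R) : measurable_fun (setT : set (measurableTypeR R)) F ->
       (forall t, 0 <= F t)%E -> (\int[mu]_t F t = \int[mu]_t F (t + z)%R)%E.
      move=> mF F0; rewrite -(ge0_integral_affine1 z (@ltr01 R) mF F0) mul1e.
      by under eq_integral do rewrite mul1r.
    rewrite (aff _ (measurable_funepos mhu) (fun t => funepos_ge0 _ t)).
    rewrite (aff _ (measurable_funeneg mhu) (fun t => funeneg_ge0 _ t)).
    by congr (fine (_ - _)); apply: eq_integral => t _;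
      rewrite ?funeposE ?funenegE addrK [t + z]addrC.
  rewrite tr [RHS]Rintegral_mkcond; apply: eq_Rintegral => y _.
  rewrite patchE; case: ifPn => // yJ; rewrite u0 ?mulr0//.
  apply/negP => /andP[h1 h2]; move/negP: yJ; apply; rewrite inE/= in_itv/=.
  by apply/andP; split; lra.
have uB : exists B : R, forall y, J y -> `|u (z + y)| <= B.
  exists (L * 4 + `|u z|) => y Jy; rewrite -[u (z + y)](subrK (u z)).
  rewrite (le_trans (ler_normD _ _))// lerD// (le_trans (uL y Jy))// ler_wpM2l//.
  by move: Jy; rewrite /= in_itv/= -ler_norml.
have [B uBB] := uB.
have icu (c : R) : mu.-integrable J (EFin \o (fun y => cos (c * y) * u (z + y))).
  apply: (@integrable_J _ B); first by apply: measurable_funM => //; exact: measurable_cosM.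
  by move=> y Jy; rewrite normrM (le_trans _ (uBB y Jy))// ler_piMl// cos_max.
have ic (c : R) : mu.-integrable J (EFin \o (fun y => cos (c * y))).
  by apply: (@integrable_J _ 1); [exact: measurable_cosM|move=> y _; exact: cos_max].
have E M : 8^-1 * (\int[mu]_t u t + \sum_(1 <= n < M.+1)
     2 * \int[mu]_t (cos (n%:R * pi / 4 * (t - z)) * u t)) =
   u z + 8^-1 * \int[mu]_(y in J) (G y * sodd M y).
  have D1 : \int[mu]_t u t + \sum_(1 <= n < M.+1)
     2 * \int[mu]_t (cos (n%:R * pi / 4 * (t - z)) * u t) =
     \int[mu]_(y in J) (u (z + y)) + \sum_(1 <= n < M.+1)
       2 * \int[mu]_(y in J) (cos (n%:R * pi / 4 * y) * u (z + y)).
    congr (_ + _).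
      have := ucJ (cst 1) (@measurable_cst _ _ _ _ _ _).
      by under eq_Rintegral do rewrite mul1r; under [in RHS]eq_Rintegral do rewrite mul1r.
    by apply: eq_bigr => n _; rewrite (ucJ (fun y => cos (n%:R * pi / 4 * y)))//; exact: measurable_cosM.
  rewrite D1.
  have iu : mu.-integrable J (EFin \o (fun y => u (z + y))) by exact: integrable_J uBB.
  have i1 : mu.-integrable J (EFin \o (fun y => u z * 1)).
    by apply: (@integrable_J _ `|u z|) => // y _; rewrite mulr1.
  have I8 : \int[mu]_(y in J) (u z * 1) = 8 * u z.
    rewrite RintegralZl//; last by apply: (@integrable_J _ 1) => // y _; rewrite normr1.
    have := integral_cos_J 0; under eq_Rintegral do rewrite !mul0r cos0.
    by move=> ->; rewrite mulrC.
  (* The kernel [1 + sum 2 cos] has integral 8 over [J], so subtracting [u z] from [u] subtracts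
     [8 * u z] from the pairing. Integrability is carried along in the induction. *)
  have KE : forall M, \int[mu]_(y in J) ((u (z + y) - u z) *
      (1 + \sum_(1 <= n < M.+1) 2 * cos (n%:R * pi / 4 * y))) =
      \int[mu]_(y in J) (u (z + y)) + \sum_(1 <= n < M.+1)
       2 * \int[mu]_(y in J) (cos (n%:R * pi / 4 * y) * u (z + y)) - 8 * u z /\
      mu.-integrable J (EFin \o (fun y => (u (z + y) - u z) *
        (1 + \sum_(1 <= n < M.+1) 2 * cos (n%:R * pi / 4 * y)))).
    elim=> [|K [IH1 IH2]].
      rewrite big_geq// addr0; split.
        under eq_Rintegral do rewrite big_geq// addr0 mulr1 -[u z]mulr1.
        by rewrite RintegralB// I8.
      have := integrableB mJ iu i1; apply: eq_integrable => // y _.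
      by rewrite /= big_geq// addr0 !mulr1.
    have ia := integrableZl mJ 2 (icu (K.+1%:R * pi / 4)).
    have ib := integrableZl mJ (2 * u z) (ic (K.+1%:R * pi / 4)).
    have iab := integrableB mJ ia ib.
    have EE y : (u (z + y) - u z) * (1 + \sum_(1 <= n < K.+2) 2 * cos (n%:R * pi / 4 * y)) =
       (u (z + y) - u z) * (1 + \sum_(1 <= n < K.+1) 2 * cos (n%:R * pi / 4 * y)) +
       (2 * (cos (K.+1%:R * pi / 4 * y) * u (z + y)) - 2 * u z * cos (K.+1%:R * pi / 4 * y)).
      by rewrite [in LHS]big_nat_recr//=; ring.
    split.
      under eq_Rintegral do rewrite EE.
      rewrite RintegralD// RintegralB// !RintegralZl// integral_cos_J/= mulr0 subr0.
      by rewrite IH1 [in RHS]big_nat_recr//=; ring.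
    have := integrableD mJ IH2 iab; apply: eq_integrable => // y _ /=.
    by rewrite -!EFinM -EFinB -EFinD EE.
  have [KE1 _] := KE M.
  have -> : \int[mu]_(y in J) (G y * sodd M y) = \int[mu]_(y in J) ((u (z + y) - u z) *
      (1 + \sum_(1 <= n < M.+1) 2 * cos (n%:R * pi / 4 * y))).
    apply: eq_Rintegral => y; rewrite inE => Jy.
    have [->|y0] := eqVneq y 0; first by rewrite /G addr0 subrr !mul0r.
    rewrite -dirichlet_kernel /G [_ * sin _]mulrC mulrA divfK//.
    rewrite -normr_gt0; apply: lt_le_trans (sin_lb (arg y Jy)).
    by rewrite divr_gt0// normr_gt0 mulf_neq0// lt0r_neq0// divr_gt0.
  by rewrite KE1; field.
rewrite (_ : (fun M => _) = fun M => u z + 8^-1 * \int[mu]_(y in J) (G y * sodd M y)); last first.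
  by apply/funext => M; exact: E.
rewrite -[X in _ --> X]addr0 -[X in _ --> _ + X](mulr0 (8^-1 : R)).
by apply: cvgD; [exact: cvg_cst|apply: cvgM; [exact: cvg_cst|exact: cG]].
Qed.

End FourierSeriesPoint.

Section FourierSeries.
Variable R : realType.
Local Notation mu := (@lebesgue_measure R).

Lemma normc_le_ReIm (z : R[i]) : normc z <= `|Re z| + `|Im z|.
Proof.
case: z => a b /=; rewrite -(@ler_pXn2r _ 2)// ?nnegrE ?sqrtr_ge0 ?addr_ge0//.
rewrite sqr_sqrtr ?addr_ge0 ?sqr_ge0// sqrrD !real_normK ?num_real//.
by rewrite -addrA lerD2l lerDr mulrn_wge0// mulr_ge0.
Qed.

Lemma Re_le_normc (z : R[i]) : `|Re z| <= normc z.
Proof. by case: z => a b /=; rewrite -sqrtr_sqr ler_wsqrtr// lerDl sqr_ge0. Qed.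

Lemma Im_le_normc (z : R[i]) : `|Im z| <= normc z.
Proof. by case: z => a b /=; rewrite -sqrtr_sqr ler_wsqrtr// lerDr sqr_ge0. Qed.

(** Reads the Fourier coefficients as values of [costr] in dimension one at the points [k / 8];
    their rapid decay then follows from [costr_schwartz]. *)
Lemma costr_rV1 (u : R -> R) (th : R) (k : nat) : schwartzR (fun v : 'rV[R]_1 => u (v ord0 ord0)) ->
  costr th (fun v : 'rV[R]_1 => u (v ord0 ord0)) (const_mx (k%:R / 8)) =
  \int[mu]_t (cos (k%:R * pi / 4 * t + th) * u t).
Proof.
move=> su; have ic := integrable_cosM th (const_mx (k%:R / 8)) su.
have iv (t : R) : (leb R 0).-integrable setT (fun v => (cos (2 * pi *
    dot (consrV (t, v)) (const_mx (k%:R / 8)) + th) * u (consrV (t, v) ord0 ord0))%:E).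
  apply: (@eq_integrable _ _ _ (leb R 0) setT measurableT
    (cst (cos (2 * pi * dot (consrV (t, 0)) (const_mx (k%:R / 8)) + th) *
          u (consrV (t, 0 : 'rV[R]_0) ord0 ord0))%:E)).
    by move=> v _ /=; rewrite (_ : v = 0)//; apply/rowP => -[].
  apply/integrableP; split; first exact: measurable_cst.
  by rewrite integral_cst//= diracT mule1 ltry.
rewrite /costr Rintegral_lebS//.
apply: eq_Rintegral => t _.
rewrite /Rintegral /= integral_dirac//; last exact: measurable_int (iv t).
rewrite diracT mul1e /= consrV0 /dot big_ord1 consrV0 mxE.
by congr (cos _ * _); field.
Qed.

Lemma smooth_schwartz_rV1 (u : R -> R) (L : R) : smoothR u ->
  (forall t, L < `|t| -> u t = 0) -> schwartzR (fun v : 'rV[R]_1 => u (v ord0 ord0)).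
Proof.
move=> su u0; apply: (@smooth_compact_schwartz _ _ L).
- by apply: smoothV_comp => //; exact: smoothV_coord.
- by move=> x j; rewrite (ord1 j) => /u0.
Qed.

Lemma real_fourier_coef_decay (u : R -> R) (th : R) (N : nat) : smoothR u ->
  (forall t, ~~ (1/2 < t < 2) -> u t = 0) ->
  exists2 C : R, 0 <= C & forall k : nat,
    `|\int[mu]_t (cos (k%:R * pi / 4 * t + th) * u t)| * (k.*2.+3)%:R ^+ N <= C.
Proof.
move=> su u0.
have sw : schwartzR (fun v : 'rV[R]_1 => u (v ord0 ord0)).
  apply: (@smooth_schwartz_rV1 _ 2) => // t t2; apply: u0; apply/negP => /andP[h1 h2].
  by move: t2; rewrite gtr0_norm; lra.
have [C C0 HC] := schwartzR_wt N (costr_schwartz th sw).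
(* [2 k + 3 <= 24 (1 + (k / 8)^2)]. The weight [2 k + 3] bounds [m + 2] for both indices [m] with
   [m./2 = k]. *)
exists (C * 24 ^+ N); first by rewrite mulr_ge0// exprn_ge0.
move=> k; rewrite -costr_rV1//.
have w0 := wt_gt0 (const_mx (k%:R / 8) : 'rV[R]_1).
apply: (@le_trans _ _ (C * wt (const_mx (k%:R / 8) : 'rV[R]_1) ^+ N * (k.*2.+3)%:R ^+ N)).
  by rewrite ler_wpM2r ?exprn_ge0.
rewrite -mulrA -exprMn ler_wpM2l// lerXn2r ?nnegrE ?mulr_ge0 ?(ltW w0)//.
rewrite /wt big_ord1 mxE mulrC ler_pdivrMr ?ltr_wpDr ?sqr_ge0//.
rewrite -addn3 natrD -muln2 natrM; move: (k%:R : R) => x; have := sqr_ge0 (x - 3); nra.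
Qed.

(* Indices [2 l] and [2 l + 1] carry the frequencies [l pi / 4] and [- l pi / 4];
   the frequency 0 occurs twice, each time with half of its coefficient. *)
Definition fourier_freq (k : nat) : R := (-1) ^+ k * (k./2%:R * pi / 4).

(** Up to the halving at frequency 0, this is [1/8] times the integral of
    [psi t * expi (- fourier_freq k * t)], in real and imaginary parts. *)
Definition fourier_coef (psi : R -> R[i]) (k : nat) : R[i] :=
  let c (f : R -> R) th := \int[mu]_t (cos (k./2%:R * pi / 4 * t + th) * f t) in
  let w := (if k./2 == 0%N then 2^-1 else 1) / 8 in
  let s := (-1) ^+ k in
  Complex (w * (c (Re \o psi) 0 + s * c (Im \o psi) (- (pi / 2))))
          (w * (c (Im \o psi) 0 - s * c (Re \o psi) (- (pi / 2)))).

Lemma ReD (z w : R[i]) : Re (z + w) = Re z + Re w. Proof. by case: z; case: w. Qed.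
Lemma ImD (z w : R[i]) : Im (z + w) = Im z + Im w. Proof. by case: z; case: w. Qed.

Lemma sum_ReE (I : Type) (r : seq I) (F : I -> R[i]) :
  Re (\sum_(i <- r) F i) = \sum_(i <- r) Re (F i).
Proof. by elim: r => [|i r IH]; rewrite ?big_nil// !big_cons ReD IH. Qed.

Lemma sum_ImE (I : Type) (r : seq I) (F : I -> R[i]) :
  Im (\sum_(i <- r) F i) = \sum_(i <- r) Im (F i).
Proof. by elim: r => [|i r IH]; rewrite ?big_nil// !big_cons ImD IH. Qed.

Lemma test_function_eq0 (psi : R -> R[i]) t : test_function `]1/2, 2[ psi ->
  ~~ (1/2 < t < 2) -> psi t = 0.
Proof.
move=> [_ _ sub] t2; apply/eqP/negPn/negP => pt; move/negP: t2; apply.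
have /sub /= : csupport psi t by exact: subset_closure.
by rewrite in_itv.
Qed.

Lemma test_function_real (psi : R -> R[i]) : test_function `]1/2, 2[ psi ->
  (smoothR (Re \o psi) /\ forall t, ~~ (1/2 < t < 2) -> (Re \o psi) t = 0) /\
  (smoothR (Im \o psi) /\ forall t, ~~ (1/2 < t < 2) -> (Im \o psi) t = 0).
Proof.
move=> tp; have [[sr si] _ _] := tp.
by split; split => // t /(test_function_eq0 tp) /= ->.
Qed.

Lemma fourier_freq_le k : `|fourier_freq k| <= k%:R.
Proof.
rewrite /fourier_freq normrM normrX normrN1 expr1n mul1r.
rewrite ger0_norm; last by rewrite divr_ge0// mulr_ge0// pi_ge0.
have /andP[_ p2] := @pihalf_02 R.
apply: (@le_trans _ _ (k./2%:R)); last by rewrite ler_nat -[leqRHS]odd_double_half -addnn addnA leq_addl.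
have : (0 : R) <= k./2%:R by []; move: (k./2%:R : R) => x x0; nra.
Qed.

(** Decay is taken at order [N.+2]: the two spare powers give a denominator whose sums telescope. *)
Lemma fourier_coef_decay (psi : R -> R[i]) (N : nat) : test_function `]1/2, 2[ psi ->
  exists2 C : R, 0 <= C & forall k,
    normc (fourier_coef psi k) * (1 + `|fourier_freq k|) ^+ N <= C / (k.+1%:R * k.+2%:R).
Proof.
move=> /test_function_real[[sr r0] [si i0]].
have [C1 C10 H1] := real_fourier_coef_decay 0 N.+2 sr r0.
have [C2 C20 H2] := real_fourier_coef_decay (- (pi / 2)) N.+2 si i0.
have [C3 C30 H3] := real_fourier_coef_decay 0 N.+2 si i0.
have [C4 C40 H4] := real_fourier_coef_decay (- (pi / 2)) N.+2 sr r0.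
exists (C1 + C2 + (C3 + C4)); first by rewrite !addr_ge0.
move=> k; rewrite ler_pdivlMr ?mulr_gt0 ?ltr0n//.
pose X : R := (k./2.*2.+3)%:R.
have kX : (k.+2%:R : R) <= X.
  by rewrite ler_nat -[in leqLHS](odd_double_half k); case: odd => /=; rewrite !(add1n, add0n).
have X0 : 0 < X by rewrite ltr0n.
have fX : 1 + `|fourier_freq k| <= X.
  by apply: le_trans kX; rewrite mulrSr mulrSr addrC -addrA lerD ?fourier_freq_le// lerDl.
have wl : 0 <= (if k./2 == 0%N then 2^-1 else 1 : R) / 8 <= 1.
  by apply/andP; split; case: ifP => _; lra.
have /andP[w0 w1] := wl.
apply: (@le_trans _ _ (normc (fourier_coef psi k) * X ^+ N.+2)).
  rewrite -mulrA ler_wpM2l//; first by case: (fourier_coef psi k) => ? ? /=; exact: sqrtr_ge0.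
  rewrite exprSr exprSr -mulrA; apply: ler_pM; rewrite ?exprn_ge0 ?addr_ge0 ?mulr_ge0//.
    by rewrite lerXn2r ?nnegrE ?addr_ge0// ltW.
  by rewrite ler_pM// (le_trans _ kX)// ler_nat.
apply: (@le_trans _ _ ((`|Re (fourier_coef psi k)| + `|Im (fourier_coef psi k)|) * X ^+ N.+2)).
  by rewrite ler_wpM2r ?normc_le_ReIm// exprn_ge0// ltW.
have Xn : 0 <= X ^+ N.+2 by rewrite exprn_ge0// ltW.
have aux (a b D1 D2 : R) : `|a| * X ^+ N.+2 <= D1 -> `|b| * X ^+ N.+2 <= D2 ->
    `|(if k./2 == 0%N then 2^-1 else 1) / 8 * (a + (-1) ^+ k * b)| * X ^+ N.+2 <= D1 + D2.
  move=> Da Db; rewrite normrM (ger0_norm w0).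
  apply: (@le_trans _ _ ((`|a| + `|b|) * X ^+ N.+2)); last by rewrite mulrDl lerD.
  rewrite ler_wpM2r//; apply: (@le_trans _ _ `|a + (-1) ^+ k * b|).
    by rewrite ler_piMl.
  by rewrite (le_trans (ler_normD _ _))// normrM normrX normrN1 expr1n mul1r.
rewrite mulrDl lerD//=; first exact: aux.
by rewrite -mulrN; apply: aux; rewrite ?normrN.
Qed.

(** Opposite frequencies recombine into a real cosine mode acting separately on [Re psi] and
    [Im psi], the form in which [fourier_series_cvg] applies. *)
Lemma fourier_pair (psi : R -> R[i]) (z : R) (n : nat) : test_function `]1/2, 2[ psi ->
  let A f := (if n == 0%N then 1 else 2) / 8 *
    \int[mu]_t (cos (n%:R * pi / 4 * (t - z)) * f t) in
  fourier_coef psi n.*2 * expi (fourier_freq n.*2 * z) +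
  fourier_coef psi n.*2.+1 * expi (fourier_freq n.*2.+1 * z) =
  Complex (A (Re \o psi)) (A (Im \o psi)).
Proof.
move=> /test_function_real[[sr r0] [si i0]] A.
pose c (f : R -> R) th := \int[mu]_t (cos (n%:R * pi / 4 * t + th) * f t).
have AE f : smoothR f -> (forall t, ~~ (1/2 < t < 2) -> f t = 0) ->
    \int[mu]_t (cos (n%:R * pi / 4 * (t - z)) * f t) =
    cos (n%:R * pi / 4 * z) * c f 0 + sin (n%:R * pi / 4 * z) * c f (- (pi / 2)).
  move=> sf f0.
  have ic th : mu.-integrable setT (EFin \o (fun t => cos (n%:R * pi / 4 * t + th) * f t)).
    have cf : continuous f.
      by move=> t; apply: differentiable_continuous; apply/derivable1_diffP; exact: (sf 0%N).
    have [] : bounded_set (f @` `[- 2, 2]%classic).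
      apply/compact_bounded/continuous_compact; last exact: segment_compact.
      exact: continuous_subspaceT.
    move=> M0 [_ HM].
    have fb t : `|f t| <= (5 * `|M0 + 1|) * (1 + t ^+ 2)^-1.
      have [/andP[t1 t2]|t12] := boolP (1/2 < t < 2); last first.
        by rewrite f0// normr0 mulr_ge0 ?mulr_ge0// invr_ge0 addr_ge0 ?sqr_ge0.
      rewrite ler_pdivlMr; last by rewrite ltr_wpDr ?sqr_ge0.
      rewrite mulrC ler_pM// ?addr_ge0 ?sqr_ge0//; first by nra.
      apply: le_trans (ler_norm _); apply: (HM (M0 + 1)); first by rewrite ltrDl.
      by exists t => //=; rewrite in_itv/=; apply/andP; split; lra.
    apply: integrable_le (integrable_inv1Dsqr (5 * `|M0 + 1|)).
      apply: measurable_funM; last exact: continuous_measurable_fun.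
      apply: (measurableT_comp (continuous_measurable_fun (@continuous_cos R))).
      by apply: measurable_funD => //; exact: measurable_funM.
    by move=> t; rewrite normrM (le_trans _ (fb t))// ler_piMl// cos_max.
  rewrite /c -!RintegralZl// -RintegralD//; last 2 first.
  - exact: (integrableZl measurableT _ (ic 0)).
  - exact: (integrableZl measurableT _ (ic (- (pi / 2)))).
  apply: eq_Rintegral => t _; rewrite addr0 cosBpihalf !mulrA -mulrDl; congr (_ * _).
  by rewrite mulrBr cosB; ring.
have cE k f th : k./2 = n ->
    \int[mu]_t (cos (k./2%:R * pi / 4 * t + th) * f t) = c f th by move=> ->.
have h1 : (n.*2)./2 = n by rewrite doubleK.
have h2 : (n.*2.+1)./2 = n by exact: uphalf_double.
rewrite /fourier_coef /fourier_freq !cE// h1 h2 exprS -muln2 exprM sqrr_sign.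
rewrite /A !AE//; apply: complex_ext; rewrite ?ReD ?ImD ?complex_ReM ?complex_ImM /=;
  rewrite ?mul1r ?mulr1 ?mulN1r ?mulNr ?cosN ?sinN; by case: (n == 0%N); field.
Qed.

(** Pointwise convergence identifies the limit; the rate, uniform in [z], comes from the telescoping
    tail of the coefficients. The factor 2 pays for real and imaginary parts. *)
Theorem fourier_series (psi : R -> R[i]) : test_function `]1/2, 2[ psi ->
  exists2 C : R, 0 <= C & forall z M, - (1/2) <= z <= 3 ->
    normc (psi z - \sum_(k < M.+1.*2) fourier_coef psi k * expi (fourier_freq k * z)) <=
    C / M.+1%:R.
Proof.
move=> tp; have [C C0 HC] := fourier_coef_decay 0 tp.
have {}HC k : normc (fourier_coef psi k) <= C / (k.+1%:R * k.+2%:R).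
  by have := HC k; rewrite expr0 mulr1.
have [[sr r0] [si i0]] := test_function_real tp.
exists (2 * C); first by rewrite mulr_ge0.
move=> z M z12.
pose T k := fourier_coef psi k * expi (fourier_freq k * z).
have SE K : \sum_(k < K.*2) T k = \sum_(0 <= n < K) (T n.*2 + T n.*2.+1).
  elim: K => [|K IH]; first by rewrite big_ord0 big_geq.
  by rewrite doubleS !big_ord_recr/= IH big_nat_recr//= addrA.
pose A (n : nat) (f : R -> R) := (if n == 0%N then 1 else 2) / 8 *
    \int[mu]_t (cos (n%:R * pi / 4 * (t - z)) * f t).
have AS f K : \sum_(0 <= n < K.+1) A n f = 8^-1 * (\int[mu]_t f t + \sum_(1 <= n < K.+1)
     2 * \int[mu]_t (cos (n%:R * pi / 4 * (t - z)) * f t)).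
  rewrite big_ltn// [RHS]mulrDr; congr (_ + _).
    rewrite /A eqxx mul1r; congr (_ * _); apply: eq_Rintegral => t _.
    by rewrite !mul0r cos0 mul1r.
  rewrite mulr_sumr; apply: eq_big_nat => n /andP[n1 _].
  by rewrite /A gtn_eqF//; ring.
have ReS K : Re (\sum_(k < K.+1.*2) T k) = 8^-1 * (\int[mu]_t (Re \o psi) t + \sum_(1 <= n < K.+1)
     2 * \int[mu]_t (cos (n%:R * pi / 4 * (t - z)) * (Re \o psi) t)).
  by rewrite SE sum_ReE -AS; apply: eq_bigr => n _; rewrite fourier_pair.
have ImS K : Im (\sum_(k < K.+1.*2) T k) = 8^-1 * (\int[mu]_t (Im \o psi) t + \sum_(1 <= n < K.+1)
     2 * \int[mu]_t (cos (n%:R * pi / 4 * (t - z)) * (Im \o psi) t)).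
  by rewrite SE sum_ImE -AS; apply: eq_bigr => n _; rewrite fourier_pair.
have cR := fourier_series_cvg sr r0 z12.
have cI := fourier_series_cvg si i0 z12.
have E1 := funext ReS; have E2 := funext ImS.
rewrite -E1 in cR; rewrite -E2 in cI.
have nT k : normc (T k) <= C / (k.+1%:R * k.+2%:R).
  suff -> : normc (T k) = normc (fourier_coef psi k) by [].
  rewrite /T; case: (fourier_coef psi k) => a b; rewrite /expi /=; congr Num.sqrt.
  have := cos2Dsin2 (fourier_freq k * z); move: (cos _) (sin _) => c s E.
  by rewrite -[RHS]mulr1 -E; ring.
have tail (K L : nat) : (K <= L)%N ->
    \sum_(K <= k < L) (C / (k.+1%:R * k.+2%:R)) <= C / K.+1%:R.
  move=> KL; suff -> : \sum_(K <= k < L) (C / (k.+1%:R * k.+2%:R)) = C / K.+1%:R - C / L.+1%:R.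
    by rewrite gerBl divr_ge0.
  elim: L KL => [|L IH]; first by rewrite leqn0 => /eqP ->; rewrite big_geq// subrr.
  rewrite leq_eqVlt => /predU1P[->|]; first by rewrite big_geq// subrr.
  rewrite ltnS => KL; rewrite big_nat_recr//= IH//.
  have e1 : (L.+1%:R : R) != 0 by rewrite pnatr_eq0.
  have e2 : (L.+2%:R : R) = L.+1%:R + 1 by rewrite mulrSr.
  have e3 : (L.+1%:R + 1 : R) != 0 by rewrite -e2 pnatr_eq0.
  have e0 : (K.+1%:R : R) != 0 by rewrite pnatr_eq0.
  rewrite e2; move: e0 e1 e3; move: (K.+1%:R : R) (L.+1%:R : R) => l0 l e0 e1 e3.
  by field; rewrite ?e0 ?e1 ?e3.
have bnd (P : R[i] -> R) : (forall z w, P (z + w) = P z + P w) ->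
    (forall w, `|P w| <= normc w) ->
    (forall K, (K >= M)%N -> `|P (\sum_(k < K.+1.*2) T k) - P (\sum_(k < M.+1.*2) T k)| <= C / M.+1%:R).
  move=> PD Pn K MK.
  have P0 : P 0 = 0 by apply: (addrI (P 0)); rewrite -PD !addr0.
  have Psum (r : seq nat) : `|P (\sum_(k <- r) T k)| <= \sum_(k <- r) C / (k.+1%:R * k.+2%:R).
    elim: r => [|k r IH]; first by rewrite !big_nil P0 normr0.
    rewrite !big_cons PD (le_trans (ler_normD _ _))// lerD// (le_trans (Pn _))//.
  rewrite -!(big_mkord xpredT) (@big_cat_nat _ _ _ M.+1.*2)//=; last by rewrite leq_double.
  rewrite PD addrAC subrr add0r (le_trans (Psum _))//.
  apply: (le_trans (tail _ _ _)); first by rewrite leq_double.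
  by rewrite ler_wpM2l// lef_pV2 ?posrE// ler_nat -addnn; lia.
apply: (le_trans (normc_le_ReIm _)); rewrite -/T (_ : 2 * C / M.+1%:R = C / M.+1%:R + C / M.+1%:R); last by ring.
have subE (P : R[i] -> R) (w1 w2 : R[i]) : (forall z w, P (z + w) = P z + P w) -> P (w1 - w2) = P w1 - P w2.
  by move=> PD; apply: (addIr (P w2)); rewrite -PD !subrK.
rewrite !subE//; [|exact: ImD|exact: ReD].
apply: lerD.
- have c : (fun K => `|Re (\sum_(k < K.+1.*2) T k) - Re (\sum_(k < M.+1.*2) T k)|) @ \oo -->
      `|(Re \o psi) z - Re (\sum_(k < M.+1.*2) T k)|.
    by apply: cvg_norm; apply: cvgB => //; exact: cvg_cst.
  apply: (cvgr_to_le c); exists M => // K MK; apply: bnd => //; [exact: ReD|exact: Re_le_normc].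
- have c : (fun K => `|Im (\sum_(k < K.+1.*2) T k) - Im (\sum_(k < M.+1.*2) T k)|) @ \oo -->
      `|(Im \o psi) z - Im (\sum_(k < M.+1.*2) T k)|.
    by apply: cvg_norm; apply: cvgB => //; exact: cvg_cst.
  apply: (cvgr_to_le c); exists M => // K MK; apply: bnd => //; [exact: ImD|exact: Im_le_normc].
Qed.

End FourierSeries.

(** * The partition of unity *)

Section SmoothReal.
Variable R : realType.
Implicit Types (f g u : R -> R).

Lemma smoothR_class (P : (R -> R) -> Prop) :
  (forall f, P f -> forall t, derivable f t 1) ->
  (forall f, P f -> P f^`()%classic) -> forall f, P f -> smoothR f.
Proof.
move=> Pd PD f Pf k t; apply: Pd; elim: k => [//|k IH].
by rewrite derive1nS; exact: PD.
Qed.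

Inductive smoothR_gen : (R -> R) -> Prop :=
| sr_base f of smoothR f : smoothR_gen f
| sr_add f g of smoothR_gen f & smoothR_gen g : smoothR_gen (fun x => f x + g x)
| sr_mul f g of smoothR_gen f & smoothR_gen g : smoothR_gen (fun x => f x * g x)
| sr_comp f g of smoothR f & smoothR_gen g : smoothR_gen (fun x => f (g x)).

Lemma smoothR_gen_derivable f (t : R) : smoothR_gen f -> derivable f t 1.
Proof.
elim=> {f} [f sf|f g _ Hf _ Hg|f g _ Hf _ Hg|f g sf _ Hg].
- exact: (sf 0%N).
- exact: derivableD.
- exact: derivableM.
- apply/derivable1_diffP; apply: (@differentiable_comp _ _ _ _ g f).
    exact/derivable1_diffP.
  by apply/derivable1_diffP; exact: (sf 0%N).
Qed.

Lemma smoothR_gen_derive f : smoothR_gen f -> smoothR_gen f^`()%classic.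
Proof.
elim=> {f} [f sf|f g sf Hf sg Hg|f g sf Hf sg Hg|f g sf sg Hg].
- by apply: sr_base; exact: smoothR_derive.
- rewrite (_ : _^`()%classic = fun x => f^`()%classic x + g^`()%classic x); first exact: sr_add.
  apply/funext => t; rewrite !derive1E (_ : (fun x => _) = f + g)// deriveD//;
    exact: smoothR_gen_derivable.
- rewrite (_ : _^`()%classic = fun x => f x * g^`()%classic x + g x * f^`()%classic x).
    by apply: sr_add; exact: sr_mul.
  apply/funext => t; rewrite !derive1E (_ : (fun x => _) = f * g)// deriveM//;
    exact: smoothR_gen_derivable.
- rewrite (_ : _^`()%classic = fun x => f^`()%classic (g x) * g^`()%classic x).
    by apply: sr_mul => //; apply: sr_comp => //; exact: smoothR_derive.
  apply/funext => t; rewrite (_ : (fun x => _) = f \o g)// derive1_comp//.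
    exact: smoothR_gen_derivable.
  exact: (sf 0%N).
Qed.

Lemma smoothR_genP f : smoothR_gen f -> smoothR f.
Proof.
apply: smoothR_class; [by move=> *; exact: smoothR_gen_derivable|].
by move=> *; exact: smoothR_gen_derive.
Qed.

Lemma smoothR_cst (c : R) : smoothR (cst c).
Proof.
apply: (@smoothR_class (fun f => exists c, f = cst c)); last by exists c.
- by move=> _ [k ->] t; exact: derivable_cst.
- by move=> _ [k ->]; exists 0; apply/funext => t; rewrite derive1_cst.
Qed.

Lemma smoothRM f g : smoothR f -> smoothR g -> smoothR (fun x => f x * g x).
Proof. by move=> sf sg; apply: smoothR_genP; apply: sr_mul; exact: sr_base. Qed.

Lemma smoothR_comp f g : smoothR f -> smoothR g -> smoothR (fun x => f (g x)).
Proof. by move=> sf sg; apply: smoothR_genP; apply: sr_comp => //; exact: sr_base. Qed.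

Lemma smoothR_affine (a b : R) : smoothR (fun x => a * x + b).
Proof.
move=> [|k] t; first by apply: derivableD => //; exact: derivableM.
rewrite derive1Sn (_ : _^`()%classic = cst a); first exact: smoothR_cst.
apply/funext => x; rewrite derive1E; have H : is_derive x 1 (fun x => a * x + b) a.
  by apply: is_derive_eq; rewrite /GRing.scale/= !(mulr1, mulr0, addr0, add0r).
by case: H.
Qed.

Lemma smoothR_expR : smoothR (@expR R).
Proof.
apply: (@smoothR_class (fun f => f = expR)) => //.
- by move=> _ -> t; exact: derivable_expR.
- by move=> _ ->; apply/funext => t; rewrite derive1E; case: (is_derive_expR t).
Qed.

Lemma smoothR_cos : smoothR (@cos R).
Proof.
apply: (@smoothR_class (fun f => exists (a b : R), f = fun t => a * cos t + b * sin t)).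
- by move=> _ [a [b ->]] t; apply: derivableD; apply: derivableM => //.
- move=> _ [a [b ->]]; exists b, (- a); apply/funext => t; rewrite derive1E.
  have H : is_derive t 1 (fun t => a * cos t + b * sin t) (b * cos t + - a * sin t).
    by apply: is_derive_eq; rewrite /GRing.scale/=; ring.
  by case: H.
- by exists 1, 0; apply/funext => t; rewrite mul1r mul0r addr0.
Qed.

Lemma smoothR_continuous f : smoothR f -> continuous f.
Proof.
by move=> sf t; apply: differentiable_continuous; apply/derivable1_diffP; exact: (sf 0%N).
Qed.

Lemma derive1nD k f g : smoothR f -> smoothR g ->
  (fun x => f x + g x)^`(k)%classic = fun x => f^`(k)%classic x + g^`(k)%classic x.
Proof.
move=> sf sg; elim: k => [//|k IH]; rewrite !derive1nS IH.
by apply/funext => t; rewrite !derive1E (_ : (fun x => _) = f^`(k)%classic + g^`(k)%classic)// deriveD.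
Qed.

Lemma derive1nZ k (c : R) f : smoothR f ->
  (fun x => c * f x)^`(k)%classic = fun x => c * f^`(k)%classic x.
Proof.
move=> sf; elim: k => [//|k IH]; rewrite !derive1nS IH.
by apply/funext => t; rewrite !derive1E (_ : (fun x => _) = c *: f^`(k)%classic)// deriveZ.
Qed.

Definition bump u := smoothR u /\ forall t, 1 < `|t| -> u t = 0.

Lemma bump_derive u : bump u -> bump u^`()%classic.
Proof.
move=> [su u0]; split; first exact: smoothR_derive.
move=> t t1; rewrite derive1E (@near_eq_derive _ _ _ u (cst 0)) ?derive_cst//.
have : (fun y : R => `|y|) y @[y --> t] --> `|t| by exact: norm_continuous.
by move=> /cvgr_gt/(_ _ t1); apply: filterS => y; exact: u0.
Qed.

Lemma bump_bounded u : bump u -> exists2 C : R, 0 <= C & forall t, `|u t| <= C.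
Proof.
move=> [su u0].
have [] : bounded_set (u @` `[- 1, 1]%classic).
  apply/compact_bounded/continuous_compact; last exact: segment_compact.
  by apply: continuous_subspaceT; exact: smoothR_continuous.
move=> M [_ HM]; exists `|M + 1| => // t; have [t1|t1] := leP `|t| 1.
  apply: le_trans (ler_norm _); apply: (HM (M + 1)); first by rewrite ltrDl.
  by exists t => //=; rewrite in_itv/= -ler_norml.
by rewrite u0// normr0.
Qed.

(** The induction runs over all bumps and phases: one derivative yields the same expression with the
    bump [u'], plus [lam] times the same expression with the phase advanced by [pi / 2]. *)
Lemma bump_osc_bound (k : nat) u : bump u -> exists2 C : R, 0 <= C &
  forall lam th t : R, `|(fun s => u s * cos (lam * s + th))^`(k)%classic t| <= C * (1 + `|lam|) ^+ k.
Proof.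
elim: k u => [|k IH] u bu.
  have [C C0 HC] := bump_bounded bu; exists C => // lam th t.
  by rewrite /derive1n/= expr0 mulr1 normrM (le_trans _ (HC t))// ler_piMr// cos_max.
have [C1 C10 H1] := IH _ (bump_derive bu).
have [C2 C20 H2] := IH _ bu.
exists (C1 + C2); first exact: addr_ge0.
move=> lam th t; rewrite derive1Sn.
have sc th' v : smoothR v -> smoothR (fun s => v s * cos (lam * s + th')).
  move=> sv; apply: smoothRM => //.
  by apply: (smoothR_comp smoothR_cos); exact: smoothR_affine.
have -> : (fun s => u s * cos (lam * s + th))^`()%classic =
    fun s => u^`()%classic s * cos (lam * s + th) +
             lam * (u s * cos (lam * s + (th + pi / 2))).
  apply/funext => s; rewrite derive1E.
  have du : is_derive s 1 u (u^`()%classic s).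
    by rewrite derive1E; apply: DeriveDef => //; case: bu => su _; exact: (su 0%N).
  have H : is_derive s 1 (fun s => u s * cos (lam * s + th))
     (u^`()%classic s * cos (lam * s + th) + lam * (u s * cos (lam * s + (th + pi / 2)))).
    apply: is_derive_eq.
    by rewrite /GRing.scale/= addrA cosDpihalf !(mulr1, mulr0, addr0, add0r); ring.
  by case: H.
have [su _] := bu.
rewrite derive1nD; [|exact/sc/smoothR_derive|].
  2: by apply: smoothRM; [exact: smoothR_cst|exact: sc].
rewrite derive1nZ; last exact: sc.
rewrite (le_trans (ler_normD _ _))// normrM.
have l0 : 0 <= (1 + `|lam|) ^+ k by rewrite exprn_ge0// addr_ge0.
apply: (@le_trans _ _ (C1 * (1 + `|lam|) ^+ k + `|lam| * (C2 * (1 + `|lam|) ^+ k))).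
  by rewrite lerD// ler_wpM2l.
rewrite exprS; move: l0 (normr_ge0 lam); move: (`|lam|) => l; move: ((1 + l) ^+ k) => P P0 l0.
have : 0 <= C1 * P * l by rewrite !mulr_ge0.
have : 0 <= C2 * P by rewrite mulr_ge0.
by nra.
Qed.

End SmoothReal.

Section Partition.
Variables (R : realType) (alpha : R) (psi : R -> R[i]).
Hypotheses (tp : test_function `]1/2, 2[ psi) (dr : dyadic_resolution alpha psi).

(* [part s = 2^(- alpha s) Re (psi (2^s))]: the dyadic resolution at [t = 2^Y] says
   that the integer translates of [part] sum to 1 at [Y]. *)
Definition part (s : R) : R := expR (- alpha * ln 2 * s) * Re (psi (expR (ln 2 * s))).

Let ln20 : 0 < ln (2 : R). Proof. by rewrite ln_gt0// ltr1n. Qed.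

Lemma part_eq0 s : 1 <= `|s| -> part s = 0.
Proof.
move=> s1; rewrite /part (test_function_eq0 tp) ?mulr0//.
apply/negP => /andP[h1 h2].
have e2 : (2 : R) = expR (ln 2) by rewrite lnK// posrE.
have e2' : (1/2 : R) = expR (- ln 2) by rewrite expRN -e2 mul1r.
rewrite e2' ltr_expR in h1; rewrite [X in _ < X]e2 ltr_expR in h2.
have h1' : -1 < s by rewrite -(ltr_pM2l ln20) mulrN1.
have h2' : s < 1 by rewrite -(ltr_pM2l ln20) mulr1.
by move: s1; rewrite leNgt ltr_norml h1' h2'.
Qed.

Lemma bump_part : bump part.
Proof.
split; last by move=> t t1; rewrite part_eq0// ltW.
have [[sr _] _] := test_function_real tp.
apply: smoothRM.
  apply: (smoothR_comp (@smoothR_expR R)).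
  by have := @smoothR_affine R (- alpha * ln 2) 0; under eq_fun do rewrite addr0.
apply: (smoothR_comp sr); apply: (smoothR_comp (@smoothR_expR R)).
by have := @smoothR_affine R (ln 2) 0; under eq_fun do rewrite addr0.
Qed.

Lemma exprz2E (k : int) : (2 : R) ^ k = expR (ln 2 * k%:~R).
Proof.
have e2 : (2 : R) = expR (ln 2) by rewrite lnK// posrE.
have en (n : nat) : (2 : R) ^+ n = expR (ln 2 * n%:R).
  elim: n => [|n IH]; first by rewrite expr0 mulr0 expR0.
  by rewrite exprS IH -(natr1 n) mulrDr mulr1 expRD [X in X * _]e2 mulrC.
case: k => n; first exact: en.
by rewrite -[_ ^ Negz n]/((2 ^+ n.+1)^-1) NegzE mulrNz mulrN expRN en.
Qed.

(** The conditions on [Y] put every integer outside [0 .. K - 1] at distance at least 1, where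
    [part] vanishes, so the dyadic sum becomes finite. *)
Lemma part_partition (Y : R) (K : nat) : 0 <= Y -> Y + 1 <= K%:R ->
  \sum_(k < K) part (Y - k%:R) = 1.
Proof.
move=> Y0 YK.
pose t := expR (ln 2 * Y).
pose F (delta : R) : R[i] := ((delta `^ alpha)%:C)%C * psi (t / delta).
pose r := [seq (2 : R) ^ (k : int) | k <- [seq Posz k | k <- iota 0 K]].
have inj2 : injective (fun k : int => (2 : R) ^ k).
  move=> a b; rewrite !exprz2E => /expR_inj /(mulfI (lt0r_neq0 ln20)).
  by move=> /eqP; rewrite eqr_int => /eqP.
have ur : uniq r by rewrite map_inj_uniq// map_inj_uniq ?iota_uniq// => a b [].
have sub : [set` r] `<=` range (fun k : int => (2 : R) ^ k).
  by move=> x /= /mapP[k _ ->]; exists k.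
have H : \sum_(delta \in range (fun k : int => (2 : R) ^ k)) F delta = ((t `^ alpha)%:C)%C.
  by apply: dr; exact: expR_gt0.
have tE (k : int) : t / 2 ^ k = expR (ln 2 * (Y - k%:~R)).
  by rewrite exprz2E /t -expRN -expRD mulrBr.
rewrite -(fsbig_widen [set` r]) in H => //; last first.
  move=> x [[k _ <-] nr]; rewrite /= /F tE.
  suff : 1 <= `|Y - k%:~R|.
    move=> Yk; rewrite (test_function_eq0 tp) ?mulr0//.
    apply/negP => /andP[h1 h2].
    have e2 : (2 : R) = expR (ln 2) by rewrite lnK// posrE.
    have e2' : (1/2 : R) = expR (- ln 2) by rewrite expRN -e2 mul1r.
    rewrite e2' ltr_expR in h1; rewrite [X in _ < X]e2 ltr_expR in h2.
    have h1' : -1 < Y - k%:~R by rewrite -(ltr_pM2l ln20) mulrN1.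
    have h2' : Y - k%:~R < 1 by rewrite -(ltr_pM2l ln20) mulr1.
    by move: Yk; rewrite leNgt ltr_norml h1' h2'.
  case: k nr => k nr.
    have Kk : (K <= k)%N.
      rewrite leqNgt; apply/negP => kK; apply: nr => /=; apply: map_f.
      by apply: map_f; rewrite mem_iota add0n.
    have : (K%:R : R) <= k%:R by rewrite ler_nat.
    rewrite -[k%:R]/((Posz k)%:~R : R) => Kk'.
    by rewrite ler0_norm; lra.
  rewrite NegzE mulrNz opprK.
  have : (1 : R) <= (k.+1%:R : R) by rewrite ler1n.
  rewrite -[k.+1%:R]/((Posz k.+1)%:~R : R) => k1.
  by rewrite ger0_norm; lra.
rewrite -fsbig_seq// in H.
have {}H : \sum_(k < K) F (2 ^ (Posz k)) = ((t `^ alpha)%:C)%C.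
  by rewrite -H /r !big_map -[in RHS](subn0 K) -/(index_iota 0 K) big_mkord.
have := congr1 (fun z : R[i] => Re z) H; rewrite sum_ReE /= => HR.
have tpow : t `^ alpha = expR (alpha * ln 2 * Y).
  by rewrite /powR gt_eqF ?expR_gt0// /t expRK mulrA.
apply: (mulfI (lt0r_neq0 (expR_gt0 (alpha * ln 2 * Y)))).
rewrite mulr1 -[RHS]tpow -HR mulr_sumr; apply: eq_bigr => k _.
rewrite /F complex_ReM /= mul0r subr0 tE /part mulrA -expRD; congr (_ * _).
rewrite exprz2E /powR gt_eqF ?expR_gt0// expRK; congr expR.
by rewrite -[k%:R]/((Posz k)%:~R : R); ring.
Qed.

(** The frequency is [- mu / 4] because [psi] is evaluated at [(X - S - T) / 4]. *)
Definition osc (mu : R) (u : R) : R[i] := ((part u)%:C)%C * expi (- mu / 4 * u).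

Lemma osc_eq0 mu u : 1 <= `|u| -> osc mu u = 0.
Proof. by move=> u1; rewrite /osc part_eq0// mul0r. Qed.

Lemma osc_classC (N : nat) : exists2 C : R, 0 < C & forall mu W : R,
  C * (1 + `|mu|) ^+ N <= W -> 0 < W ->
  classC N `[-1, 1] (fun u => ((W^-1)%:C)%C * osc mu u).
Proof.
have H : exists2 C : R, 0 < C & forall k, (k <= N)%N -> forall lam th t : R,
   `|(fun s => part s * cos (lam * s + th))^`(k)%classic t| <= C * (1 + `|lam|) ^+ N.
  have [f Hf] : {f : nat -> R & forall k, 0 <= f k /\ forall lam th t : R,
    `|(fun s => part s * cos (lam * s + th))^`(k)%classic t| <= f k * (1 + `|lam|) ^+ k}.
    apply: (@choice _ _ (fun k C => 0 <= C /\ forall lam th t : R,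
    `|(fun s => part s * cos (lam * s + th))^`(k)%classic t| <= C * (1 + `|lam|) ^+ k)) => k.
    by have [C C0 HC] := bump_osc_bound k bump_part; exists C.
  exists (1 + \sum_(k < N.+1) f k).
    by rewrite ltr_pwDl// sumr_ge0// => k _; case: (Hf k).
  move=> k kN lam th t; have [f0 /(_ lam th t)] := Hf k => /le_trans; apply.
  apply: ler_pM; [exact: f0|by rewrite exprn_ge0// addr_ge0| |].
    rewrite -ltnS in kN; rewrite (bigD1 (Ordinal kN))//= addrCA lerDl.
    by rewrite addr_ge0// sumr_ge0// => j _; case: (Hf j).
  by apply: ler_weXn2l => //; rewrite lerDl.
(* The factor 2 pays for bounding [normc] by the sum of the real and imaginary parts. *)
have [C C0 HC] := H; exists (2 * C); first by rewrite mulr_gt0.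
move=> mu W CW W0.
pose lam := - mu / 4.
have ReE : Re \o (fun u => ((W^-1)%:C)%C * osc mu u) =
    fun u => W^-1 * (part u * cos (lam * u + 0)).
  by apply/funext => u; rewrite /comp /osc !(complex_ReM, complex_ImM) /= addr0; ring.
have ImE : Im \o (fun u => ((W^-1)%:C)%C * osc mu u) =
    fun u => W^-1 * (part u * cos (lam * u - pi / 2)).
  by apply/funext => u; rewrite /comp /osc !(complex_ReM, complex_ImM) /= cosBpihalf; ring.
have [sp _] := bump_part.
have sc th : smoothR (fun u => part u * cos (lam * u + th)).
  apply: smoothRM => //; apply: (smoothR_comp (@smoothR_cos R)); exact: smoothR_affine.
have lmu : `|lam| <= `|mu|.
  by rewrite /lam normrM normrN (ger0_norm (_ : 0 <= 4^-1))//; have := normr_ge0 mu; lra.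
split.
- split; [rewrite ReE|rewrite ImE].
    exact: (smoothRM (@smoothR_cst R W^-1) (sc 0)).
  exact: (smoothRM (@smoothR_cst R W^-1) (sc (- (pi / 2)))).
- have /closure_id E : closed (`[-1, 1]%classic : set R) by exact: interval_closed.
  rewrite E; apply: closure_subset => u /= /eqP u0; rewrite in_itv/= -ler_norml leNgt.
  by apply/negP => u1; apply: u0; rewrite osc_eq0 ?mulr0// ltW.
move=> k t kN _; apply: (le_trans (normc_le_ReIm _)).
rewrite /derivenC ReE ImE (derive1nZ _ _ (sc 0)) (derive1nZ _ _ (sc (- (pi / 2)))).
rewrite /= !normrM -mulrDr gtr0_norm ?invr_gt0// ler_pdivrMl// mulr1.
apply: le_trans CW; rewrite -mulrA mulr_natl mulr2n.
have X : C * (1 + `|lam|) ^+ N <= C * (1 + `|mu|) ^+ N.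
  by rewrite ler_wpM2l ?(ltW C0)// lerXn2r ?nnegrE ?addr_ge0// lerD2l.
by apply: lerD; apply: le_trans X; exact: HC.
Qed.

End Partition.

(** * L^r bounds *)

Section LnormReal.
Context d (T : measurableType d) (R : realType).
Variable mu : {measure set T -> \bar R}.
Implicit Types (u v : T -> R) (r : \bar R).

Local Notation "'LN[ r ] u" := (Lnorm mu r (EFin \o u))
  (at level 10, format "''LN[' r ]  u").

Lemma measurable_norm_powR (a : R) u : measurable_fun setT u ->
  measurable_fun setT (fun x => (`|(EFin \o u) x| `^ a)%E).
Proof.
move=> mu_; rewrite (_ : (fun x => _) = EFin \o (fun x => `|u x| `^ a)) //.
apply/measurable_EFinP; apply: (measurableT_comp (T2 := measurableTypeR R) (@measurable_powR R a)).
exact: measurableT_comp.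
Qed.

Lemma Lnorm_le r u v : (1 <= r)%E -> measurable_fun setT u -> measurable_fun setT v ->
  (forall x, `|u x| <= `|v x|) -> ('LN[r] u <= 'LN[r] v)%E.
Proof.
move=> r1 mu_ mv uv; rewrite unlock /Lnorm; case: r r1 => [r r1|_|//]; last first.
  case: ifP => // _; apply: le_ess_sup; apply: nearW => x /=.
  by rewrite lee_fin.
rewrite lee_fin in r1; have r0 : 0 <= r by lra.
apply: gt0_ler_poweR; rewrite ?invr_ge0// ?in_itv/= ?integral_ge0 ?leey//.
apply: ge0_le_integral => //; try (by move=> x _; exact: poweR_ge0);
  try exact: measurable_norm_powR.
by move=> x _ /=; rewrite lee_fin ge0_ler_powR// ?nnegrE.
Qed.

Lemma LnormZ_le r (c : R) u : (1 <= r)%E -> 0 <= c -> measurable_fun setT u ->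
  ('LN[r] (fun x => (c * u x)%R) <= c%:E * 'LN[r] u)%E.
Proof.
move=> r1 c0 mu_; rewrite unlock /Lnorm; case: r r1 => [r r1|_|//]; last first.
  case: ifP => // _; last by rewrite mule0.
  apply/ess_supP; near=> x.
  rewrite /= normrM ger0_norm// EFinM lee_wpmul2l ?lee_fin//.
  by near: x; exact: ess_sup_ge.
rewrite lee_fin in r1; have r0 : 0 < r by lra.
have -> : (\int[mu]_x `|(EFin \o (fun x => c * u x)%R) x| `^ r =
    (c `^ r)%:E * \int[mu]_x `|(EFin \o u) x| `^ r)%E.
  rewrite -ge0_integralZl//; last 3 first.
  - exact: measurable_norm_powR.
  - by move=> x _; exact: poweR_ge0.
  - by rewrite lee_fin powR_ge0.
  apply: eq_integral => x _ /=.
  by rewrite normrM powRM// EFinM (ger0_norm c0).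
rewrite poweRM ?lee_fin ?powR_ge0//; last by apply: integral_ge0 => x _; exact: poweR_ge0.
by rewrite poweR_EFin -powRrM mulfV ?gt_eqF// powRr1.
Unshelve. all: by end_near. Qed.

Lemma Lnorm_sum_le (I : Type) (s : seq I) r (c : I -> R) (F : I -> T -> R) :
  (1 <= r)%E -> (forall i, 0 <= c i) -> (forall i, measurable_fun setT (F i)) ->
  ('LN[r] (fun x => (\sum_(i <- s) c i * F i x)%R) <= \sum_(i <- s) (c i)%:E * 'LN[r] (F i))%E.
Proof.
move=> r1 c0 mF; elim: s => [|i s IH].
  rewrite big_nil; have -> : (fun x => \sum_(i <- [::]) c i * F i x) = fun x => 0 * cst 0 x.
    by apply/funext => x; rewrite big_nil mul0r.
  by rewrite (le_trans (LnormZ_le r1 _ _))// mul0e.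
have -> : (fun x => \sum_(j <- i :: s) c j * F j x) =
    ((fun x => c i * F i x) \+ (fun x => \sum_(j <- s) c j * F j x)).
  by apply/funext => x; rewrite big_cons.
rewrite big_cons (le_trans (eminkowski _ _ _ r1))//.
- exact: measurable_funM.
- by apply: measurable_sum => j; exact: measurable_funM.
by apply: leeD => //; exact: LnormZ_le.
Qed.

(** Continuity of the power settles a nonzero limit; at 0 one uses [|u n|^a <= |u n|] once
    [|u n| < 1]. *)
Lemma cvg_norm_powR (a : R) (u : nat -> R) (l : R) : 1 <= a -> u @ \oo --> l ->
  (fun n => `|u n| `^ a) @ \oo --> `|l| `^ a.
Proof.
move=> a1 /cvg_norm ul.
have [l0|l0] := eqVneq l 0; last first.
  have H : {for `|l|, continuous (fun x : R => x `^ a)}.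
    apply: differentiable_continuous; apply/derivable1_diffP.
    by apply: derivable_powR; rewrite in_itv/= andbT normr_gt0.
  exact: (cvg_comp (fun n => `|u n|) (fun x : R => x `^ a) ul H).
rewrite l0 normr0 powR0 ?gt_eqF ?(lt_le_trans ltr01)//.
rewrite l0 normr0 in ul.
apply: (squeeze_cvgr (f := fun=> 0) (h := fun n => `|u n|)); [|exact: cvg_cst|exact: ul].
have : \forall n \near \oo, `|u n| < 1 by move: ul => /cvgr_lt/(_ _ ltr01).
apply: filterS => n un; rewrite powR_ge0/=.
have [->|u0] := eqVneq (u n) 0; first by rewrite normr0 powR0 ?gt_eqF ?(lt_le_trans ltr01).
rewrite -[leRHS]powRr1// ger_powR// normr_gt0 u0/=.
exact: ltW.
Qed.

Lemma Lnorm_fatou r (u : nat -> T -> R) v (b : R) : (1 <= r)%E ->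
  (forall n, measurable_fun setT (u n)) -> (forall x, u ^~ x @ \oo --> v x) ->
  (forall n, 'LN[r] (u n) <= b%:E)%E -> ('LN[r] v <= b%:E)%E.
Proof.
move=> r1 mu_ uv ub.
have b0 : 0 <= b by rewrite -lee_fin (le_trans (Lnorm_ge0 _ _ _) (ub 0%N)).
move: ub; rewrite unlock /Lnorm; case: r r1 => [r r1|_|//] ub; last first.
  (* For [r = +oo] the countably many exceptional null sets are discarded together. *)
  case: ifP ub => // _ ub; apply/ess_supP.
  have : \forall x \ae mu, forall n, ((abse \o (EFin \o u n)) x <= b%:E)%E.
    by apply/ae_foralln => n; apply/ess_supP; exact: ub.
  apply: filterS => x ux /=; rewrite lee_fin.
  apply: (cvgr_to_le (cvg_norm (uv x))); apply: nearW => n.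
  by have := ux n; rewrite /= lee_fin.
rewrite lee_fin in r1; have r0 : 0 < r by lra.
have {}ub n : (\int[mu]_x `|(EFin \o u n) x| `^ r <= (b `^ r)%:E)%E.
  have I0 : (0 <= \int[mu]_x `|(EFin \o u n) x| `^ r)%E.
    by apply: integral_ge0 => x _; exact: poweR_ge0.
  have := ub n; set J := (X in (X `^ _)%E) => H.
  have : ((J `^ r^-1) `^ r <= b%:E `^ r)%E.
    apply: gt0_ler_poweR; [exact: ltW| | |exact: H].
      by rewrite in_itv/= poweR_ge0 leey.
    by rewrite in_itv/= lee_fin b0 leey.
  by rewrite -poweRrM mulVf ?gt_eqF// poweRe1.
have -> : b%:E = (((b `^ r)%:E) `^ r^-1)%E :> \bar R.
  by rewrite poweR_EFin -powRrM mulfV ?gt_eqF// powRr1.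
apply: gt0_ler_poweR; [by rewrite invr_ge0 ltW| |by rewrite in_itv/= lee_fin powR_ge0 leey|].
  have I0 : (0 <= \int[mu]_x `|(EFin \o v) x| `^ r)%E.
    by apply: integral_ge0 => x _; exact: poweR_ge0.
  by rewrite in_itv; apply/andP; split; [exact: I0|exact: leey].
have -> : (\int[mu]_x `|(EFin \o v) x| `^ r =
    \int[mu]_x limn_einf (fun n => `|(EFin \o u n) x| `^ r))%E.
  apply: eq_integral => x _; apply/esym.
  have /cvg_limn_einf_sup[->//] : (fun n => (`|(EFin \o u n) x| `^ r)%E) @ \oo -->
      (`|(EFin \o v) x| `^ r)%E.
  by apply/fine_cvgP; split; [exact: nearW|exact: cvg_norm_powR].
apply: (le_trans (fatou mu measurableT _ _)).
- by move=> n; exact: measurable_norm_powR.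
- by move=> n x _; exact: poweR_ge0.
rewrite limn_einf_lim; apply: lime_le; first exact: is_cvg_einfs.
apply: nearW => n; apply: (le_trans _ (ub n)).
by apply: ereal_inf_lbound; exists n => //=.
Qed.

End LnormReal.

Section ComplexMeasurable.
Context d (T : measurableType d) (R : realType).
Implicit Types (f g : T -> R[i]).

Definition measurableC f := measurable_fun setT (Re \o f) /\ measurable_fun setT (Im \o f).

Lemma measurableC_normc f : measurableC f -> measurable_fun setT (fun x => normc (f x)).
Proof.
move=> [m1 m2]; rewrite (_ : (fun x => normc (f x)) =
    (@Num.sqrt R) \o (fun x => (Re \o f) x ^+ 2 + (Im \o f) x ^+ 2)); last first.
  by apply/funext => x /=; case: (f x).
apply: (measurableT_comp (T2 := measurableTypeR R)).
  by apply: continuous_measurable_fun; exact: sqrt_continuous.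
by apply: measurable_funD; exact: measurable_funX.
Qed.

Lemma measurableCM f g : measurableC f -> measurableC g -> measurableC (fun x => f x * g x).
Proof.
move=> [m1 m2] [m3 m4]; split.
  rewrite (_ : _ \o _ = fun x => (Re \o f) x * (Re \o g) x - (Im \o f) x * (Im \o g) x).
    by apply: measurable_funB; exact: measurable_funM.
  by apply/funext => x /=; rewrite complex_ReM.
rewrite (_ : _ \o _ = fun x => (Re \o f) x * (Im \o g) x + (Im \o f) x * (Re \o g) x).
  by apply: measurable_funD; exact: measurable_funM.
by apply/funext => x /=; rewrite complex_ImM.
Qed.

Lemma measurableC_cst (c : R[i]) : measurableC (cst c).
Proof. by split; exact: measurable_cst. Qed.

Lemma measurableC_sum (I : Type) (s : seq I) (F : I -> T -> R[i]) :
  (forall i, measurableC (F i)) -> measurableC (fun x => \sum_(i <- s) F i x).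
Proof.
move=> mF; split.
  rewrite (_ : _ \o _ = fun x => \sum_(i <- s) (Re \o F i) x).
    by apply: measurable_sum => i; have [] := mF i.
  by apply/funext => x /=; rewrite sum_ReE.
rewrite (_ : _ \o _ = fun x => \sum_(i <- s) (Im \o F i) x).
  by apply: measurable_sum => i; have [] := mF i.
by apply/funext => x /=; rewrite sum_ImE.
Qed.

End ComplexMeasurable.

(** * Iterated complex integrals *)

Section IntegralC.
Variables (R : realType) (n : nat).
Local Notation V := 'rV[R]_n.
Local Notation mu := (leb R n).
Implicit Types (f g : V -> R[i]) (K : V -> V -> R[i]).

Lemma normc_ge0 (z : R[i]) : 0 <= normc z.
Proof. exact: le_trans (Re_le_normc z). Qed.

Lemma normc_sum (I : Type) (s : seq I) (F : I -> R[i]) :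
  normc (\sum_(i <- s) F i) <= \sum_(i <- s) normc (F i).
Proof.
elim: s => [|i s IH]; first by rewrite !big_nil ComplexField.Normc.normc0.
by rewrite !big_cons (le_trans (complex.le_normcD _ _))// lerD2l.
Qed.

Definition integrableC f :=
  mu.-integrable setT (EFin \o (Re \o f)) /\ mu.-integrable setT (EFin \o (Im \o f)).

Lemma integrable_measurable (u : V -> R) : mu.-integrable setT (EFin \o u) -> measurable_fun setT u.
Proof. by move=> iu; apply/measurable_EFinP; exact: (measurable_int _ iu). Qed.

Lemma integrableCZ (c : R[i]) f : integrableC f ->
  integrableC (fun x => c * f x) /\ integralC (fun x => c * f x) = c * integralC f.
Proof.
move=> [fr fi].
have i1 a := integrableZl measurableT a fr.
have i2 a := integrableZl measurableT a fi.
have ReE : Re \o (fun x => c * f x) = fun x => Re c * (Re \o f) x - Im c * (Im \o f) x.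
  by apply/funext => x /=; rewrite complex_ReM.
have ImE : Im \o (fun x => c * f x) = fun x => Re c * (Im \o f) x + Im c * (Re \o f) x.
  by apply/funext => x /=; rewrite complex_ImM.
split.
  split; rewrite ?ReE ?ImE.
    exact: (integrableB measurableT (i1 (Re c)) (i2 (Im c))).
  exact: (integrableD measurableT (i2 (Re c)) (i1 (Im c))).
apply: complex_ext; rewrite ?complex_ReM ?complex_ImM /=.
  rewrite -[LHS]/(\int[mu]_x (Re \o (fun x => c * f x)) x) ReE.
  by rewrite RintegralB// ?RintegralZl//; [exact: i1|exact: i2].
rewrite -[LHS]/(\int[mu]_x (Im \o (fun x => c * f x)) x) ImE.
by rewrite RintegralD// ?RintegralZl//; [exact: i2|exact: i1].
Qed.

Lemma integrableC_sum (I : eqType) (s : seq I) (F : I -> V -> R[i]) :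
  (forall i, integrableC (F i)) -> integrableC (fun x => \sum_(i <- s) F i x) /\
  integralC (fun x => \sum_(i <- s) F i x) = \sum_(i <- s) integralC (F i).
Proof.
move=> iF.
have ReE : Re \o (fun x => \sum_(i <- s) F i x) = fun x => \sum_(i <- s) (Re \o F i) x.
  by apply/funext => x /=; rewrite sum_ReE.
have ImE : Im \o (fun x => \sum_(i <- s) F i x) = fun x => \sum_(i <- s) (Im \o F i) x.
  by apply/funext => x /=; rewrite sum_ImE.
have S (G : I -> V -> R) : (forall i, mu.-integrable setT (EFin \o G i)) ->
    mu.-integrable setT (EFin \o (fun x => \sum_(i <- s) G i x)).
  move=> iG; rewrite (_ : _ \o _ = fun x => (\sum_(i <- s) (EFin \o G i) x)%E).
    by apply: (integrable_sum measurableT) => i _; exact: iG.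
  by apply/funext => x /=; rewrite sumEFin.
split.
  by split; rewrite ?ReE ?ImE; apply: S => i; have [] := iF i.
apply: complex_ext; rewrite ?sum_ReE ?sum_ImE /=.
  rewrite -[LHS]/(\int[mu]_x (Re \o (fun x => \sum_(i <- s) F i x)) x) ReE.
  by apply: Rintegral_sum => i; have [] := iF i.
rewrite -[LHS]/(\int[mu]_x (Im \o (fun x => \sum_(i <- s) F i x)) x) ImE.
by apply: Rintegral_sum => i; have [] := iF i.
Qed.

(** An explicit rate rather than bare convergence, so that the error of an inner integral can serve
    as the hypothesis of an outer one. *)
Lemma integralC_limit (f_ : nat -> V -> R[i]) f (h : V -> R) (e : nat -> R) :
  (forall k, integrableC (f_ k)) -> mu.-integrable setT (EFin \o h) ->
  e @ \oo --> 0 -> (forall k x, normc (f_ k x - f x) <= e k * h x) ->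
  integrableC f /\
  forall k, normc (integralC (f_ k) - integralC f) <= 2 * (e k * \int[mu]_x h x).
Proof.
move=> if_ ih e0 fe.
have real (u_ : nat -> V -> R) (u : V -> R) :
    (forall k, mu.-integrable setT (EFin \o u_ k)) ->
    (forall k x, `|u_ k x - u x| <= e k * h x) ->
    mu.-integrable setT (EFin \o u) /\
    forall k, `|\int[mu]_x u_ k x - \int[mu]_x u x| <= e k * \int[mu]_x h x.
  move=> iu ue.
  have mu_ : measurable_fun setT u.
    apply: (@measurable_fun_cvg _ _ _ _ u_) => [k|x _]; first exact: integrable_measurable.
    apply/subr_cvg0; apply/cvgr0Pnorm_le => eps eps0.
    have : e k * h x @[k --> \oo] --> 0 * h x by apply: cvgM => //; exact: cvg_cst.
    rewrite mul0r => /cvgr0_norm_le/(_ _ eps0); apply: filterS => k.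
    by apply: le_trans; exact: le_trans (ue k x) (ler_norm _).
  have iuu : mu.-integrable setT (EFin \o u).
    apply: (@integrable_le _ _ _ _ _ (fun x => `|u_ 0%N x| + e 0%N * h x)) => //.
      move=> x; have := ue 0%N x; have := ler_normB (u_ 0%N x) (u_ 0%N x - u x).
      by rewrite subKr => /le_trans + H; apply; rewrite lerD2l.
    exact: (integrableD measurableT (integrable_norm (iu 0%N)) (integrableZl measurableT (e 0%N) ih)).
  split => // k; rewrite -RintegralB// -RintegralZl//.
  apply: ler_norm_Rintegral => //.
    by apply: measurable_funB => //; exact: integrable_measurable.
  exact: (integrableZl measurableT (e k) ih).
have ReB (z w : R[i]) : Re (z - w) = Re z - Re w by case: z; case: w.
have ImB (z w : R[i]) : Im (z - w) = Im z - Im w by case: z; case: w.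
have [ir br] : mu.-integrable setT (EFin \o (Re \o f)) /\
    forall k, `|\int[mu]_x Re (f_ k x) - \int[mu]_x Re (f x)| <= e k * \int[mu]_x h x.
  apply: (real (fun k => Re \o f_ k)) => [k|k x]; first by have [] := if_ k.
  by rewrite /= -ReB (le_trans (Re_le_normc _)).
have [ii bi] : mu.-integrable setT (EFin \o (Im \o f)) /\
    forall k, `|\int[mu]_x Im (f_ k x) - \int[mu]_x Im (f x)| <= e k * \int[mu]_x h x.
  apply: (real (fun k => Im \o f_ k)) => [k|k x]; first by have [] := if_ k.
  by rewrite /= -ImB (le_trans (Im_le_normc _)).
split => [//|k]; rewrite (le_trans (normc_le_ReIm _))// ReB ImB mulr_natl mulr2n.
by apply: lerD; [exact: br|exact: bi].
Qed.

(* [K eta xi] has the iterated integral [v], with every inner integral convergent. *)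
Definition iint K (v : R[i]) := [/\ forall y, integrableC (K y),
  integrableC (fun y => integralC (K y)) & integralC (fun y => integralC (K y)) = v].

Lemma iint_prod f g : integrableC f -> integrableC g ->
  iint (fun y x => f x * g y) (integralC f * integralC g).
Proof.
move=> if_ ig.
have E y : (fun x => f x * g y) = fun x => g y * f x by apply/funext => x; rewrite mulrC.
have E2 : (fun y => integralC (fun x => f x * g y)) = fun y => integralC f * g y.
  by apply/funext => y; rewrite E (integrableCZ _ if_).2 mulrC.
split=> [y||]; first by rewrite E; exact: (integrableCZ _ if_).1.
  by rewrite E2; exact: (integrableCZ _ ig).1.
by rewrite E2 (integrableCZ _ ig).2.
Qed.

Lemma iintZ (c : R[i]) K v : iint K v -> iint (fun y x => c * K y x) (c * v).
Proof.
move=> [k1 k2 <-].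
have E : (fun y => integralC (fun x => c * K y x)) = fun y => c * integralC (K y).
  by apply/funext => y; rewrite (integrableCZ _ (k1 y)).2.
split=> [y||]; first exact: (integrableCZ _ (k1 y)).1.
  by rewrite E; exact: (integrableCZ _ k2).1.
by rewrite E (integrableCZ _ k2).2.
Qed.

Lemma iint_sum (I : eqType) (s : seq I) (K : I -> V -> V -> R[i]) (v : I -> R[i]) :
  (forall i, iint (K i) (v i)) ->
  iint (fun y x => \sum_(i <- s) K i y x) (\sum_(i <- s) v i).
Proof.
move=> iK.
have k1 y := integrableC_sum s (F := fun i => K i y)
  (fun i => let: And3 h _ _ := iK i in h y).
have k2 := integrableC_sum s (F := fun i y => integralC (K i y))
  (fun i => let: And3 _ h _ := iK i in h).
have E : (fun y => integralC (fun x => \sum_(i <- s) K i y x)) =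
    fun y => \sum_(i <- s) integralC (K i y).
  by apply/funext => y; rewrite (k1 y).2.
split=> [y||]; first exact: (k1 y).1.
  by rewrite E; exact: k2.1.
by rewrite E k2.2; apply: eq_bigr => i _; have [] := iK i.
Qed.

(** [integralC_limit] is used twice: integrating in [x] leaves a null sequence times [h2 y]. The
    order of integration is never exchanged, as [Btilde] is itself an iterated integral. *)
Lemma iint_limit (K_ : nat -> V -> V -> R[i]) (v_ : nat -> R[i]) K (h1 h2 : V -> R) (e : nat -> R) :
  (forall k, iint (K_ k) (v_ k)) -> mu.-integrable setT (EFin \o h1) ->
  mu.-integrable setT (EFin \o h2) -> e @ \oo --> 0 ->
  (forall k y x, normc (K_ k y x - K y x) <= e k * (h1 x * h2 y)) ->
  normc (v_ k) @[k --> \oo] --> normc (integralC (fun y => integralC (K y))).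
Proof.
move=> iK i1 i2 e0 Ke.
pose I1 := \int[mu]_x h1 x; pose I2 := \int[mu]_x h2 x.
have inner y : integrableC (K y) /\
    forall k, normc (integralC (K_ k y) - integralC (K y)) <= (2 * I1 * e k) * h2 y.
  have i1y : mu.-integrable setT (EFin \o (fun x => h1 x * h2 y)).
    exact: (integrableZr measurableT (h2 y) i1).
  have [k1 k2] := integralC_limit (fun k => let: And3 h _ _ := iK k in h y) i1y e0
    (fun k x => Ke k y x).
  split => // k; apply: le_trans (k2 k) _; rewrite RintegralZr// -/I1.
  by rewrite le_eqVlt; apply/orP; left; apply/eqP; ring.
have e0' : (2 * I1 * e k) @[k --> \oo] --> 0.
  by rewrite -(mulr0 (2 * I1)); apply: cvgM => //; exact: cvg_cst.
have [_ k2] := integralC_limit (fun k => let: And3 _ h _ := iK k in h) i2 e0'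
    (fun k y => (inner y).2 k).
have {}k2 k : `|normc (v_ k) - normc (integralC (fun y => integralC (K y)))| <=
    2 * (2 * I1 * e k * I2).
  apply: le_trans (k2 k); have [_ _ ->] := iK k.
  rewrite ler_norml; apply/andP; split.
    rewrite lerNl opprB lerBlDr -(complex.normcN (_ - _)) opprB.
    by apply: le_trans (complex.le_normcD _ _); rewrite subrK.
  by rewrite lerBlDr; apply: le_trans (complex.le_normcD _ _); rewrite subrK.
apply/subr_cvg0; apply/cvgr0Pnorm_le => eps eps0.
have : 2 * (2 * I1 * e k * I2) @[k --> \oo] --> 2 * (0 * I2).
  by apply: cvgM; [exact: cvg_cst|apply: cvgM => //; exact: cvg_cst].
rewrite mul0r mulr0 => /cvgr0_norm_le/(_ _ eps0); apply: filterS => k.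
by apply: le_trans; exact: le_trans (k2 k) (ler_norm _).
Qed.

End IntegralC.

(** * Decomposition of the bilinear multiplier *)

Section Kernel.
Variables (R : realType) (alpha : R) (psi : R -> R[i]).
Hypotheses (tp : test_function `]1/2, 2[ psi) (dr : dyadic_resolution alpha psi).
Local Notation part := (part alpha psi).
Local Notation osc := (osc alpha psi).
Local Notation a_ := (fourier_coef psi).
Local Notation mu_ := (@fourier_freq R).

(* If [psi ((X - S - T) / 4) <> 0] then [S + T] is within bounded distance of [F],
   so ten antidiagonals of cells suffice. *)
Definition pou (F : nat) (S T : R) : R := \sum_(i < 10) \sum_(j < F.+1)
  part (S - j%:R) * part (T - (F%:R - i%:R) + j%:R).

(** Here [S + T] lies in ]F - 8, F - 1[. Hence [S <= F] and the sum over [j] is a full partition;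
    and when [|S - j| < 1], [T + j - F + 9] lies in ]0, 9[, which ten translates cover. *)
Lemma pou_eq1 (X S T : R) (F : nat) : 0 <= S -> 0 <= T -> F%:R <= X < F.+1%:R ->
  1/2 < (X - S - T) / 4 < 2 -> pou F S T = 1.
Proof.
move=> S0 T0 /andP[FX XF] /andP[h1 h2]; rewrite -natr1 in XF.
have {}h1 : 2 < X - S - T by lra.
have {}h2 : X - S - T < 8 by lra.
rewrite /pou exchange_big /= -[RHS](@part_partition _ alpha psi tp dr S F.+1)//; last first.
  by rewrite -natr1; lra.
apply: eq_bigr => j _; rewrite -mulr_sumr.
have [Sj|Sj] := leP 1 `|S - j%:R|; first by rewrite (part_eq0 _ tp)// mul0r.
rewrite ltr_norml in Sj; case/andP: Sj => j1 j2.
rewrite -[RHS]mulr1; congr (_ * _).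
rewrite -[RHS](@part_partition _ alpha psi tp dr (T + j%:R - F%:R + 9) 10); [|lra|lra].
(* In [pou] the index [i] is added, in the partition it is subtracted; hence the reversal
   [i -> 9 - i]. *)
rewrite (reindex_inj rev_ord_inj) /=; apply: eq_bigr => i _; congr (part _).
have -> : ((10 - i.+1)%N%:R : R) = 9 - i%:R by rewrite subSS natrB// -ltnS.
by ring.
Qed.

(** On cell [(i, j)] the number [S + T] is within 2 of [F - i], so [X - S - T] lies in ]i - 2, i +
    3[ with [i <= 9]. *)
Lemma pou_neq0 (X S T : R) (F : nat) : F%:R <= X < F.+1%:R -> pou F S T != 0 ->
  - (1/2) <= (X - S - T) / 4 <= 3.
Proof.
move=> /andP[FX XF]; rewrite -natr1 in XF.
apply: contra_neqT => z; apply: big1 => i _; apply: big1 => j _.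
have [Sj|Sj] := leP 1 `|S - j%:R|; first by rewrite (part_eq0 _ tp)// mul0r.
have [Tj|Tj] := leP 1 `|T - (F%:R - i%:R) + j%:R|; first by rewrite (part_eq0 _ tp Tj) mulr0.
exfalso; move/negP: z; apply.
have i9 : (i%:R : R) <= 9 by rewrite (ler_nat R i 9) -ltnS.
have i0 : 0 <= (i%:R : R) by [].
move: Sj Tj; rewrite !ltr_norml => /andP[j1 j2] /andP[j3 j4].
by apply/andP; split; lra.
Qed.

(** The growth in [F] is harmless: this bound serves only the limit in [M], at fixed [F]. *)
Lemma pou_bounded : exists2 P : R, 0 <= P & forall F S T, `|pou F S T| <= P * F.+1%:R.
Proof.
have [P P0 HP] := bump_bounded (bump_part alpha tp).
exists (10 * P ^+ 2); first by rewrite mulr_ge0// exprn_ge0.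
move=> F S T; rewrite /pou (le_trans (ler_norm_sum _ _ _))//.
apply: (@le_trans _ _ (\sum_(i < 10) (F.+1%:R * P ^+ 2))).
  apply: ler_sum => i _; rewrite (le_trans (ler_norm_sum _ _ _))//.
  apply: (@le_trans _ _ (\sum_(j < F.+1) P ^+ 2)).
    by apply: ler_sum => j _; rewrite normrM expr2 ler_pM.
  by rewrite sumr_const card_ord mulr_natl.
rewrite sumr_const card_ord -mulr_natl; nra.
Qed.

Lemma expiD (s t : R) : expi (s + t) = expi s * expi t.
Proof. by rewrite /expi cosD sinD; apply: complex_ext; rewrite ?complex_ReM ?complex_ImM//= addrC. Qed.

(** With [u] and [v] the arguments of the two cut-offs, [X - S - T = (X - (F - i)) - u - v] for
    every [j]; the constant phase goes into the coefficient. *)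
Lemma kernel_separation (X S T : R) (F m : nat) :
  \sum_(k < m) \sum_(i < 10) \sum_(j < F.+1)
    (a_ k * expi (mu_ k * ((X - (F%:R - i%:R)) / 4))) *
    (osc (mu_ k) (S - j%:R) * osc (mu_ k) (T - (F%:R - i%:R) + j%:R)) =
  ((pou F S T)%:C)%C * \sum_(k < m) a_ k * expi (mu_ k * ((X - S - T) / 4)).
Proof.
rewrite mulr_sumr; apply: eq_bigr => k _.
rewrite /pou rmorph_sum mulr_suml; apply: eq_bigr => i _.
rewrite rmorph_sum mulr_suml; apply: eq_bigr => j _.
rewrite rmorphM /osc.
set u := S - j%:R; set v := T - _ + _.
have -> : expi (mu_ k * ((X - S - T) / 4)) =
    expi (mu_ k * ((X - (F%:R - i%:R)) / 4)) * expi (- mu_ k / 4 * u) * expi (- mu_ k / 4 * v).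
  by rewrite -!expiD /u /v; congr expi; field.
by move: (expi _) (expi _) (expi _) => e1 e2 e3; ring.
Qed.

(** [pou * psi = psi], since [pou] is 1 where [psi] is nonzero. The series therefore has to
    approximate [psi] only where [pou] is nonzero, and there [fourier_series] applies. *)
Lemma kernel_approx : exists2 C : R, 0 <= C & forall (X S T : R) (F M : nat),
  0 <= S -> 0 <= T -> F%:R <= X < F.+1%:R ->
  normc (\sum_(k < M.+1.*2) \sum_(i < 10) \sum_(j < F.+1)
    (a_ k * expi (mu_ k * ((X - (F%:R - i%:R)) / 4))) *
    (osc (mu_ k) (S - j%:R) * osc (mu_ k) (T - (F%:R - i%:R) + j%:R)) -
    psi ((X - S - T) / 4)) <= C * F.+1%:R / M.+1%:R.
Proof.
have [P P0 HP] := pou_bounded; have [C C0 HC] := fourier_series tp.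
exists (P * C); first exact: mulr_ge0.
move=> X S T F M S0 T0 FX; rewrite kernel_separation.
set z := (X - S - T) / 4; set Psi := \sum_(k < _) _.
have [p0|p0] := eqVneq (pou F S T) 0.
  rewrite p0 mul0r sub0r complex.normcN (test_function_eq0 tp).
    by rewrite ComplexField.Normc.normc0 divr_ge0// !mulr_ge0.
  apply/negP => h; have := pou_eq1 S0 T0 FX h; rewrite p0 => /esym/eqP.
  by rewrite oner_eq0.
have -> : ((pou F S T)%:C)%C * Psi - psi z = - (((pou F S T)%:C)%C * (psi z - Psi)).
  have [h|h] := boolP (1/2 < z < 2); last by rewrite (test_function_eq0 tp h); ring.
  by rewrite (pou_eq1 S0 T0 FX h) rmorph1; ring.
rewrite complex.normcN ComplexField.Normc.normcM.
have -> : normc ((pou F S T)%:C)%C = `|pou F S T| by rewrite /normc /= expr0n /= addr0 sqrtr_sqr.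
have -> : P * C * F.+1%:R / M.+1%:R = (P * F.+1%:R) * (C / M.+1%:R) by ring.
by apply: ler_pM => //; [exact: normc_ge0|apply: HC; exact: pou_neq0 FX p0].
Qed.

End Kernel.

Section BopSum.
Variables (R : realType) (n : nat).

Lemma Bop_sum (phi1 phi2 : R -> R[i]) (delta varrho : R) (F : nat) f g (x : 'rV[R]_n) :
  0 < delta -> F%:R <= delta^-1 < F.+1%:R ->
  Bop phi1 phi2 delta varrho f g x = \sum_(j < F.+1)
    Sop phi1 (delta * j%:R) delta f x * Sop phi2 (varrho - delta * j%:R) delta g x.
Proof.
move=> d0 /andP[F1 F2]; rewrite /Bop.
pose r := [seq delta * (k%:R) | k <- iota 0 F.+1].
have -> : [set rho : R | (exists k : int, rho = delta * k%:~R) /\ 0 <= rho <= 1] = [set` r].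
  apply/seteqP; split=> rho /=.
    move=> [[k ->] /andP[k0 k1]]; apply/mapP.
    rewrite pmulr_rge0// ler0z in k0; case: k k0 k1 => // k _ k1.
    exists k => //; rewrite mem_iota /= add0n -(ltr_nat R).
    by apply: le_lt_trans F2; rewrite -[leRHS]mulr1 ler_pdivlMl.
  move=> /mapP[k + ->]; rewrite mem_iota /= add0n ltnS => kF; split; first by exists k.
  rewrite mulr_ge0 ?(ltW d0)//= -ler_pdivlMl// mulr1 (le_trans _ F1)//.
  by rewrite ler_nat.
rewrite -fsbig_seq; last first.
  rewrite map_inj_uniq ?iota_uniq// => a b /(mulfI (lt0r_neq0 d0)) /eqP.
  by rewrite eqr_nat => /eqP.
by rewrite /r big_map -[F.+1 in LHS]subn0 -/(index_iota 0 F.+1) big_mkord.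
Qed.

End BopSum.

(** * Finite superpositions of the operators [Bop] *)

Section Superposition.
Variables (R : realType) (n : nat) (alpha : R) (psi : R -> R[i]).
Hypotheses (tp : test_function `]1/2, 2[ psi) (dr : dyadic_resolution alpha psi).
Variables (N : nat) (W : nat -> R).
Hypothesis W0 : forall k, 0 < W k.
Let phi (k : nat) (u : R) : R[i] := (((W k)^-1)%:C)%C * osc alpha psi (@fourier_freq R k) u.
Hypothesis cphi : forall k, classC N `[-1, 1] (phi k).
Variables (delta X : R) (F : nat).
Hypotheses (d0 : 0 < delta) (dX : delta^-1 = X) (FX : F%:R <= X < F.+1%:R).
Implicit Types (f g : 'rV[R]_n -> R[i]) (x xi eta : 'rV[R]_n).

(** [W k ^+ 2] undoes the factor [(W k)^-1] in each of the two cut-offs [phi k]. *)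
Definition coef (k i : nat) : R[i] := fourier_coef psi k *
  expi (fourier_freq R k * ((X - (F%:R - i%:R)) / 4)) * ((W k ^+ 2)%:C)%C.

Definition superpos (m : nat) f g x : R[i] := \sum_(k < m) \sum_(i < 10)
  coef k i * Bop (phi k) (phi k) delta (delta * (F%:R - i%:R)) f g x.

Lemma normc_expi (t : R) : normc (expi t) = 1.
Proof. by rewrite /normc /expi cos2Dsin2 sqrtr1. Qed.

Lemma integrableC_invF (G : 'rV[R]_n -> R[i]) x : schwartz G ->
  integrableC (fun xi => expi (2 * pi * dot x xi) * G xi).
Proof.
move=> [sr si].
have ReE : Re \o (fun xi => expi (2 * pi * dot x xi) * G xi) =
    fun xi => cos (2 * pi * dot xi x + 0) * (Re \o G) xi -
              cos (2 * pi * dot xi x - pi / 2) * (Im \o G) xi.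
  by apply/funext => xi /=; rewrite complex_ReM/= dotC addr0 cosBpihalf.
have ImE : Im \o (fun xi => expi (2 * pi * dot x xi) * G xi) =
    fun xi => cos (2 * pi * dot xi x + 0) * (Im \o G) xi +
              cos (2 * pi * dot xi x - pi / 2) * (Re \o G) xi.
  by apply/funext => xi /=; rewrite complex_ImM/= dotC addr0 cosBpihalf.
split; rewrite ?ReE ?ImE.
  exact: (integrableB measurableT (integrable_cosM _ _ sr) (integrable_cosM _ _ si)).
exact: (integrableD measurableT (integrable_cosM _ _ si) (integrable_cosM _ _ sr)).
Qed.

(** Gives the superposition the iterated form of [Btilde], so that comparing the operators amounts
    to comparing kernels. *)
Lemma superpos_iint (m : nat) f g x : schwartz f -> schwartz g ->
  iint (fun eta xi => \sum_(k < m) \sum_(i < 10) \sum_(j < F.+1) coef k i *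
    ((expi (2 * pi * dot x xi) * (phi k ((sqnorm xi - delta * j%:R) / delta) * fourier f xi)) *
     (expi (2 * pi * dot x eta) * (phi k ((sqnorm eta -
        (delta * (F%:R - i%:R) - delta * j%:R)) / delta) * fourier g eta))))
    (superpos m f g x).
Proof.
move=> sf sg; have Fd : F%:R <= delta^-1 < F.+1%:R by rewrite dX.
rewrite /superpos; apply: (iint_sum (I := 'I_m)) => k; apply: (iint_sum (I := 'I_10)) => i.
rewrite (Bop_sum _ _ _ _ _ _ d0 Fd) mulr_sumr.
apply: (iint_sum (I := 'I_F.+1)) => j; apply: iintZ.
have [s1 ->] := Sop_invF (delta * j%:R) d0 (cphi k) sf.
have [s2 ->] := Sop_invF (delta * (F%:R - i%:R) - delta * j%:R) d0 (cphi k) sg.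
by apply: iint_prod; exact: integrableC_invF.
Qed.

Lemma superpos_kernel (m : nat) (f' g' e1 e2 : R[i]) (s t : R) :
  \sum_(k < m) \sum_(i < 10) \sum_(j < F.+1) coef k i *
    ((e1 * (phi k ((s - delta * j%:R) / delta) * f')) *
     (e2 * (phi k ((t - (delta * (F%:R - i%:R) - delta * j%:R)) / delta) * g'))) =
  e1 * e2 * f' * g' * \sum_(k < m) \sum_(i < 10) \sum_(j < F.+1)
    (fourier_coef psi k * expi (fourier_freq R k * ((X - (F%:R - i%:R)) / 4))) *
    (osc alpha psi (fourier_freq R k) (s / delta - j%:R) *
     osc alpha psi (fourier_freq R k) (t / delta - (F%:R - i%:R) + j%:R)).
Proof.
rewrite mulr_sumr; apply: eq_bigr => k _; rewrite mulr_sumr; apply: eq_bigr => i _.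
rewrite mulr_sumr; apply: eq_bigr => j _; rewrite /coef /phi.
have dn : delta != 0 by rewrite gt_eqF.
have -> : (s - delta * j%:R) / delta = s / delta - j%:R by field.
have -> : (t - (delta * (F%:R - i%:R) - delta * j%:R)) / delta =
    t / delta - (F%:R - i%:R) + j%:R by field.
have WE : ((W k ^+ 2)%:C)%C * ((((W k)^-1)%:C)%C * (((W k)^-1)%:C)%C) = 1 :> R[i].
  by rewrite -!rmorphM/= expr2 mulrACA mulfV ?gt_eqF// mulr1 rmorph1.
move: WE; move: (osc _ _ _ _) (osc _ _ _ _) (((W k)^-1)%:C)%C ((W k ^+ 2)%:C)%C => o1 o2 w1 w2 WE.
transitivity (e1 * e2 * f' * g' * (fourier_coef psi k *
  expi (fourier_freq R k * ((X - (F%:R - i%:R)) / 4)) * (o2 * o1)) * (w2 * (w1 * w1))); first by ring.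
by rewrite WE mulr1.
Qed.

(** [delta] is here the fine scale, hence the target at [4 * delta]. Convergence of moduli is all
    that [normLp] sees. *)
Lemma superpos_cvg f g x : schwartz f -> schwartz g ->
  normc (superpos M.+1.*2 f g x) @[M --> \oo] --> normc (Btilde psi (4 * delta) f g x).
Proof.
move=> sf sg; have [C C0 HC] := kernel_approx tp dr.
pose h (G : 'rV[R]_n -> R[i]) xi := `|Re (G xi)| + `|Im (G xi)|.
have ih G : schwartz G -> (leb R n).-integrable setT (EFin \o h G).
  move=> [sr si].
  exact: (integrableD measurableT (integrable_norm (schwartzR_integrable sr))
    (integrable_norm (schwartzR_integrable si))).
apply: (iint_limit (h1 := h (fourier f)) (h2 := h (fourier g))
  (e := fun M => C * F.+1%:R / M.+1%:R) (fun M => superpos_iint M.+1.*2 x sf sg)).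
- exact: ih (fourier_schwartz sf).
- exact: ih (fourier_schwartz sg).
- rewrite -(mulr0 (C * F.+1%:R)).
  by apply: cvgM; [exact: cvg_cst|exact: cvg_harmonic].
move=> M eta xi; rewrite superpos_kernel dotDr (mulrDr (2 * pi)) expiD.
have -> : (1 - sqnorm xi - sqnorm eta) / (4 * delta) =
    (X - sqnorm xi / delta - sqnorm eta / delta) / 4.
  by rewrite -dX; field; rewrite gt_eqF.
have S0 (y : 'rV[R]_n) : 0 <= sqnorm y / delta.
  by apply: divr_ge0; [apply: sumr_ge0 => i _; rewrite -expr2 sqr_ge0|exact: ltW].
have := HC X (sqnorm xi / delta) (sqnorm eta / delta) F M (S0 _) (S0 _) FX.
set Q := \sum_(k < _) _; set P := psi _ => QP.
set e1 := expi _; set e2 := expi _.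
have -> : e1 * e2 * fourier f xi * fourier g eta * Q -
    e1 * e2 * P * fourier f xi * fourier g eta =
    e1 * e2 * (Q - P) * (fourier f xi * fourier g eta) by ring.
rewrite !ComplexField.Normc.normcM !normc_expi !mul1r.
apply: ler_pM; rewrite ?mulr_ge0 ?normc_ge0//.
by apply: ler_pM; rewrite ?normc_ge0//; exact: normc_le_ReIm.
Qed.

Lemma measurableC_Bop k i f g : schwartz f -> schwartz g ->
  measurableC (Bop (phi k) (phi k) delta (delta * (F%:R - i%:R)) f g : 'rV[R]_n -> R[i]).
Proof.
move=> sf sg.
rewrite (_ : Bop _ _ _ _ f g = fun x => \sum_(j < F.+1)
    Sop (phi k) (delta * j%:R) delta f x *
    Sop (phi k) (delta * (F%:R - i%:R) - delta * j%:R) delta g x); last first.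
  by apply/funext => x; rewrite (Bop_sum _ _ _ _ _ _ d0 (F := F)) ?dX.
have mS rho h : schwartz h -> measurableC (Sop (phi k) rho delta h : 'rV[R]_n -> R[i]).
  move=> sh; have [sG ->] := Sop_invF rho d0 (cphi k) sh.
  by have [s1 s2] := invF_schwartz sG; split; exact: schwartzR_measurable.
by apply: measurableC_sum => j; apply: measurableCM; exact: mS.
Qed.

Lemma normLp_superpos (m : nat) f g (r Y : \bar R) : (1 <= r)%E -> (0 <= Y)%E ->
  schwartz f -> schwartz g ->
  (forall k i, (i < 10)%N ->
     (normLp r (Bop (phi k) (phi k) delta (delta * (F%:R - i%:R)) f g) <= Y)%E) ->
  (normLp r (superpos m f g) <=
    (\sum_(k < m) \sum_(i < 10) normc (fourier_coef psi k) * W k ^+ 2)%:E * Y)%E.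
Proof.
move=> r1 Y0 sf sg HY.
pose I := ('I_m * 'I_10)%type.
pose c (t : I) := normc (fourier_coef psi t.1) * W t.1 ^+ 2.
pose G (t : I) x := normc (Bop (phi t.1) (phi t.1) delta (delta * (F%:R - (t.2 : nat)%:R)) f g x).
have c0 t : 0 <= c t by rewrite mulr_ge0 ?normc_ge0// exprn_ge0// ltW.
have mG t : measurable_fun setT (G t) by apply: measurableC_normc; exact: measurableC_Bop.
have cE k i : normc (coef k i) = normc (fourier_coef psi k) * W k ^+ 2.
  rewrite /coef !ComplexField.Normc.normcM normc_expi mulr1; congr (_ * _).
  by rewrite /normc /= expr0n /= addr0 sqrtr_sqr ger0_norm// exprn_ge0// ltW.
have msup : measurable_fun setT (fun x => normc (superpos m f g x)).
  apply: measurableC_normc; apply: measurableC_sum => k; apply: measurableC_sum => i.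
  by apply: measurableCM; [exact: measurableC_cst|exact: measurableC_Bop].
have mR : measurable_fun setT (fun x => \sum_(t : I) c t * G t x).
  by apply: measurable_sum => t; exact: measurable_funM.
apply: (@le_trans _ _ (Lnorm (leb R n) r (EFin \o (fun x => \sum_(t : I) c t * G t x)))).
  apply: Lnorm_le => // x; rewrite ger0_norm ?normc_ge0//.
  apply: le_trans (ler_norm _); rewrite /superpos pair_bigA /=.
  rewrite (le_trans (normc_sum _ _))//; apply: ler_sum => t _.
  by rewrite ComplexField.Normc.normcM cE.
apply: (le_trans (Lnorm_sum_le _ _ r1 c0 mG)).
rewrite pair_bigA /= -sumEFin ge0_sume_distrl; last by move=> t _; rewrite lee_fin; exact: c0.
apply: lee_sum => t _; apply: lee_wpmul2l; first by rewrite lee_fin.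
exact: HY.
Qed.

End Superposition.

(** * Transfer of the bound to [Btilde] *)

Section Transfer.
Variables (R : realType) (alpha : R) (psi : R -> R[i]).
Hypotheses (tp : test_function `]1/2, 2[ psi) (dr : dyadic_resolution alpha psi).

Lemma sum_inv_pronic (m : nat) :
  \sum_(k < m) (k.+1%:R * k.+2%:R : R)^-1 = 1 - m.+1%:R^-1.
Proof.
elim: m => [|m IH]; first by rewrite big_ord0 invr1 subrr.
have m1 : (0 : R) < m.+1%:R by rewrite ltr0n.
rewrite big_ord_recr /= IH -(natr1 m.+1); field.
by apply/andP; split; rewrite gt_eqF// ltr_wpDl// ltW.
Qed.

(** The square of the normalization grows like the power [N + N] of the frequency, which is the
    order of decay requested; the remaining sum telescopes below 1. *)
Lemma weighted_coef_sum (N : nat) (C : R) : exists2 K : R, 0 <= K & forall m : nat,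
  \sum_(k < m) \sum_(i < 10)
    normc (fourier_coef psi k) * (C * (1 + `|fourier_freq R k|) ^+ N) ^+ 2 <= K.
Proof.
have [C1 C10 H] := fourier_coef_decay (N + N) tp.
have K0 : 0 <= C ^+ 2 * C1 * 10 by rewrite mulr_ge0// mulr_ge0// sqr_ge0.
exists (C ^+ 2 * C1 * 10) => // m; apply: (@le_trans _ _ (\sum_(k < m) (C ^+ 2 * C1 * 10) * (k.+1%:R * k.+2%:R)^-1)).
  apply: ler_sum => k _; rewrite sumr_const card_ord -[leLHS]mulr_natr.
  have -> : normc (fourier_coef psi k) * (C * (1 + `|fourier_freq R k|) ^+ N) ^+ 2 =
      C ^+ 2 * (normc (fourier_coef psi k) * (1 + `|fourier_freq R k|) ^+ (N + N)).
    by rewrite exprMn exprD -expr2; ring.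
  have -> : C ^+ 2 * C1 * 10 * (k.+1%:R * k.+2%:R)^-1 =
      C ^+ 2 * (C1 / (k.+1%:R * k.+2%:R)) * 10 by ring.
  by apply: ler_wpM2r => //; apply: ler_wpM2l; [exact: sqr_ge0|exact: H].
by rewrite -mulr_sumr sum_inv_pronic ler_piMr ?lerBlDr ?lerDl ?invr_ge0.
Qed.

Lemma normLp_limit (n : nat) (r B : \bar R) (F_ : nat -> 'rV[R]_n -> R[i]) F :
  (1 <= r)%E -> (forall k, measurableC (F_ k)) ->
  (forall x, normc (F_ k x) @[k --> \oo] --> normc (F x)) ->
  (forall k, (normLp r (F_ k) <= B)%E) -> (normLp r F <= B)%E.
Proof.
move=> r1 mF cF; case: B => [b| |] bF; last 2 first.
- exact: leey.
- by have := le_trans (Lnorm_ge0 _ _ _) (bF 0%N).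
by apply: (Lnorm_fatou r1 (fun k => measurableC_normc (mF k)) cF) => k; exact: bF.
Qed.

(** [K] is fixed before [delta] and the exponents, so all dependence on [delta] sits in [B]. *)
Lemma Btilde_bound (n N : nat) : exists2 K : R, 0 <= K &
  forall (delta B : R) (p q r : \bar R), 0 < delta <= 1/10 -> 0 <= B -> (1 <= r)%E ->
  (forall varrho phi (f g : 'rV[R]_n -> R[i]), 1/2 <= varrho <= 2 ->
    classC N `[-1, 1] phi -> schwartz f -> schwartz g ->
    (normLp r (Bop phi phi (delta / 4) varrho f g) <= B%:E * normLp p f * normLp q g)%E) ->
  forall f g : 'rV[R]_n -> R[i], schwartz f -> schwartz g ->
    (normLp r (Btilde psi delta f g) <= (K * B)%:E * normLp p f * normLp q g)%E.
Proof.
have [C C0 HC] := osc_classC alpha tp N.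
pose W k := C * (1 + `|fourier_freq R k|) ^+ N.
have W0 k : 0 < W k by rewrite mulr_gt0// exprn_gt0// ltr_pwDl.
have cphi k := HC (fourier_freq R k) (W k) (lexx _) (W0 k).
have [K K0 HK] := weighted_coef_sum N C; exists K => //.
move=> delta B p q r /andP[d0 d1] B0 r1 HB f g sf sg.
have d40 : 0 < delta / 4 by lra.
set X := (delta / 4)^-1.
have X40 : 40 <= X by rewrite -[40]invrK lef_pV2 ?posrE ?invr_gt0 ?ltr0n//; lra.
pose F := Num.truncn X.
have FX : F%:R <= X < F.+1%:R by apply: truncn_itv; lra.
have dX : (delta / 4) * X = 1 by rewrite mulfV// gt_eqF.
(* [F - i > X - 10], so the product exceeds [1 - 10 / X >= 3/4]; it is at most 1. *)
have vr (i : nat) : (i < 10)%N -> 1/2 <= (delta / 4) * (F%:R - i%:R) <= 2.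
  move=> i10; have i9 : (i%:R : R) <= 9 by rewrite (ler_nat R i 9) -ltnS.
  have i0 : 0 <= (i%:R : R) by [].
  by case/andP: FX; rewrite -natr1 => F1 F2; apply/andP; split; nra.
pose Y := (B%:E * normLp p f * normLp q g)%E.
have Y0 : (0 <= Y)%E by rewrite !mule_ge0 ?lee_fin ?Lnorm_ge0.
rewrite EFinM -!muleA (muleA B%:E) -/Y.
have -> : delta = 4 * (delta / 4) by field.
apply: (@normLp_limit _ _ _ (fun M => superpos alpha psi W (delta / 4) X F M.+1.*2 f g)) => //.
- move=> M; apply: measurableC_sum => k; apply: measurableC_sum => i.
  apply: measurableCM; first exact: measurableC_cst.
  exact: (measurableC_Bop cphi d40 (erefl X) FX).
- move=> x; exact: (superpos_cvg tp dr W0 cphi d40 (erefl X) FX).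
move=> M; apply: (le_trans (normLp_superpos W0 cphi d40 (erefl X) FX M.+1.*2 r1 Y0 sf sg _)).
  by move=> k i i10; apply: HB => //; exact: vr.
by apply: lee_wpmul2r => //; rewrite lee_fin; exact: HK.
Qed.

End Transfer.

Theorem lemma3p1 (R : realType) (d : nat) (hd : (2 <= d)%N) :
  exists2 c : R, 0 < c < 1 &
  forall (delta0 : R) (hdelta0 : 0 < delta0 <= c)
    (alpha : R) (psi : R -> R[i]) (halpha : 0 < alpha)
    (hpsi : test_function `]1/2, 2[ psi) (hsum : dyadic_resolution alpha psi)
    (kappa : R) (hkappa : -1 <= kappa)
    (p q r : \bar R) (hp : (1 <= p)%E) (hq : (1 <= q)%E) (hr : (1 <= r)%E)
    (hpqr : (r^-1 <= p^-1 + q^-1)%E),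
  (exists (N : nat) (A : R), 0 < A /\
    forall (delta varrho : R) (phi1 phi2 : R -> R[i]),
      0 < delta <= delta0 -> 1/2 <= varrho <= 2 ->
      classC N `[-1, 1] phi1 -> classC N `[-1, 1] phi2 ->
      (opnorm (@Bop R d phi1 phi2 delta varrho) p q r
        <= (A * delta `^ (- kappa))%:E)%E) ->
  forall eps : R, 0 < eps ->
  exists Aeps : R, forall delta : R, 0 < delta <= delta0 ->
    (opnorm (@Btilde R d psi delta) p q r
      <= (Aeps * delta `^ (- kappa - eps * (1 + kappa)))%:E)%E.
Proof.
(* With this threshold the scale [delta / 4] is at most 1/40, which keeps the ten values of [varrho]
   in [1/2, 2]. *)
exists (1/10); first by apply/andP; split; lra.
move=> delta0 /andP[_ h0] alpha psi _ tp dr kappa hkappa p q r _ _ hr _ [N [A [A0 HA]]] eps eps0.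
have [K K0 HK] := Btilde_bound tp dr d N.
exists (K * ((A + 1) * 4^-1 `^ (- kappa))) => delta /andP[d0 d1].
(* [opnorm] is an infimum: the strict gain from [A] to [A + 1] lets an admissible constant below [B]
   be extracted. *)
pose B := (A + 1) * (delta / 4) `^ (- kappa).
have B0 : 0 <= B by rewrite mulr_ge0 ?powR_ge0//; lra.
have d40 : 0 < delta / 4 by lra.
apply: (@le_trans _ _ (K * B)%:E); last first.
  rewrite lee_fin -!mulrA /B powRM; [|exact: ltW|by rewrite invr_ge0].
  rewrite (mulrC (delta `^ _)); apply: ler_wpM2l => //; apply: ler_wpM2l; first lra.
  apply: ler_wpM2l; first exact: powR_ge0.
  (* As [delta <= 1] and [eps * (1 + kappa) >= 0], lowering the exponent can only increase the
     power. *)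
  apply: ger_powR; first by apply/andP; split; lra.
  by rewrite lerBlDr lerDl mulr_ge0//; lra.
apply: ereal_inf_lbound; exists (K * B) => //; split; first exact: mulr_ge0.
apply: (HK delta B p q r) => //; first by apply/andP; split; lra.
move=> varrho phi f g hv cphi sf sg.
have : (opnorm (@Bop R d phi phi (delta / 4) varrho) p q r < B%:E)%E.
  apply: (le_lt_trans (HA (delta / 4) varrho phi phi _ hv cphi cphi)).
    by apply/andP; split; lra.
  by rewrite lte_fin /B ltr_pM2r ?powR_gt0//; lra.
move=> /ereal_inf_lt[_ [b [b0 Hb] <-]]; rewrite lte_fin => bB.
apply: (le_trans (Hb f g sf sg)); rewrite -!muleA.
by apply: lee_wpmul2r; [rewrite mule_ge0 ?Lnorm_ge0|rewrite lee_fin ltW].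
Qed.
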